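(* Consider the following two assertions. (B') For every $n\ge 1$, all reduced complex analytic function germs $f,g\colon(\mathbb{C}^n,0)\to(\mathbb{C},0)$ and every germ of homeomorphism $\varphi\colon(\mathbb{C}^n,0)\to(\mathbb{C}^n,0)$ with $f=g\circ\varphi$: if at least one of the tangent cones $C(V(f),0)$, $C(V(g),0)$ is a linear subspace of $\mathbb{C}^n$, then there is a homeomorphism between $(C(V(f),0),0)$ and $(C(V(g),0),0)$, or there is a homeomorphism between $E_0(f)$ and $E_0(g)$. (A') For every $n\ge 1$, all reduced complex analytic function germs $f,g\colon(\mathbb{C}^n,0)\to(\mathbb{C},0)$ and every germ of homeomorphism $\varphi\colon(\mathbb{C}^n,0)\to(\mathbb{C}^n,0)$ with $f=g\circ\varphi$, one has $m(V(f),0)=m(V(g),0)$. If (B') is true, then (A') is true.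
   Context: $V(f)$ denotes the zero set (germ) of $f$. For a reduced holomorphic germ $f\colon(\mathbb{C}^n,0)\to(\mathbb{C},0)$ (in particular not identically zero, without repeated irreducible factors), write $f=f_m+f_{m+1}+\cdots$ with $f_k$ homogeneous of degree $k$ and $f_m\neq 0$. The multiplicity of $V(f)$ at $0$ is $m(V(f),0):=m$, and the tangent cone of $V(f)$ at $0$ is $C(V(f),0)=V(f_m)\subset\mathbb{C}^n$. Let $Bl_0(\mathbb{C}^n)=\{(x,[v])\in\mathbb{C}^n\times\mathbb{C}P^{n-1};\ x=\lambda v\text{ for some }\lambda\in\mathbb{C}\}$, with projection $\beta\colon Bl_0(\mathbb{C}^n)\to\mathbb{C}^n$. Put $Bl_0(V(f))=\overline{\beta^{-1}(V(f)\setminus\{0\})}$ and $E_0(f)=Bl_0(V(f))\cap(\{0\}\times\mathbb{C}P^{n-1})$; one has $E_0(f)=\{0\}\times\mathbb{P}C(V(f),0)$, where $\mathbb{P}C(V(f),0)\subset\mathbb{C}P^{n-1}$ is the projectivized tangent cone. A homeomorphism between $(A,0)$ and $(B,0)$ means a homeomorphism of germs at $0$ sending $0$ to $0$. *)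

(* Defs.v *)
From HB Require Import structures.
From mathcomp Require Import all_boot all_order all_algebra.
From mathcomp Require Import all_classical all_reals all_analysis.
From mathcomp Require Import complex.

Set Implicit Arguments.
Unset Strict Implicit.
Unset Printing Implicit Defensive.

Import Order.TTheory GRing.Theory Num.Theory.
Import numFieldNormedType.Exports.

Local Open Scope classical_set_scope.
Local Open Scope ring_scope.
Local Open Scope quotient_scope.

(* [R[i]] itself carries no topology in the library; typing it as a
   [numClosedFieldType] gives it the topology of its norm, and gives
   [C^n], i.e. ['rV[Cplx R]_n], the product topology. *)
Definition Cplx (R : realType) : numClosedFieldType := R[i].

(* A germ at [0] is represented by a total function: every notion below that
   takes such a function depends only on its restriction to a neighbourhood
   of [0]. *)

Section AnalyticGerms.
Variables (R : realType) (n : nat).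
Local Notation C := (Cplx R).
Local Notation Cn := 'rV[C]_n.
Implicit Types (f g h : Cn -> C) (x : Cn).

Definition mindex := {ffun 'I_n -> nat}.

Definition monomial (al : mindex) x : C := \prod_i x 0 i ^+ al i.

(* A multi-index of degree [k] has all its entries at most [k], so the
   multi-indices of degree [k] are enumerated by a finite type. *)
Definition degree_sum (k : nat) (F : mindex -> C) : C :=
  \sum_(b : {ffun 'I_n -> 'I_k.+1} | (\sum_i b i)%N == k)
     F [ffun i => b i : nat].

Definition hom_component (a : mindex -> C) (k : nat) x : C :=
  degree_sum k (fun al => a al * monomial al x).

Definition power_series_of f (a : mindex -> C) : Prop :=
  \forall x \near (0 : Cn),
    cvgn (series (fun k => degree_sum k (fun al => `|a al * monomial al x|)))
    /\ series (fun k => hom_component a k x) @ \oo --> f x.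

Definition analytic_germ f : Prop := exists a, power_series_of f a.

Definition germ_eq f g : Prop := \forall x \near (0 : Cn), f x = g x.

Definition germ_dvd f g : Prop :=
  exists2 q, analytic_germ q & germ_eq g (fun x => q x * f x).

Definition germ_unit f : Prop := analytic_germ f /\ germ_dvd f (cst 1).

Definition germ_irreducible f : Prop :=
  [/\ analytic_germ f, ~ germ_eq f (cst 0), ~ germ_unit f
    & forall g h, analytic_germ g -> analytic_germ h ->
        germ_eq f (fun x => g x * h x) -> germ_unit g \/ germ_unit h].

Definition reduced_germ f : Prop :=
  [/\ analytic_germ f, f 0 = 0, ~ germ_eq f (cst 0)
    & forall h, germ_irreducible h -> ~ germ_dvd (fun x => h x ^+ 2) f].

(* The power series of an analytic germ is unique, so that the choices made
   by [xget] here and in [multiplicity] are forced for a nonzero analytic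
   germ. *)
Definition taylor f : mindex -> C :=
  xget (fun=> 0) [set a | power_series_of f a].

Definition homogeneous_part f (k : nat) : Cn -> C :=
  hom_component (taylor f) k.

Definition multiplicity f : nat :=
  xget 0%N [set m | homogeneous_part f m <> cst 0 /\
                    forall k, (k < m)%N -> homogeneous_part f k = cst 0].

Definition zero_set f : set Cn := [set x | f x = 0].

Definition tangent_cone f : set Cn :=
  zero_set (homogeneous_part f (multiplicity f)).

Definition linear_subspace (A : set Cn) : Prop :=
  exists W : {vspace Cn}, A = [set x | x \in W].

End AnalyticGerms.

Section Homeomorphisms.
Variables (T U : topologicalType).

Definition homeo_on (A : set T) (B : set U) (h : T -> U) (k : U -> T) : Prop :=
  [/\ set_fun A B h, set_fun B A k,
      (forall x, A x -> k (h x) = x), (forall y, B y -> h (k y) = y)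
    & {within A, continuous h} /\ {within B, continuous k}].

Definition homeomorphic_sets (A : set T) (B : set U) : Prop :=
  exists h k, homeo_on A B h k.

End Homeomorphisms.

(* [h] represents a homeomorphism of germs [(A, 0) -> (B, 0)]. *)
Definition germ_homeo (R : realType) (n : nat) (A B : set 'rV[Cplx R]_n)
    (h : 'rV[Cplx R]_n -> 'rV[Cplx R]_n) : Prop :=
  h 0 = 0 /\
  exists (U V : set 'rV[Cplx R]_n) (k : 'rV[Cplx R]_n -> 'rV[Cplx R]_n),
    [/\ open_nbhs (0 : 'rV[Cplx R]_n) U, open_nbhs (0 : 'rV[Cplx R]_n) V
       & homeo_on (A `&` U) (B `&` V) h k].

Section Projectivization.
Variables (R : realType) (n : nat).
Local Notation C := (Cplx R).
Local Notation Cn := 'rV[C]_n.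

Definition punctured : set Cn := [set v | v != 0].

Definition collinear (u v : punctured) : bool :=
  `[< exists2 c : C, c != 0 & val u = c *: val v >].

Lemma collinear_refl : reflexive collinear.
Proof. by move=> u; apply/asboolP; exists 1; rewrite ?oner_neq0 ?scale1r. Qed.

Lemma collinear_sym : symmetric collinear.
Proof.
suff H u v : collinear u v -> collinear v u by move=> u v; apply/idP/idP; exact: H.
move=> /asboolP[c c0 uv]; apply/asboolP; exists c^-1; first by rewrite invr_eq0.
by rewrite uv scalerA mulVf // scale1r.
Qed.

Lemma collinear_trans : transitive collinear.
Proof.
move=> v u w /asboolP[c c0 uv] /asboolP[d d0 vw]; apply/asboolP.
by exists (c * d); rewrite ?mulf_neq0 // uv vw scalerA.
Qed.

Canonical collinear_equiv :=
  EquivRel collinear collinear_refl collinear_sym collinear_trans.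

(* [CP^(n-1)] with the quotient topology of [C^n \ {0}]. *)
Definition projective := quotient_topology {eq_quot collinear}.

Definition pclass (v : punctured) : projective := \pi_{eq_quot collinear} v.

Definition blowup : set (Cn * projective) :=
  [set p | exists (v : punctured) (c : C), p.2 = pclass v /\ p.1 = c *: val v].

(* The closure is taken in the subspace [blowup]. *)
Definition blowup_hypersurface (f : Cn -> C) : set (Cn * projective) :=
  blowup `&`
  closure (blowup `&` [set p | (zero_set f `\ 0) p.1]).

Definition exceptional_fiber (f : Cn -> C) : set (Cn * projective) :=
  blowup_hypersurface f `&` [set p | p.1 = 0].

End Projectivization.

Arguments punctured : clear implicits.
Arguments projective : clear implicits.
Arguments blowup : clear implicits.

(* Main.v *)
(* Suppose m(f) = a < b = m(g); inverting phi covers the other case. On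
   C^(n+2), with coordinates (x, z, y) and k = 2a + 2, put
   F = f(x)^2 z + y^k and G = g(x)^2 z + y^k. Both are reduced, because the
   derivative of y^k detects square factors, and F = G o (phi x id x id). Since
   2a + 1 < k < 2b + 1, the initial part of F is f_a(x)^2 z and that of G is y^k,
   so C(V(G), 0) is the hyperplane y = 0 and (B') applies to F and G.
   Both of its conclusions are absurd. The cone of F contains the hyperplane
   z = 0 and, in addition, the z-axis, but for f_a(w) <> 0 the map
   (x, z, y) |-> (x - z w, y) vanishes on it only at 0 and restricts to a chart
   of z = 0. A homeomorphism onto a complex vector space of the same dimension
   would then make the hyperplane a neighbourhood of 0 in the cone, by an
   invariance-of-domain argument that needs only the Poincare-Miranda theorem.
   The same argument applies to E_0(F) at the point [0 : 0 : 1] and to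
   E_0(G), the projectivized hyperplane y = 0. *)

Require Import Defs.
From mathcomp Require Import all_boot all_order all_fingroup all_algebra.
From mathcomp Require Import complex interval_inference ring lra zify.
From mathcomp Require Import all_classical all_reals all_analysis.
Set Implicit Arguments.
Unset Strict Implicit.
Unset Printing Implicit Defensive.
Import Order.TTheory GRing.Theory Num.Theory.
Import numFieldNormedType.Exports.
Local Open Scope classical_set_scope.
Local Open Scope ring_scope.

(** * A mod 2 Sperner lemma on cubes *)

(** The factor [z] makes the cone of F reducible: without it, that cone would be the zero set of f_a
    times a line, which may itself be a hyperplane. Squaring f opens a gap between the degrees: 2a +
    1 and 2b + 1 always enclose an even number, whereas a + 1 and b + 1 enclose no integer when b =
    a + 1. The germ f(x)^2 z is not reduced, but adding y^k repairs this.

    Full invariance of domain is avoided because the embedding to be excluded comes with a left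
    inverse that is continuous on a whole neighbourhood, not merely on the image, and whose zero is
    isolated. That left inverse is the chart map of the overview composed with the inverse
    homeomorphism.

    Poincare-Miranda rests on a count of simplices modulo 2, so no orientation or sign appears. The
    count is written as a cup product of coboundaries of labels, and Stokes' formula lowers the
    dimension.

    The exceptional fibers are not computed in full. They are bounded from above by the initial
    form, and explicit points of the zero set reach the directions that the contradiction uses. *)

Section CharTwo.
Variables (K : comNzRingType) (K2 : forall x : K, x + x = 0).

Lemma addr_eq0_char2 (x y : K) : x + y = 0 -> x = y.
Proof. by move=> xy; rewrite -[x]addr0 -(K2 y) addrA xy add0r. Qed.

(* [d o d = 0] for the cup product of the [m] coboundaries [d (b j)], evaluated
   on a simplex with vertices [0, ..., m.+1]. *)
Lemma cup_coboundary (b : nat -> nat -> K) m :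
  \sum_(l < m.+2) \prod_(j < m) (b j (bump l j.+1) + b j (bump l j)) = 0.
Proof.
elim: m => [|m IHm].
  by rewrite !big_ord_recr big_ord0 /= !big_ord0 add0r K2.
pose s := \prod_(j < m) (b j j.+1 + b j j).
have bs l : (m < l)%N ->
    \prod_(j < m) (b j (bump l j.+1) + b j (bump l j)) = s.
  move=> ml; apply: eq_bigr => j _.
  have jl : (j.+1 < l)%N by apply: leq_ltn_trans ml.
  by rewrite /bump leqNgt jl leqNgt (ltnW jl).
have IH : \sum_(l < m.+1) \prod_(j < m) (b j (bump l j.+1) + b j (bump l j)) = s.
  by move: IHm; rewrite big_ord_recr /= bs // => /addr_eq0_char2.
rewrite 2!big_ord_recr /=.
have -> : \sum_(i < m.+1) \prod_(j < m.+1)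
    (b j (bump i j.+1) + b j (bump i j)) = s * (b m m.+2 + b m m.+1).
  rewrite -IH mulr_suml; apply: eq_bigr => l _; rewrite big_ord_recr /=.
  have lm : (l <= m)%N by rewrite -ltnS.
  by rewrite /bump lm leqW // !add1n.
rewrite (big_ord_recr m) /= (big_ord_recr m) /= !bs // -!mulrDr.
have F : (m.+1 < m)%N = false by rewrite ltnNge leqnSn.
rewrite /bump !ltnn leqnn F !add0n !add1n.
by rewrite [X in s * (X + _)]addrACA !K2 add0r K2 mulr0.
Qed.

(** An involution that flips [odd] has no fixed point, so the terms pair off and cancel in
    characteristic 2. *)
Lemma sum_involution (T : finType) (P odd : pred T) (f : T -> T) (F : T -> K) :
  involutive f -> {mono f : x / P x} -> (forall x, odd (f x) = ~~ odd x) ->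
  (forall x, P x -> F (f x) = F x) -> \sum_(x | P x) F x = 0.
Proof.
move=> fK Pf of_ Ff; rewrite (bigID odd) /= [X in _ + X](reindex_inj (inv_inj fK)) /=.
rewrite [X in _ + X](eq_big (fun x => P x && odd x) F) ?K2 // => x.
  by rewrite Pf of_ negbK.
by rewrite Pf => /andP[/Ff].
Qed.

Section Grid.
Variables (M k : nat) (k_gt0 : (0 < k)%N) (a : nat -> {ffun 'I_M -> nat} -> K).
Hypothesis a0 : forall (i : 'I_M) (v : {ffun 'I_M -> nat}), v i = 0%N -> a i v = 0.
Hypothesis ak : forall (i : 'I_M) (v : {ffun 'I_M -> nat}), v i = k -> a i v = 1.

Local Notation point := {ffun 'I_M -> 'I_k.+1}.
Implicit Types (x : point) (s : 'S_M) (i c : 'I_M).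

(* [vtx x s j] is the [j]-th vertex of the simplex of Kuhn's triangulation
   that starts at [x] and moves successively along [s 0], [s 1], ... *)
Definition vtx x s j : {ffun 'I_M -> nat} :=
  [ffun c => (x c + ((s^-1)%g c < j))%N].

(** A simplex of dimension [m] in the face where the coordinates below [M - m] equal [k] uses only
    the first [m] steps of [s]. Freezing the other values counts each such simplex once. *)
Definition fits m s := [forall i : 'I_M, (m <= i)%N ==> (s i == rev_ord i)].

Definition box m x :=
  [forall c : 'I_M, if (M - m <= c)%N then (x c < k)%N else x c == k :> nat].

(** The cup product of the coboundaries of the labels [M - m], ..., [M - 1], evaluated on a simplex
    of dimension [m]; [cupsum] integrates it over one face of the cube. *)
Definition cup m x s :=
  \prod_(j < m) (a (M - m + j)%N (vtx x s j.+1) + a (M - m + j)%N (vtx x s j)).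

Definition cupsum m := \sum_(s | fits m s) \sum_(x | box m x) cup m x s.

Lemma cupsum0 : cupsum 0 = 1.
Proof.
pose r : 'S_M := perm (@rev_ord_inj M).
rewrite /cupsum (big_pred1 r) => [|s].
  rewrite (big_pred1 [ffun => ord_max]) /cup ?big_ord0 // => x.
  apply/forallP/eqP => [xk|-> c]; last by rewrite subn0 leqNgt ltn_ord ffunE eqxx.
  by apply/ffunP=> c; apply/val_inj/eqP; move: (xk c); rewrite subn0 leqNgt ltn_ord ffunE.
apply/forallP/eqP => [sr|-> i]; last by rewrite permE eqxx.
by apply/permP => i; rewrite permE; apply/eqP/(implyP (sr i)).
Qed.

Section Step.
Variables (m : nat) (mM : (m < M)%N).
Let pos j (jm : (j <= m)%N) : 'I_M := Ordinal (leq_ltn_trans jm mM).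
Let om : 'I_M := Ordinal mM.
Let c0 : 'I_M := rev_ord om.

(** The cochain [a c0] cup the coboundaries of the later labels, on the face opposite vertex [l]:
    [bump l] enumerates the remaining vertices. *)
Definition face l x s :=
  a c0 (vtx x s (bump l 0)) *
  \prod_(j < m) (a (M - m + j)%N (vtx x s (bump l j.+1))
                + a (M - m + j)%N (vtx x s (bump l j))).

(** This is d(a cup w) = da cup w for a closed cochain w. In the expansion of the first factor,
    [cup_coboundary] trades the term weighted by the label of vertex 0 for the faces that contain
    vertex 0. *)
Lemma cup_faces x s : cup m.+1 x s = \sum_(l < m.+2) face l x s.
Proof.
have /= := cup_coboundary (fun j l => a (M - m + j)%N (vtx x s l)) m.
rewrite big_ord_recl /= => /addr_eq0_char2 E.
have EM : (M - m = (M - m.+1).+1)%N by rewrite subnSK.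
rewrite /cup big_ord_recl /= big_ord_recl /= /face addn0.
transitivity ((a (M - m.+1)%N (vtx x s 1) + a (M - m.+1)%N (vtx x s 0)) *
   \prod_(i < m) (a (M - m + i)%N (vtx x s i.+2)
                + a (M - m + i)%N (vtx x s i.+1))).
  by congr (_ * _); apply: eq_bigr => i _; rewrite /bump /= !add1n EM addSnnS.
rewrite mulrDl; congr (_ + _); rewrite [X in _ * X](_ : _ = \sum_(i < m.+1)
    \prod_(j < m) (a (M - m + j)%N (vtx x s (bump i.+1 j.+1))
                  + a (M - m + j)%N (vtx x s (bump i.+1 j)))) ?mulr_sumr //.
Qed.

Lemma fits_ge s i : fits m.+1 s -> (m < i)%N -> s i = rev_ord i.
Proof. by move=> /forallP /(_ i) /implyP H /H /eqP. Qed.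

Lemma fits_mul s (t : 'S_M) : (forall i, (m < i)%N -> t i = i) ->
  fits m.+1 (t * s)%g = fits m.+1 s.
Proof.
move=> ti; apply: eq_forallb => i.
by case: ltnP => //= mi; rewrite permM ti.
Qed.

(** Exchanging the steps [l] and [l.+1] moves only vertex [l.+1], which this face omits; the two
    simplices that share the face cancel. *)
Lemma sum_inner_face (l : 'I_m) x :
  \sum_(s | fits m.+1 s) face l.+1 x s = 0.
Proof.
have lm : (l < m)%N by [].
pose i := pos (ltnW lm); pose j := pos lm.
have ij : i != j by rewrite -val_eqE /= neq_ltn leqnn.
apply: (sum_involution (odd := fun s : 'S_M => s) (f := mulg (tperm i j))).
- by move=> s; rewrite mulgA tperm2 mul1g.
- move=> s; rewrite fits_mul // => h mh; rewrite tpermD // -val_eqE /=.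
    by rewrite neq_ltn (leq_trans _ mh) // ltnW.
  by rewrite neq_ltn (leq_trans _ mh) // !ltnS.
- by move=> s; rewrite odd_mul_tperm ij.
move=> s _.
have E h : vtx x (tperm i j * s)%g (bump l.+1 h) = vtx x s (bump l.+1 h).
  apply/ffunP => c; rewrite !ffunE invMg tpermV permM; congr (_ + nat_of_bool _)%N.
  have B : (l.+1 < bump l.+1 h)%N = (l < bump l.+1 h)%N.
    by rewrite /bump; lia.
  by case: tpermP => [->|->|] //=.
by rewrite /face E; congr (_ * _); apply: eq_bigr => h _; rewrite !E.
Qed.

(** The cycle 0 -> 1 -> ... -> m -> 0 on positions: composed with [s], it moves the first step to
    position [m]. *)
Definition step_rot_fun (i : 'I_M) : 'I_M :=
  if ltnP i m is LtnNotGeq im then pos im else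
  if i == om then pos (leq0n m) else i.

Lemma val_step_rot i :
  step_rot_fun i = (if (i < m)%N then i.+1 else if (i == m :> nat) then 0 else i)%N :> nat.
Proof. by rewrite /step_rot_fun; case: ltnP => // im; rewrite -val_eqE /=; case: eqP. Qed.

Lemma step_rot_inj : injective step_rot_fun.
Proof.
move=> i j /(congr1 val) /=; rewrite !val_step_rot => E; apply/val_inj => /=.
by move: E; do 2 case: ltnP => ?; do ?[case: eqP => ?]; lia.
Qed.

Definition step_rot : 'S_M := perm step_rot_inj.

Lemma fits_rot s : fits m.+1 (step_rot * s)%g = fits m.+1 s.
Proof.
apply: fits_mul => i mi; apply/val_inj; rewrite permE /= val_step_rot.
by rewrite ltnNge ltnW //= gtn_eqF.
Qed.

Lemma lt_step_rot i j : (j <= m)%N ->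
  (i < j.+1)%N = (i == 0%N :> nat) || ((step_rot^-1)%g i < j)%N.
Proof.
move=> jm; have := permKV step_rot i; set h := (step_rot^-1)%g i.
rewrite permE => <-; rewrite val_step_rot.
by case: (ltnP h m) => ?; [|case: (eqVneq (h : nat) m) => ?]; lia.
Qed.

Definition incr c x : point :=
  [ffun d => if d == c then inord (x d).+1 else x d].

Definition rest c x := [forall d : 'I_M, (d != c) ==>
  (if (M - m.+1 <= d)%N then (x d < k)%N else x d == k :> nat)].

Lemma box_rest c x : (M - m.+1 <= c)%N ->
  box m.+1 x = rest c x && (x c < k)%N.
Proof.
move=> mc; apply/forallP/andP => [bx|[/forallP rx xc] d].
  split; last by have := bx c; rewrite mc.
  by apply/forallP => d; apply/implyP.
by have [->|dc] := eqVneq d c; [rewrite mc|apply: (implyP (rx d))].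
Qed.

Lemma val_incr c x d : (x c < k)%N -> incr c x d = (x d + (d == c))%N :> nat.
Proof.
move=> xc; rewrite ffunE; case: eqP => [->|] //=; last by rewrite addn0.
by rewrite inordK ?addn1.
Qed.

(** On each grid line in direction [c] the intermediate terms occur twice and cancel in
    characteristic 2; the two ends remain. *)
Lemma sum_telescope c (G : point -> K) : (M - m.+1 <= c)%N ->
  \sum_(x | box m.+1 x) (G (incr c x) + G x) =
  \sum_(x | rest c x && (x c == k :> nat)) G x +
  \sum_(x | rest c x && (x c == 0%N :> nat)) G x.
Proof.
move=> mc; rewrite big_split /=.
pose decr x : point := [ffun d => if d == c then inord (x d).-1 else x d].
have -> : \sum_(x | box m.+1 x) G (incr c x) =
          \sum_(x | rest c x && (0 < x c)%N) G x.
  rewrite [RHS](reindex_onto (incr c) decr) /=; last first.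
    move=> x /andP[_ xc]; apply/ffunP => d; rewrite !ffunE; case: eqP => //= ->.
    by apply/val_inj; rewrite /= !inordK ?prednK // ltnW.
  apply: eq_bigl => x; rewrite (box_rest _ mc).
  have -> : rest c (incr c x) = rest c x.
    by apply: eq_forallb => d; rewrite ffunE; case: eqP.
  rewrite -andbA; congr (_ && _); apply/idP/andP => [xc|[+ _]].
    rewrite val_incr // eqxx addn1; split=> //; apply/eqP/ffunP => d.
    rewrite !ffunE; case: eqP => //= ->; apply/val_inj.
    by rewrite /= inordK ?inordK //= ltnS // ltnW.
  (* If [x c] were [k], the overflowing [inord] would fall back to 0, against the positivity of the
     new coordinate. *)
  rewrite ffunE eqxx => x0; rewrite ltn_neqAle -ltnS ltn_ord andbT.
  by apply: contraTneq x0 => ->; rewrite /inord /insubd insubF //= ltnn.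
rewrite (bigID (fun x => x c == k :> nat)) /=.
rewrite [X in _ + X](bigID (fun x => x c == 0%N :> nat)) /=.
rewrite addrACA -[RHS]addr0; congr (_ + _ + _); last first.
- rewrite -[RHS](K2 (\sum_(x | box m.+1 x && (x c != 0%N :> nat)) G x)).
  congr (_ + _); apply: eq_bigl => x; rewrite (box_rest _ mc).
  by have := ltn_ord (x c); case: (rest c x) => //=; lia.
- by apply: eq_bigl => x; rewrite (box_rest _ mc); case: (rest c x) => //=; lia.
by apply: eq_bigl => x; case: (rest c x) => //=; lia.
Qed.

Lemma fits_pos_active s : fits m.+1 s -> (M - m.+1 <= s om)%N.
Proof.
move=> fs; rewrite leqNgt; apply/negP => sm.
have mi : (m < rev_ord (s om))%N by rewrite /=; lia.
have := fits_ge fs mi; rewrite rev_ordK => /perm_inj /(congr1 val) /=.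
by move=> E; move: mi; rewrite /= E ltnn.
Qed.

Lemma vtx_shift s x j : (j <= m)%N -> (x (s (pos (leq0n m))) < k)%N ->
  vtx x s j.+1 = vtx (incr (s (pos (leq0n m))) x) (step_rot * s)%g j.
Proof.
move=> jm xk; apply/ffunP => d; rewrite 2!ffunE val_incr // invMg permM.
rewrite lt_step_rot //.
have [->|ds] := eqVneq d (s (pos (leq0n m))).
  rewrite permK /= (_ : (step_rot^-1)%g _ = om) /=; first by lia.
  apply: (@perm_inj _ step_rot); rewrite permKV permE; apply/val_inj.
  by rewrite /= val_step_rot /= ltnn eqxx.
rewrite (_ : (s^-1)%g d == 0%N :> nat = false) ?addn0 //.
by apply: contraNF ds => /eqP E; apply/eqP; rewrite -[LHS](permKV s); congr (s _); apply/val_inj.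
Qed.

(** The face without the first vertex is also the face without the last vertex of the neighbouring
    simplex that starts one step later. *)
Lemma face_first s x : (x (s (pos (leq0n m))) < k)%N ->
  face 0 x s = face m.+1 (incr (s (pos (leq0n m))) x) (step_rot * s)%g.
Proof.
move=> xk; have B l : (l <= m)%N -> bump m.+1 l = l by rewrite /bump; lia.
have B0 l : bump 0 l = l.+1 by [].
rewrite /face B // B0 vtx_shift //; congr (_ * _).
apply: eq_bigr => j _; have jm := ltnW (ltn_ord j).
by rewrite (B j.+1) // (B j) // (B0 j) (B0 j.+1) (vtx_shift (ltn_ord j) xk) (vtx_shift jm xk).
Qed.

(** The direction [c] is the omitted last step, so [a c] is constant along the face, and the factor
    holding its coboundary vanishes. *)
Lemma face_side s x c : fits m.+1 s -> c = s om -> c != c0 ->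
  (x c == k :> nat) || (x c == 0%N :> nat) -> face m.+1 x s = 0.
Proof.
move=> fs cE cc0 xc.
have mc := fits_pos_active fs; rewrite -cE in mc.
have jm : (c - (M - m) < m)%N.
  have := ltn_ord c; move: cc0; rewrite -val_eqE /=; lia.
have E : (M - m + (c - (M - m)) = c)%N.
  by move: cc0; rewrite -val_eqE /=; lia.
rewrite /face (bigD1 (Ordinal jm)) //= E.
have V j : (j <= m)%N -> vtx x s j c = x c.
  by move=> h; rewrite ffunE cE permK /= ltnNge h addn0.
have {V} V j : (j < m.+1)%N -> a c (vtx x s (bump m.+1 j)) = (x c == k :> nat)%:R.
  move=> jm1; rewrite (_ : bump _ _ = j); last by rewrite /bump; lia.
  case/orP: xc => /eqP xc; rewrite xc.
    by rewrite eqxx; apply: ak; rewrite V.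
  by rewrite eq_sym gtn_eqF //; apply: a0; rewrite V.
set j := (_ - _)%N in jm *.
by rewrite (V j.+1 jm) (V j (ltnW jm)) K2 mul0r mulr0.
Qed.

Lemma fitsS s : fits m s = fits m.+1 s && (s om == c0).
Proof.
apply/forallP/andP => [fs|[/forallP fs sm] i].
  split; last exact: (implyP (fs om)).
  by apply/forallP => i; apply/implyP => mi; apply: (implyP (fs i)); apply: ltnW.
apply/implyP; rewrite leq_eqVlt => /orP[/eqP mi|]; last exact: (implyP (fs i)).
by have -> : i = om by apply/val_inj.
Qed.

Lemma face_top s x : fits m.+1 s -> s om = c0 -> rest c0 x ->
  x c0 = k :> nat -> face m.+1 x s = cup m x s.
Proof.
move=> fs sm _ xk.
have B l : (l <= m)%N -> bump m.+1 l = l by rewrite /bump; lia.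
rewrite /face B // ak ?mul1r; last by rewrite ffunE -sm permK /= sm addn0.
by apply: eq_bigr => j _; rewrite (B j.+1) // (B j) // ltnW.
Qed.

(** Stokes' formula modulo 2. Inner faces cancel in pairs, the faces [0] and [m.+1] telescope in the
    direction of the last step, and of the walls only [x c0 = k] contributes, where [a c0] is 1. *)
Lemma cupsumS : cupsum m.+1 = cupsum m.
Proof.
rewrite /cupsum.
transitivity (\sum_(s | fits m.+1 s) \sum_(l < m.+2) \sum_(x | box m.+1 x) face l x s).
  apply: eq_bigr => s _; rewrite exchange_big /=.
  by apply: eq_bigr => x _; rewrite cup_faces.
rewrite exchange_big /= big_ord_recl big_ord_recr /=.
rewrite [X in _ + (X + _)]big1 ?add0r; last first.
  move=> l _; rewrite exchange_big big1 // => x _.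
  by rewrite /bump /= add1n; exact: sum_inner_face.
rewrite [X in _ + X](_ : _ = \sum_(s | fits m.+1 s)
    \sum_(x | box m.+1 x) face m.+1 x s) //.
rewrite [X in X + _](_ : _ = \sum_(s | fits m.+1 s)
    \sum_(x | box m.+1 x) face m.+1 (incr (s om) x) s); last first.
  rewrite [RHS](reindex_inj (mulgI step_rot)) /=.
  apply: eq_big => [s|s fs]; first by rewrite fits_rot.
  have so : (step_rot * s)%g om = s (pos (leq0n m)).
    by rewrite permM; congr (s _); apply/val_inj; rewrite permE /= val_step_rot ltnn eqxx.
  apply: eq_bigr => x bx; rewrite so; apply: face_first.
  have := forallP bx (s (pos (leq0n m))).
  by rewrite -so fits_pos_active // fits_rot.
rewrite -big_split /= (bigID (fun s : 'S_M => s om == c0)) /=.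
rewrite [X in _ + X]big1 ?addr0; last first.
  move=> s /andP[fs sm]; rewrite -big_split /=.
  rewrite (sum_telescope (fun x => face m.+1 x s)) ?fits_pos_active //.
  by rewrite !big1 ?addr0 // => x /andP[_ xc]; apply: (face_side fs (erefl _)) => //; rewrite xc ?orbT.
apply: eq_big => s; first by rewrite fitsS.
move=> /andP[fs /eqP sm]; rewrite -big_split /= sm.
rewrite (sum_telescope (fun x => face m.+1 x s)) -?sm ?fits_pos_active // sm.
rewrite [X in _ + X]big1 ?addr0; last first.
  move=> x /andP[_ /eqP xc]; rewrite /face a0 ?mul0r //.
  by rewrite ffunE -sm permK /= sm xc.
apply: eq_big => x; last by move=> /andP[rx /eqP xk]; apply: face_top.
apply/andP/forallP => [[/forallP rx xk] d|bx].
  have [->|dc] := eqVneq d c0; first by rewrite xk ifN //= -ltnNge; lia.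
  have := implyP (rx d) dc; move: dc; rewrite -val_eqE /= => dc.
  by case: (leqP (M - m) d) => h; [rewrite ifT//; lia|rewrite ifN //; lia].
split; last by have := bx c0; rewrite ifN //= -ltnNge; lia.
apply/forallP => d; apply/implyP => dc; have := bx d.
move: dc; rewrite -val_eqE /= => dc.
by case: (leqP (M - m) d) => h; [rewrite ifT//; lia|rewrite ifN //; lia].
Qed.

End Step.

Lemma cupsum_eq1 m : (m <= M)%N -> cupsum m = 1.
Proof. by elim: m => [_|m IHm mM]; [exact: cupsum0|rewrite cupsumS // IHm // ltnW]. Qed.
Lemma exists_cup_neq0 :
  exists s x, box M x && (cup M x s != 0).
Proof.
have [/existsP[s /existsP[x sx]]|/existsPn no] :=
    boolP [exists s : 'S_M, [exists x : point, box M x && (cup M x s != 0)]].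
  by exists s, x.
have := cupsum_eq1 (leqnn M); rewrite /cupsum big1 => [|s _].
  by move/eqP; rewrite eq_sym oner_eq0.
rewrite big1 // => x bx; have /existsPn /(_ x) := no s.
by rewrite bx negbK => /eqP.
Qed.

End Grid.
End CharTwo.

(** A nonzero cup product over ['F_2] says that every label changes along an edge of one Kuhn
    simplex, and this simplex lies in one cell of the grid. *)
Lemma cubical_sperner (M k : nat) (a : 'I_M -> {ffun 'I_M -> nat} -> bool) :
  (0 < k)%N ->
  (forall (i : 'I_M) (v : {ffun 'I_M -> nat}), v i = 0%N -> a i v = false) ->
  (forall (i : 'I_M) (v : {ffun 'I_M -> nat}), v i = k -> a i v = true) ->
  exists x : {ffun 'I_M -> 'I_k.+1}, (forall i, x i < k)%N /\ forall i, exists u v : {ffun 'I_M -> nat},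
    [/\ a i u != a i v, forall j, (x j <= u j <= (x j).+1)%N
      & forall j, (x j <= v j <= (x j).+1)%N].
Proof.
move=> k0 a0 ak.
have F2 (x : 'F_2) : x + x = 0.
  by case: x => [[|[|]]] // ?; apply/val_inj.
pose b (i : nat) v : 'F_2 := (if insub i is Some j then a j v else false)%:R.
have bE (i : 'I_M) v : b i v = (a i v)%:R by rewrite /b valK.
have b0 (i : 'I_M) (v : {ffun 'I_M -> nat}) : v i = 0%N -> b i v = 0.
  by move=> vi; rewrite bE a0.
have bk (i : 'I_M) (v : {ffun 'I_M -> nat}) : v i = k -> b i v = 1.
  by move=> vi; rewrite bE ak.
have [s [x]] := exists_cup_neq0 F2 k0 b0 bk.
rewrite /cup prodf_seq_neq0 => /andP[/forallP bx /allP nz]; exists x.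
  split=> i; first by have := bx i; rewrite subnn.
  have := nz i (mem_index_enum i); rewrite /= subnn add0n !bE => ne.
  exists (vtx x s i.+1), (vtx x s i); split.
  - by apply: contraNneq ne => ->; rewrite F2.
  - by move=> j; rewrite ffunE; lia.
  - by move=> j; rewrite ffunE; lia.
Qed.

(** * The Poincare-Miranda theorem *)

Section PoincareMiranda.
Variables (R : realType) (m : nat) (r : R) (q : 'rV[R]_m -> 'rV[R]_m).
Hypothesis r0 : 0 < r.
Let cube (x : 'rV[R]_m) := forall i, `|x 0 i| <= r.
Hypothesis qcont : forall x, cube x -> {for x, continuous q}.
Hypothesis qlo : forall x i, cube x -> x 0 i = - r -> q x 0 i < 0.
Hypothesis qhi : forall x i, cube x -> x 0 i = r -> 0 < q x 0 i.

Let grid k (v : {ffun 'I_m -> nat}) : 'rV[R]_m :=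
  \row_i (- r + 2 * r * (v i)%:R / k%:R).

Lemma grid_cube k (v : {ffun 'I_m -> nat}) : (0 < k)%N -> (forall i, v i <= k)%N -> cube (grid k v).
Proof.
move=> k0 vk i; rewrite mxE.
have k0' : 0 < k%:R :> R by rewrite ltr0n.
have h0 : 0 <= (v i)%:R / k%:R :> R by rewrite divr_ge0.
have h1 : (v i)%:R / k%:R <= 1 :> R by rewrite ler_pdivrMr // mul1r ler_nat.
rewrite -mulrA ler_norml; move: (_ / _) h0 h1 => t h0 h1.
have h2 : 0 <= r * t by rewrite mulr_ge0 // ltW.
have h3 : r * t <= r by rewrite ler_piMr // ltW.
by rewrite -mulrA; apply/andP; split; lra.
Qed.

Lemma miranda_cell k : (0 < k)%N -> exists p, cube p /\
  forall i, exists x y, [/\ cube x, cube y, 0 < q x 0 i, q y 0 i <= 0 &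
    (forall j, `|x 0 j - p 0 j| <= 2 * r / k%:R) /\
    (forall j, `|y 0 j - p 0 j| <= 2 * r / k%:R)].
Proof.
move=> k0; have k0' : 0 < k%:R :> R by rewrite ltr0n.
(* The labels at both ends are imposed to meet the boundary condition of [cubical_sperner]; [qlo]
   and [qhi] make them agree with the sign of [q]. *)
pose a i (v : {ffun 'I_m -> nat}) :=
  (v i == k) || (v i != 0%N) && (0 < q (grid k v) 0 i).
have [||x [xk H]] := @cubical_sperner m k a k0.
- by move=> i v vi; rewrite /a vi eq_sym gtn_eqF.
- by move=> i v vi; rewrite /a vi eqxx.
pose x' : {ffun 'I_m -> nat} := [ffun i => x i : nat].
exists (grid k x'); split.
  by apply: grid_cube => // i; rewrite ffunE ltnW.
have aT i (v : {ffun 'I_m -> nat}) : (forall i, v i <= k)%N -> a i v -> 0 < q (grid k v) 0 i.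
  move=> vk /orP[/eqP vi|/andP[_ //]]; apply: qhi; first exact: grid_cube.
  by rewrite mxE vi mulfK ?gt_eqF //; ring.
have aF i (v : {ffun 'I_m -> nat}) : (forall i, v i <= k)%N -> ~~ a i v -> q (grid k v) 0 i <= 0.
  move=> vk; rewrite negb_or negb_and negbK => /andP[_ /orP[/eqP vi|]].
    apply/ltW/qlo; first exact: grid_cube.
    by rewrite mxE vi mulr0 mul0r addr0.
  by rewrite -leNgt.
have near_x (v : {ffun 'I_m -> nat}) : (forall j, x j <= v j <= (x j).+1)%N ->
    forall j, `|grid k v 0 j - grid k x' 0 j| <= 2 * r / k%:R.
  move=> xv j; rewrite !mxE ffunE; have /andP[h1 h2] := xv j.
  have -> : - r + 2 * r * (v j)%:R / k%:R - (- r + 2 * r * (x j)%:R / k%:R) =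
      2 * r / k%:R * (v j - x j)%:R by rewrite natrB //; field; rewrite gt_eqF.
  have h0 : 0 <= 2 * r / k%:R by rewrite divr_ge0 ?mulr_ge0 ?ler0n // ltW.
  rewrite normrM normr_nat ger0_norm //. by rewrite ler_piMr // (ler_nat _ _ 1); lia.
move=> i; have [u [v [auv xu xv]]] := H i.
have uk j : (u j <= k)%N by have := xu j; have := xk j; lia.
have vk j : (v j <= k)%N by have := xv j; have := xk j; lia.
have [au|au] := boolP (a i u).
  have av : ~~ a i v by move: auv; rewrite au; case: (a i v).
  by exists (grid k u), (grid k v); split; [apply: grid_cube|apply: grid_cube|apply: aT|apply: aF|split; apply: near_x].
have av : a i v by move: auv; rewrite (negbTE au); case: (a i v).
by exists (grid k v), (grid k u); split; [apply: grid_cube|apply: grid_cube|apply: aT|apply: aF|split; apply: near_x].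
Qed.

Lemma compact_cube : compact cube.
Proof.
rewrite (_ : cube = [set v | forall i, `[- r, r]%classic (v ord0 i)]); last first.
  apply/seteqP; split => v /= h i.
    by have := h i; rewrite in_itv /= ler_norml.
  by have := h i; rewrite in_itv /= ler_norml.
by apply: (@rV_compact _ _ (fun=> `[- r, r]%classic)) => i; exact: segment_compact.
Qed.

(** Arbitrarily near a cluster point of ever smaller cells, each component of [q] takes both a
    positive and a nonpositive value; continuity leaves only 0. *)
Lemma poincare_miranda : exists2 x, cube x & q x = 0.
Proof.
have /choice[p pP] : forall k, exists p, cube p /\
  forall i, exists x y, [/\ cube x, cube y, 0 < q x 0 i, q y 0 i <= 0 &
    (forall j, `|x 0 j - p 0 j| <= 2 * r / k.+1%:R) /\
    (forall j, `|y 0 j - p 0 j| <= 2 * r / k.+1%:R)].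
  by move=> k; apply: miranda_cell.
have [|x [cx xcl]] := compact_cube (F := p @ \oo) _.
  by exists 0%N => // k _; exact: (pP k).1.
exists x => //; apply/rowP => i; rewrite mxE.
have cell (P : set 'rV[R]_m) : nbhs x P -> exists u v,
    [/\ P u, P v, 0 < q u 0 i & q v 0 i <= 0].
  move=> /nbhs_ballP[e /= e0 eP].
  have [N NP] : exists N : nat, 2 * r / N.+1%:R < e / 2.
    exists (Num.truncn (2 * r / (e / 2))).
    rewrite ltr_pdivrMr ?ltr0n // -ltr_pdivrMl ?divr_gt0 // mulrC.
    by rewrite truncnS_gt.
  have [||y [[k /= Nk <-] ye]] := xcl (p @` [set k | (N <= k)%N]) (ball x (e / 2)).
  - by exists N => // k Nk; exists k.
  - by apply: nbhsx_ballx; rewrite divr_gt0.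
  have [_ H] := pP k; have [u [v [_ _ qu qv [pu pv]]]] := H i.
  have le_e : 2 * r / k.+1%:R < e / 2.
    apply: le_lt_trans NP; rewrite ler_pM2l ?mulr_gt0 //.
    by rewrite lef_pV2 ?posrE ?ltr0n // ler_nat.
  have sub (w : 'rV[R]_m) : (forall j, `|w 0 j - p k 0 j| <= 2 * r / k.+1%:R) -> P w.
    move=> pw; apply: eP; rewrite (splitr e); apply: ball_triangle ye _.
    split=> [|i0 j]; first by rewrite divr_gt0.
    by rewrite ord1 /ball /= distrC; apply: le_lt_trans le_e.
  by exists u, v; split => //; apply: sub.
have qi : {for x, continuous (fun y => q y 0 i)}.
  apply: (@continuous_comp _ _ _ q (fun M : 'rV[R]_m => M 0 i)); first exact: qcont.
  exact: coord_continuous.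
apply/eqP; rewrite eq_le; apply/andP; split; rewrite leNgt; apply/negP => qx.
  have [u [v [_ Pv _]]] := cell _ (qi _ (lt_nbhsr qx)).
  by rewrite leNgt Pv.
have [u [v [Pu _]]] := cell _ (qi _ (lt_nbhsl qx)).
by rewrite ltNge ltW.
Qed.
End PoincareMiranda.

(** * Real estimates for complex numbers and vectors *)

Section RealComplex.
Variable R : realType.
Local Notation C := (Cplx R).

(** Norms on [Cplx R] take values in [Cplx R], whose order is partial. Radii and bounds are
    therefore real numbers embedded by [rC], and [ge0_rC] brings estimates back to the totally
    ordered [R]. *)
Definition rC (r : R) : C := Complex r 0.

Lemma rC_le r s : (rC r <= rC s) = (r <= s). Proof. exact: lecR. Qed.
Lemma rC_lt r s : (rC r < rC s) = (r < s). Proof. exact: ltcR. Qed.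
Lemma rC0 : rC 0 = 0. Proof. by []. Qed.
Lemma rC1 : rC 1 = 1. Proof. by []. Qed.
Lemma rCD r s : rC (r + s) = rC r + rC s.
Proof. exact: (rmorphD (real_complex R)). Qed.
Lemma rCM r s : rC (r * s) = rC r * rC s.
Proof. exact: (rmorphM (real_complex R)). Qed.

Lemma rCV r : rC r^-1 = (rC r)^-1.
Proof. exact: (fmorphV (real_complex R)). Qed.
Lemma rCX r k : rC (r ^+ k) = rC r ^+ k.
Proof. exact: (rmorphXn (real_complex R)). Qed.

Lemma ge0_rC (z : C) : 0 <= z -> exists2 r : R, 0 <= r & z = rC r.
Proof.
case: z => a b; rewrite lecE /= => /andP[/eqP b0 a0].
by exists a => //; rewrite /rC b0.
Qed.

Lemma gt0_rC (z : C) : 0 < z -> exists2 r : R, 0 < r & z = rC r.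
Proof.
by move=> z0; have [r _ zr] := ge0_rC (ltW z0); exists r => //; rewrite -rC_lt -zr.
Qed.

Lemma normRe_le (z : C) : rC `|complex.Re z| <= `|z|.
Proof. exact: normc_ge_Re. Qed.

Lemma normIm_le (z : C) : rC `|complex.Im z| <= `|z|.
Proof.
case: z => a b; have := normRe_le (Complex b (- a)).
(* Multiplication by -i turns the imaginary part into a real part without changing the norm. *)
rewrite -[`|Complex a b|]mul1r (_ : 1 = `|Complex 0 (-1) : C|) -?normrM.
  by rewrite [_ * _](_ : _ = Complex b (- a)) // /GRing.mul /=; congr Complex; ring.
by rewrite normc_def /= expr0n /= add0r sqrrN expr1n sqrtr1.
Qed.

Lemma norm_le_ReIm (z : C) : `|z| <= rC (`|complex.Re z| + `|complex.Im z|).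
Proof.
case: z => a b; rewrite normc_def /= rC_le.
rewrite -[leRHS]ger0_norm ?addr_ge0 // -sqrtr_sqr ler_wsqrtr //.
by rewrite sqrrD !real_normK ?num_real // addrAC lerDl mulrn_wge0 // mulr_ge0.
Qed.

Lemma nbhs_rC (V : normedModType C) (x : V) (P : set V) :
  nbhs x P <-> exists2 r : R, 0 < r & forall y, `|y - x| < rC r -> P y.
Proof.
split=> [/nbhs_normP[e /= e0 eP]|[r r0 rP]].
  by have [r r0 er] := gt0_rC e0; exists r => // y yx; apply: eP; rewrite /= -er distrC in yx *.
by apply/nbhs_normP; exists (rC r) => /= [|y]; rewrite ?rC_lt // /ball_ /= distrC => /rP.
Qed.

Lemma continuous_Re : continuous (fun z : C => complex.Re z : R).
Proof.
move=> z; apply/(@cvgrPdist_lt _ _ _ _ (nbhs_filter z)) => e e0.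
apply/nbhs_rC; exists e => // w zw.
rewrite distrC -rC_lt -raddfB; exact: le_lt_trans (normRe_le _) zw.
Qed.

End RealComplex.

Section CoordNorm.
Variables (K : numFieldType) (n : nat).
Implicit Types x : 'rV[K]_n.

Lemma norm_coord x i : `|x 0 i| <= `|x|.
Proof.
rewrite [leRHS]/Num.norm /= mx_normE -[leLHS]nngE num_le.
exact: (@le_bigmax _ _ _ _ _ (0, i)).
Qed.

Lemma norm_le_coord x e : 0 <= e -> (forall i, `|x 0 i| <= e) -> `|x| <= e.
Proof.
move=> e0 xe; have [->//|x0] := eqVneq `|x| 0.
by have [[i j] /= E] := mx_norm_neq0 x0; rewrite [leLHS]E ord1.
Qed.
End CoordNorm.

Section ComplexMiranda.
Variables (R : realType) (d : nat).
Local Notation C := (Cplx R).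
Local Notation Cd := 'rV[C]_d.

Definition cube (r : R) (x : Cd) :=
  forall j, `|complex.Re (x 0 j)| <= r /\ `|complex.Im (x 0 j)| <= r.

Lemma cube_ball (r : R) (x : Cd) : 0 <= r -> cube r x -> `|x| <= rC (r + r).
Proof.
move=> r0 xr; apply: norm_le_coord => [|j]; first by rewrite -rC0 rC_le addr_ge0.
by apply: le_trans (norm_le_ReIm _) _; rewrite rC_le lerD //; have [] := xr j.
Qed.

Let toC (x : 'rV[R]_(d + d)) : Cd :=
  \row_j (Complex (x 0 (lshift d j)) (x 0 (rshift d j))).

Let ofC (z : Cd) : 'rV[R]_(d + d) :=
  \row_(i < d + d) (match fintype.split i with inl j => complex.Re (z 0 j) | inr j => complex.Im (z 0 j) end).

Lemma continuous_toC (x : 'rV[R]_(d + d)) : {for x, continuous toC}.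
Proof.
apply/(@cvgrPdist_lt _ _ _ _ (nbhs_filter x)) => e /gt0_rC[r r0 ->].
have : nbhs x (ball x (r / 4)) by apply: nbhsx_ballx; rewrite divr_gt0.
apply: filterS => y [_ xy].
have xyi i : `|x 0 i - y 0 i| < r / 4 by exact: xy.
apply: (@le_lt_trans _ _ (rC (r / 4 + r / 4))); last by rewrite rC_lt; lra.
apply: norm_le_coord => [|j]; first by rewrite -rC0 rC_le; lra.
rewrite !mxE; apply: le_trans (norm_le_ReIm _) _; rewrite rC_le.
by apply: lerD; apply: ltW; rewrite raddfB /=.
Qed.

Lemma continuous_ofC (x : Cd) : {for x, continuous ofC}.
Proof.
apply/(@cvgrPdist_lt _ _ _ _ (nbhs_filter x)) => e e0.
apply/nbhs_rC; exists (e / 2); first by rewrite divr_gt0.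
move=> y; rewrite distrC => xy.
apply: (@le_lt_trans _ _ (e / 2)); last by lra.
apply: norm_le_coord => [|i]; first by lra.
rewrite !mxE; rewrite -rC_le.
have xyj j : `|x 0 j - y 0 j| <= rC (e / 2).
  by apply: ltW; apply: le_lt_trans xy; have := norm_coord (x - y) j; rewrite !mxE.
case: (fintype.split i) => j; rewrite -raddfB.
  exact: le_trans (normRe_le _) (xyj j).
exact: le_trans (normIm_le _) (xyj j).
Qed.

Lemma toCK x : ofC (toC x) = x.
Proof.
by apply/rowP => i; rewrite mxE; case: fintype.splitP => j ij; rewrite mxE /=; congr (x 0 _); apply/val_inj.
Qed.

Lemma cube_toC r (x : 'rV[R]_(d + d)) : (forall i, `|x 0 i| <= r) -> cube r (toC x).
Proof. by move=> xr j; rewrite !mxE /=. Qed.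

(** The identity has the required sign on every face of the cube, so a map equal to it on the
    boundary satisfies Poincare-Miranda in the [d + d] real coordinates. *)
Lemma complex_miranda (r : R) (q : Cd -> Cd) : 0 < r ->
  (forall x, cube r x -> {for x, continuous q}) ->
  (forall x, cube r x ->
     (exists j, `|complex.Re (x 0 j)| = r \/ `|complex.Im (x 0 j)| = r) ->
     q x = x) ->
  exists2 x, cube r x & q x = 0.
Proof.
move=> r0 qc qb.
have qB (x : 'rV[R]_(d + d)) i : (forall j, `|x 0 j| <= r) -> `|x 0 i| = r -> ofC (q (toC x)) = x.
  move=> xr xi; rewrite qb ?toCK //; first exact: cube_toC.
  have [j ij|j ij] := fintype.splitP i.
    by exists j; left; rewrite mxE /= -xi; congr `|x 0 _|; apply/val_inj.
  by exists j; right; rewrite mxE /= -xi; congr `|x 0 _|; apply/val_inj.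
have [] := @poincare_miranda R (d + d) r (fun x => ofC (q (toC x))) r0.
- move=> x xr; apply: (@continuous_comp _ _ _ (q \o toC) ofC); last exact: continuous_ofC.
  by apply: (@continuous_comp _ _ _ toC q); [exact: continuous_toC|exact/qc/cube_toC].
- by move=> x i xr xi; rewrite (qB _ i) // xi ?oppr_lt0 // normrN gtr0_norm.
- by move=> x i xr xi; rewrite (qB _ i) // xi // gtr0_norm.
move=> x xr q0; exists (toC x); first exact: cube_toC.
apply/rowP => j; rewrite mxE.
have := congr1 (fun v : 'rV_(d + d) => v 0 (lshift d j)) q0.
have := congr1 (fun v : 'rV_(d + d) => v 0 (rshift d j)) q0.
rewrite /= !mxE (unsplitK (inl _ j)) (unsplitK (inr _ j)).
by case: (q (toC x) 0 j) => a b /= -> ->.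
Qed.

End ComplexMiranda.

(** * Homeomorphisms into charts *)

Lemma near_and (T : topologicalType) (x : T) (P Q : T -> Prop) :
  (\forall y \near x, P y) -> (\forall y \near x, Q y) ->
  \forall y \near x, P y /\ Q y.
Proof. exact: filterI. Qed.

Section PushOut.
Variables (K : numFieldType) (V : normedModType K) (c : V) (eps : K).
Hypothesis eps0 : 0 < eps.

(** Radial projection of the punctured ball around [c] onto its sphere, extended by the identity
    outside. The numerator is twice max(eps - |u - c|, 0), written with an absolute value. *)
Definition push_out (u : V) : V :=
  u + ((eps - `|u - c| + `|eps - `|u - c| |) / (2 * `|u - c|)) *: (u - c).

Lemma push_out_far u : eps <= `|u - c| -> push_out u = u.
Proof.
move=> h; rewrite /push_out ler0_norm ?subr_le0 // subrr mul0r scale0r.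
by rewrite addr0.
Qed.

Lemma push_out_near u : u != c -> `|u - c| <= eps -> `|push_out u - c| = eps.
Proof.
rewrite -subr_eq0 -normr_gt0 => uc h.
rewrite /push_out ger0_norm ?subr_ge0 // addrAC -{1}[u - c]scale1r -scalerDl.
have -> : 1 + (eps - `|u - c| + (eps - `|u - c|)) / (2 * `|u - c|) = eps / `|u - c|.
  by field; rewrite gt_eqF.
by rewrite normrZ normf_div normr_id divfK ?gt_eqF // gtr0_norm.
Qed.

Lemma continuous_push_out u : u != c -> {for u, continuous push_out}.
Proof.
move=> uc; have n0 : `|u - c| != 0 by rewrite normr_eq0 subr_eq0.
have cs : {for u, continuous (fun v : V => v - c)}.
  by apply: cvgB; [exact: cvg_id|exact: cvg_cst].
have cn : {for u, continuous (fun v : V => `|v - c| : K)} by exact: cvg_norm.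
have ce : {for u, continuous (fun v : V => eps - `|v - c| : K)}.
  by apply: cvgB; [exact: cvg_cst|exact: cn].
apply: cvgD; first exact: cvg_id.
apply: cvgZ; last exact: cs.
apply: cvgM; first by apply: cvgD; [exact: ce|exact: cvg_norm].
apply: cvgV; first by rewrite mulf_neq0 // pnatr_eq0.
by apply: cvgM; [exact: cvg_cst|exact: cn].
Qed.

End PushOut.

Section ImageOfSection.
Variables (R : realType) (d : nat).
Local Notation C := (Cplx R).
Local Notation Cd := 'rV[C]_d.
Variables (e g : Cd -> Cd) (p : Cd).

(* If the image missed points [c] arbitrarily close to [p], then pushing the
   ball around [c] that contains [p] out to its boundary sphere and applying
   [g] would give a map [g \o push_out \o e] without zeros on a cube, equal to
   the identity on the boundary of the cube. *)
Lemma nbhs_image_of_isolated_zero :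
  e 0 = p ->
  (\forall x \near (0 : Cd), {for x, continuous e}) ->
  (\forall u \near p, {for u, continuous g}) ->
  (\forall x \near (0 : Cd), g (e x) = x) ->
  (\forall u \near p, g u = 0 -> u = p) ->
  forall N : set Cd, nbhs (0 : Cd) N -> nbhs p (e @` N).
Proof.
move=> e0 ec gc geK g0 N N0.
have /nbhs_rC[s s0 sP] := near_and gc g0.
have ec0 : {for 0, continuous e} by exact: nbhs_singleton ec.
have es : \forall x \near (0 : Cd), `|e x - p| < rC s.
  have : nbhs (e 0) [set u | `|u - p| < rC s] by rewrite e0; apply/nbhs_rC; exists s.
  by move/ec0.
have /nbhs_rC[rho rho0 rhoP] := near_and (near_and ec geK) (near_and N0 es).
pose r := rho / 4; have r0 : 0 < r by rewrite divr_gt0.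
have cubeP x : cube r x -> [/\ {for x, continuous e}, g (e x) = x,
    N x & `|e x - p| < rC s].
  move=> /(cube_ball (ltW r0)) xr.
  have [|[? ?] [? ?]] := rhoP x; last by split.
  by rewrite subr0; apply: le_lt_trans xr _; rewrite rC_lt /r; lra.
have gp : g p = 0 by rewrite -e0; apply: nbhs_singleton geK.
have : \forall u \near p, `|g u| < rC r.
  have gcp : {for p, continuous g} by exact: nbhs_singleton gc.
  have : nbhs (g p) [set u | `|u| < rC r].
    by rewrite gp; apply/nbhs_rC; exists r => // y; rewrite subr0.
  by move/gcp.
move=> /nbhs_rC[t t0 tP].
(* Within [s] of [p], the map [g] is continuous and vanishes only at [p]. Within [t], its values
   have norm below [r], so a boundary point of the cube, where [g (e x) = x] has norm at least [r],
   is never pushed. *)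
pose m := Num.min s t; have m0 : 0 < m by rewrite lt_min s0.
have ms u : `|u - p| < rC m -> `|u - p| < rC s.
  by move=> /lt_le_trans; apply; rewrite rC_le ge_min lexx.
have mt u : `|u - p| < rC m -> `|u - p| < rC t.
  by move=> /lt_le_trans; apply; rewrite rC_le ge_min lexx orbT.
pose eps := rC (m / 2); have eps0 : 0 < eps by rewrite -rC0 rC_lt divr_gt0.
have eps2 : eps + eps = rC m by rewrite -rCD; congr rC; lra.
apply/nbhs_rC; exists (m / 2); first by rewrite divr_gt0.
move=> c cp; apply: contrapT => cN.
have ecN x : cube r x -> e x != c.
  by move=> /cubeP[_ _ Nx _]; apply/eqP => ex; apply: cN; exists x.
have tot x : (eps <= `|x - c|) || (`|x - c| < eps).
  by case: (real_leP (gtr0_real eps0) (normr_real (x - c))).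
have pc : eps <= `|p - c| -> False by rewrite distrC => h; have := le_lt_trans h cp; rewrite ltxx.
have near_c x : cube r x -> `|e x - c| < eps ->
    `|push_out c eps (e x) - c| = eps /\ `|push_out c eps (e x) - p| < rC m.
  move=> xr h; have E := push_out_near eps0 (ecN x xr) (ltW h); split => //.
  by rewrite -eps2; apply: le_lt_trans (ler_distD c _ _) _; rewrite E ltrD2l.
have [||x xr] := @complex_miranda R d r (fun x => g (push_out c eps (e x))) r0.
- move=> x xr; have [cx _ _ xs] := cubeP x xr.
  apply: (@continuous_comp _ _ _ (push_out c eps \o e) g).
    apply: (@continuous_comp _ _ _ e (push_out c eps)); first exact: cx.
    exact: continuous_push_out (ecN x xr).
  suff /sP[gx _] : `|(push_out c eps \o e) x - p| < rC s by exact: gx.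
  have [h|h] := orP (tot (e x)); first by rewrite /comp (push_out_far h).
  exact/ms/(near_c x xr h).2.
- move=> x xr [j xj]; have [_ gx _ _] := cubeP x xr.
  have xn : rC r <= `|x|.
    apply: le_trans (norm_coord x j); case: xj => <-.
      exact: normRe_le.
    exact: normIm_le.
  rewrite push_out_far //; case/orP: (tot (e x)) => // h.
  have /tP : `|e x - p| < rC t.
    by apply: mt; rewrite -eps2; apply: le_lt_trans (ler_distD c _ _) _; rewrite ltrD.
  by rewrite gx => /(le_lt_trans xn); rewrite ltxx.
have [_ gx _ _] := cubeP x xr.
have [h|h] := orP (tot (e x)).
  rewrite push_out_far // gx => x0; apply: pc.
  by rewrite -e0 -x0.
have [E1 /ms /sP[_ E2]] := near_c x xr h.
by move=> /E2 E3; apply: pc; rewrite -E3 E1.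
Qed.

End ImageOfSection.

Lemma continuous_within_comp (S T U : topologicalType) (A : set T)
    (i : S -> T) (h : T -> U) (x : S) :
  {within A, continuous h} -> {for x, continuous i} ->
  (\forall y \near x, A (i y)) -> {for x, continuous (h \o i)}.
Proof.
move=> /subspace_continuousP hc ic Ai W hW.
have /= hA := hc _ (nbhs_singleton Ai) W hW.
have iA := ic _ hA.
by apply: filterS (near_and iA Ai) => y /= [H Ay]; apply: H.
Qed.

Lemma near_near (T : topologicalType) (x : T) (P : T -> Prop) :
  (\forall y \near x, P y) -> \forall y \near x, \forall z \near y, P z.
Proof. by move/nbhs_interior. Qed.

Lemma near_continuous (S T : topologicalType) (f : S -> T) (x : S) (P : T -> Prop) :
  {for x, continuous f} -> (\forall y \near f x, P y) -> \forall y \near x, P (f y).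
Proof. by move=> fx; exact: fx. Qed.

Section HomeoChart.
Variables (R : realType) (d : nat).
Local Notation Cd := 'rV[Cplx R]_d.
Variables (S T : topologicalType) (A : set S) (B : set T).
(** Roles of the data: [iota] parametrizes one sheet of [A] through [s0], [gamma] recovers the
    parameter and vanishes on [A] near [s0] only at [s0], and [psi], [psi'] form a chart of [B]
    around [h s0]. *)
Variables (h : S -> T) (k : T -> S) (hk : homeo_on A B h k).
Variables (s0 : S) (As0 : A s0).
Variables (iota : Cd -> S) (gamma : S -> Cd) (psi : T -> Cd) (psi' : Cd -> T).
Hypothesis iota0 : iota 0 = s0.
Hypothesis iota_cont : \forall x \near (0 : Cd), {for x, continuous iota}.
Hypothesis iotaA : \forall x \near (0 : Cd), A (iota x).
Hypothesis gamma_cont : \forall s \near s0, {for s, continuous gamma}.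
Hypothesis iotaK : \forall x \near (0 : Cd), gamma (iota x) = x.
Hypothesis gamma_eq0 : \forall s \near s0, A s -> gamma s = 0 -> s = s0.
Hypothesis iota_not_onto : forall M, nbhs s0 M ->
  exists s, [/\ A s, M s & forall x, iota x <> s].
Hypothesis psi_cont : \forall t \near h s0, {for t, continuous psi}.
Hypothesis psi'_cont : \forall u \near psi (h s0), {for u, continuous psi'}.
Hypothesis psi'B : \forall u \near psi (h s0), B (psi' u).
Hypothesis psi'K : \forall u \near psi (h s0), psi (psi' u) = u.
Hypothesis psiK : \forall t \near h s0, B t -> psi' (psi t) = t.

(* The map [psi \o h \o iota] has the left inverse [gamma \o k \o psi'], whose
   zero at [psi (h s0)] is isolated, so its image is a neighbourhood of that
   point; hence [iota] is onto [A] near [s0]. *)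
Lemma no_homeo_to_chart : False.
Proof.
have [hB kA hK kK [hc kc]] := hk.
have Bh : B (h s0) by exact: hB.
pose p := psi (h s0).
have psi'p : psi' p = h s0 by exact: (nbhs_singleton psiK).
have hi x : {for x, continuous iota} -> (\forall y \near x, A (iota y)) ->
    {for x, continuous (h \o iota)} by exact: continuous_within_comp.
have kp u : {for u, continuous psi'} -> (\forall v \near u, B (psi' v)) ->
    {for u, continuous (k \o psi')} by exact: continuous_within_comp.
have hi0 : {for 0, continuous (h \o iota)}.
  by apply: hi; [exact: nbhs_singleton iota_cont|exact: iotaA].
have kpp : {for p, continuous (k \o psi')}.
  by apply: kp; [exact: nbhs_singleton psi'_cont|exact: psi'B].
have kpE : (k \o psi') p = s0 by rewrite /= psi'p hK.
have hi0E : (h \o iota) 0 = h s0 by rewrite /= iota0.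
have psi_near : \forall x \near (0 : Cd),
    {for (h \o iota) x, continuous psi} /\ (B (h (iota x)) -> psi' (psi (h (iota x))) = h (iota x)).
  by move: (near_and psi_cont psiK); rewrite -hi0E => /(near_continuous hi0).
have gam_near : \forall u \near p,
    {for (k \o psi') u, continuous gamma} /\
    (A (k (psi' u)) -> gamma (k (psi' u)) = 0 -> k (psi' u) = s0).
  by move: (near_and gamma_cont gamma_eq0); rewrite -{1}kpE => /(near_continuous kpp).
have N0 : \forall x \near (0 : Cd), A (iota x) /\ psi' (psi (h (iota x))) = h (iota x).
  by apply: filterS (near_and iotaA psi_near) => x [Ax [_ E]]; split=> //; apply: E; exact: hB.
have M : nbhs p ((psi \o (h \o iota)) @`
    [set x | A (iota x) /\ psi' (psi (h (iota x))) = h (iota x)]).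
  apply: (@nbhs_image_of_isolated_zero R d _ (gamma \o (k \o psi')) p _ _ _ _ _ _ N0).
  - by rewrite /= iota0.
  - apply: filterS (near_and (near_and iota_cont (near_near iotaA)) psi_near).
    move=> x [[xi xA] [xp _]].
    exact: (@continuous_comp _ _ _ (h \o iota) psi x (hi x xi xA) xp).
  - apply: filterS (near_and (near_and psi'_cont (near_near psi'B)) gam_near).
    move=> u [[up uB] [ug _]].
    exact: (@continuous_comp _ _ _ (k \o psi') gamma u (kp u up uB) ug).
  - apply: filterS (near_and N0 iotaK) => x [[Ax E] xK].
    by rewrite /= E hK.
  - apply: filterS (near_and (near_and psi'B psi'K) gam_near) => u [[uB uK] [_ gu]].
    move=> z; have E := gu (kA _ uB) z.
    by rewrite -uK -(kK _ uB) E.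
move/subspace_continuousP: hc => hc'.
have pc : {for h s0, continuous psi} by exact: nbhs_singleton psi_cont.
have Mp := near_and (near_continuous pc M) psiK.
(* Continuity of [h] within [A] pulls the image neighbourhood back to [s0], so a point of [A] missed
   by [iota] can be taken inside it; there [psi'] and [k] undo [psi] and [h]. *)
have [s [As sM si]] := iota_not_onto (hc' _ As0 _ Mp).
have [[x [Ax xK] /= xs] /(_ (hB _ As)) sK] := sM As.
apply: (si x); rewrite -(hK _ Ax) -(hK _ As); congr k.
by rewrite -xK xs sK.
Qed.
End HomeoChart.

(** * Homogeneous forms and power series *)

(* A form is a sum of terms [c * x_i1 * ... * x_ik], each stored as a
   coefficient and a word; unlike multi-indices, words make products of forms
   a mere concatenation. *)
Notation form R n := (seq (Cplx R * seq 'I_n)).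

Section Forms.
Variables (R : realType) (n : nat).
Local Notation C := (Cplx R).
Local Notation Cn := 'rV[C]_n.
Implicit Types (x : Cn) (k l : nat).

Implicit Types (s t : form R n).

Definition feval s x : C := \sum_(c <- s) c.1 * \prod_(i <- c.2) x 0 i.
(** The l^1 norm of the coefficients. It depends on the list and not only on the polynomial, but it
    is exactly multiplicative under [fmul]. *)
Definition fnorm s : C := \sum_(c <- s) `|c.1|.
Definition homog k s := all (fun c => size c.2 == k) s.

Definition fmul s t : form R n :=
  [seq (c.1 * d.1, c.2 ++ d.2) | c <- s, d <- t].

Definition fscale (a : C) s : form R n := [seq (a * c.1, c.2) | c <- s].

Lemma fnorm_ge0 s : 0 <= fnorm s.
Proof. exact: sumr_ge0. Qed.

Lemma feval_nil x : feval [::] x = 0.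
Proof. exact: big_nil. Qed.

Lemma fnorm_nil : fnorm [::] = 0.
Proof. exact: big_nil. Qed.

Lemma feval_cat s t x : feval (s ++ t) x = feval s x + feval t x.
Proof. exact: big_cat. Qed.

Lemma fnorm_cat s t : fnorm (s ++ t) = fnorm s + fnorm t.
Proof. exact: big_cat. Qed.

Lemma homog_cat k s t : homog k (s ++ t) = homog k s && homog k t.
Proof. exact: all_cat. Qed.

Lemma feval_mul s t x : feval (fmul s t) x = feval s x * feval t x.
Proof.
rewrite /feval big_allpairs_dep mulr_suml; apply: eq_bigr => c _.
by rewrite mulr_sumr; apply: eq_bigr => d _; rewrite /= big_cat mulrACA.
Qed.

Lemma fnorm_mul s t : fnorm (fmul s t) = fnorm s * fnorm t.
Proof.
rewrite /fnorm big_allpairs_dep mulr_suml; apply: eq_bigr => c _.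
by rewrite mulr_sumr; apply: eq_bigr => d _; rewrite normrM.
Qed.

Lemma homog_mul k l s t : homog k s -> homog l t -> homog (k + l) (fmul s t).
Proof.
move=> /allP sk /allP tl; apply/allP => _ /allpairsP[[c d] [/= cs dt ->]] /=.
by rewrite size_cat (eqP (sk _ cs)) (eqP (tl _ dt)).
Qed.

Lemma feval_fscale a s x : feval (fscale a s) x = a * feval s x.
Proof.
by rewrite /feval big_map mulr_sumr; apply: eq_bigr => c _; rewrite mulrA.
Qed.

Lemma fnorm_fscale a s : fnorm (fscale a s) = `|a| * fnorm s.
Proof.
by rewrite /fnorm big_map mulr_sumr; apply: eq_bigr => c _; rewrite normrM.
Qed.

Lemma homog_fscale k a s : homog k (fscale a s) = homog k s.
Proof. by rewrite /homog all_map. Qed.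

Lemma feval_scale k s a x : homog k s -> feval s (a *: x) = a ^+ k * feval s x.
Proof.
move=> /allP sk; rewrite /feval mulr_sumr; apply: eq_big_seq => c /sk /eqP ck.
rewrite mulrCA; congr (_ * _).
rewrite (eq_bigr (fun i => a * x 0 i)) => [|i _]; last by rewrite mxE.
by rewrite big_split /= big_const_seq count_predT ck iter_mulr_1.
Qed.

Lemma norm_feval k s x : homog k s -> `|feval s x| <= fnorm s * `|x| ^+ k.
Proof.
move=> /allP sk; rewrite /fnorm mulr_suml; apply: le_trans (ler_norm_sum _ _ _) _.
rewrite big_seq [leRHS]big_seq; apply: ler_sum => c /sk /eqP ck.
rewrite normrM ler_wpM2l // normr_prod -ck.
elim: (c.2) => [|i w IHw]; first by rewrite big_nil.
by rewrite big_cons /= exprS ler_pM ?prodr_ge0 // norm_coord.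
Qed.

Lemma feval_line k s (v e : Cn) : homog k s ->
  exists2 P : {poly C}, (size P <= k.+1)%N & forall y, P.[y] = feval s (v + y *: e).
Proof.
move=> /allP sk.
pose lin i : {poly C} := (v 0 i)%:P + (e 0 i)%:P * 'X.
exists (\sum_(c <- s) c.1%:P * \prod_(i <- c.2) lin i).
  apply: (leq_trans (size_sum _ _ _)); apply/bigmax_leqP_seq => c /sk /eqP <- _.
  rewrite mul_polyC; apply: leq_trans (size_scale_leq _ _) _.
  elim: (c.2) => [|i w IHw]; first by rewrite big_nil size_polyC oner_eq0.
  rewrite big_cons; apply: leq_trans (size_polyMleq _ _) _.
  have : (size (lin i) <= 2)%N.
    rewrite (leq_trans (size_polyD _ _)) // geq_max size_polyC mul_polyC.
    by rewrite (leq_trans (size_scale_leq _ _)) ?size_polyX // (leq_trans (leq_b1 _)).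
  by move: IHw => /=; lia.
move=> y; rewrite horner_sum; apply: eq_bigr => c _.
rewrite hornerM hornerC; congr (_ * _); rewrite horner_prod.
by apply: eq_bigr => i _; rewrite !hornerE !mxE mulrC.
Qed.

End Forms.

Section FormMap.
Variables (R : realType) (n m : nat) (sg : 'I_n -> 'I_m).
Definition fmap (s : form R n) : form R m := [seq (c.1, map sg c.2) | c <- s].

Lemma feval_fmap s x : feval (fmap s) x = feval s (\row_i x 0 (sg i)).
Proof.
rewrite /feval big_map; apply: eq_bigr => c _; congr (_ * _).
by rewrite big_map; apply: eq_bigr => i _; rewrite mxE.
Qed.

Lemma fnorm_fmap s : fnorm (fmap s) = fnorm s.
Proof. exact: big_map. Qed.

Lemma homog_fmap k s : homog k (fmap s) = homog k s.
Proof. by rewrite /homog all_map; apply: eq_all => c /=; rewrite size_map. Qed.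
End FormMap.

Section FormsMultiIndex.
Variables (R : realType) (n : nat).
Local Notation C := (Cplx R).
Local Notation Cn := 'rV[C]_n.
Implicit Types (x : Cn) (k : nat) (w : seq 'I_n) (al : mindex n).

Definition word al : seq 'I_n := flatten [seq nseq (al i) i | i <- enum 'I_n].
Definition counts w : mindex n := [ffun i => count_mem i w].

Lemma size_word al : size (word al) = (\sum_i al i)%N.
Proof.
rewrite size_flatten /shape -map_comp sumnE big_map -big_enum /=.
by apply: eq_bigr => i _; rewrite size_nseq.
Qed.

Lemma prod_word al x : \prod_(i <- word al) x 0 i = monomial al x.
Proof.
rewrite /word /monomial big_flatten big_map /= big_enum /=.
apply: eq_bigr => i _; elim: (al i) => [|k IHk]; first by rewrite big_nil.
by rewrite /= big_cons IHk exprS.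
Qed.

Lemma prod_counts w x : \prod_(i <- w) x 0 i = monomial (counts w) x.
Proof.
rewrite /monomial; elim: w => [|j w IHw].
  by rewrite big_nil big1 // => i _; rewrite ffunE.
rewrite big_cons IHw (bigD1 j) //= [RHS](bigD1 j) //= mulrA; congr (_ * _).
  by rewrite !ffunE /= eqxx exprS.
by apply: eq_bigr => i ij; rewrite !ffunE /= eq_sym (negbTE ij).
Qed.

Lemma sum_counts w : (\sum_i counts w i)%N = size w.
Proof.
elim: w => [|j w IHw]; first by rewrite big1 // => i _; rewrite ffunE.
rewrite /= -IHw (bigD1 j) //= [in RHS](bigD1 j) //= !ffunE /= eqxx -addnA add1n.
by congr (_.+1 + _)%N; apply: eq_bigr => i ij; rewrite !ffunE /= eq_sym (negbTE ij).
Qed.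

Definition form_of (a : mindex n -> C) k : form R n :=
  map (fun b : {ffun 'I_n -> 'I_k.+1} =>
         (a [ffun i => b i : nat], word [ffun i => b i : nat]))
      (enum [pred b : {ffun 'I_n -> 'I_k.+1} | (\sum_i b i)%N == k]).

Lemma homog_form_of a k : homog k (form_of a k).
Proof.
rewrite /homog all_map; apply/allP => b; rewrite mem_enum inE /= => /eqP bk.
by rewrite size_word; apply/eqP; rewrite -[RHS]bk; apply: eq_bigr => i _; rewrite ffunE.
Qed.

Lemma feval_form_of a k x : feval (form_of a k) x = hom_component a k x.
Proof.
rewrite /feval big_map big_enum /=; apply: eq_bigr => b _.
by rewrite prod_word.
Qed.

Lemma fnorm_form_of a k : fnorm (form_of a k) = degree_sum k (fun al => `|a al|).
Proof. by rewrite /fnorm big_map big_enum. Qed.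

(** Words that are rearrangements of each other denote the same monomial, so their coefficients are
    added. *)
Definition coef_of (s : nat -> form R n) al : C :=
  \sum_(c <- s (\sum_i al i)%N | counts c.2 == al) c.1.

Lemma degree_sum_counts k (F : mindex n -> C) w : size w = k ->
  degree_sum k (fun al => if counts w == al then F al else 0) = F (counts w).
Proof.
move=> wk; pose b : {ffun 'I_n -> 'I_k.+1} := [ffun i => inord (counts w i)].
have lek i : (counts w i <= k)%N.
  by rewrite -wk -(sum_counts w) (bigD1 i) //= leq_addr.
have bE : [ffun i => b i : nat] = counts w.
  by apply/ffunP => i; rewrite !ffunE inordK ?ltnS //; have := lek i; rewrite ffunE.
rewrite /degree_sum (bigD1 b) /=; last first.
  rewrite -[X in _ == X]wk -sum_counts; apply/eqP; apply: eq_bigr => i _.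
  by have /ffunP/(_ i) := bE; rewrite [LHS]ffunE.
rewrite bE eqxx big1 ?addr0 // => b' /andP[_ bb']; case: eqP => // E.
case/eqP: bb'; apply/ffunP => i; apply/val_inj.
by have /ffunP/(_ i) := E; rewrite -bE !ffunE.
Qed.

Lemma hom_component_coef_of (s : nat -> form R n) k x :
  homog k (s k) -> hom_component (coef_of s) k x = feval (s k) x.
Proof.
move=> /allP sk; rewrite /hom_component /degree_sum /coef_of.
transitivity (\sum_(c <- s k) degree_sum k (fun al =>
    if counts c.2 == al then c.1 * monomial al x else 0)).
  rewrite /degree_sum exchange_big /=; apply: eq_bigr => b /eqP bk.
  have -> : (\sum_i [ffun i => b i : nat] i)%N = k.
    by rewrite -[RHS]bk; apply: eq_bigr => i _; rewrite ffunE.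
  by rewrite -big_mkcond mulr_suml.
apply: eq_big_seq => c /sk /eqP ck.
by rewrite (degree_sum_counts (fun al => c.1 * monomial al x) ck) prod_counts.
Qed.

(** One coefficient may collect several words, so the comparison goes through a majorant: the form
    with coefficients |c| at the point with coordinates |x_i|, which has the same norm as [x]. *)
Lemma norm_coef_of (s : nat -> form R n) k x : homog k (s k) ->
  degree_sum k (fun al => `|coef_of s al * monomial al x|) <= fnorm (s k) * `|x| ^+ k.
Proof.
move=> sk.
pose sx : form R n := [seq (`|c.1|, c.2) | c <- s k].
pose y : Cn := \row_i `|x 0 i|.
have yx : `|y| = `|x|.
  apply/eqP; rewrite eq_le; apply/andP; split; apply: norm_le_coord => // i.
    by rewrite mxE normr_id norm_coord.
  by apply: le_trans (norm_coord y i); rewrite mxE normr_id.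
have hs : homog k sx by rewrite /homog all_map.
have -> : fnorm (s k) = fnorm sx.
  by rewrite /fnorm big_map; apply: eq_bigr => c _; rewrite normr_id.
rewrite -yx; apply: le_trans (norm_feval y hs).
have fy0 : 0 <= feval sx y.
  rewrite /feval big_map; apply: sumr_ge0 => c _; apply: mulr_ge0 => //=.
  by apply: prodr_ge0 => i _; rewrite mxE.
rewrite ger0_norm // -(@hom_component_coef_of (fun=> sx) k y) //.
apply: ler_sum => b /eqP bk; rewrite normrM; apply: ler_pM => //.
  rewrite /coef_of big_map (_ : (\sum_i _)%N = k).
    exact: ler_norm_sum.
  by rewrite -[RHS]bk; apply: eq_bigr => i _; rewrite ffunE.
rewrite /monomial normr_prod ler_prod // => i _.
by rewrite normrX !mxE lexx andbT exprn_ge0.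
Qed.

End FormsMultiIndex.

(** * Convergent power series and orders of vanishing *)

Section ComplexSeries.
Variable R : realType.
Local Notation C := (Cplx R).
Implicit Types (u v : nat -> C) (B : R).

Lemma cvg_rCP u (l : C) : u @ \oo --> l <->
  forall e : R, 0 < e -> \forall N \near \oo, `|l - u N| < rC e.
Proof.
split=> [/cvgrPdist_lt ul e e0|H]; first by apply: ul; rewrite -rC0 rC_lt.
by apply/cvgrPdist_lt => e /gt0_rC[r r0 ->]; exact: H.
Qed.

Lemma norm_lim_le u (l a b : C) : 0 <= b -> u @ \oo --> l ->
  (\forall M \near \oo, `|u M - a| <= b) -> `|l - a| <= b.
Proof.
move=> b0 /cvgrPdist_lt ul ub.
case: (real_leP (normr_real (l - a)) (ger0_real b0)) => // h.
have := ul (`|l - a| - b); rewrite subr_gt0 => /(_ h) H.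
have [M [/= M1 M2]] := filter_ex (filterI H ub).
have : `|l - a| < `|l - a|; last by rewrite ltxx.
apply: le_lt_trans (ler_distD (u M) _ _) _.
by rewrite -(subrK b `|l - a|) ltr_leD.
Qed.

Lemma rC_cvg (w : nat -> R) (l : R) : w @ \oo --> l -> (fun N => rC (w N)) @ \oo --> rC l.
Proof.
move=> /cvgrPdist_lt wl; apply/cvg_rCP => e e0.
apply: filterS (wl e e0) => N h.
have -> : rC l - rC (w N) = rC (l - w N) by rewrite /rC; apply/eqP; rewrite eq_complex /= subrr !eqxx.
by rewrite /rC normc_def /= expr0n addr0 sqrtr_sqr rC_lt.
Qed.

Lemma rC_sum (I : Type) (r : seq I) (P : pred I) (F : I -> R) :
  rC (\sum_(i <- r | P i) F i) = \sum_(i <- r | P i) rC (F i).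
Proof. by apply: big_morph; [exact: rCD|exact: rC0]. Qed.

Lemma rC_Re_ge0 (z : C) : 0 <= z -> rC (complex.Re z) = z.
Proof. by move=> /ge0_rC[r _ ->]. Qed.

Lemma nonneg_series_cvg u B : (forall k, 0 <= u k) ->
  (forall N, \sum_(k < N) u k <= rC B) ->
  exists2 l : R, series (fun k => complex.Re (u k)) @ \oo --> l & cvgn (series u).
Proof.
move=> u0 uB.
have E N : series u N = rC (series (fun k => complex.Re (u k)) N).
  by rewrite /series /= rC_sum; apply: eq_bigr => k _; rewrite rC_Re_ge0.
have : cvgn (series (fun k => complex.Re (u k))).
  apply: nondecreasing_is_cvgn.
    apply/nondecreasing_seqP => N; rewrite -rC_le -!E.
    by rewrite (seriesSr u N) lerDl; exact: u0.
  by exists B => _ [N _ <-]; rewrite -rC_le -E /series /= big_mkord.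
move=> /cvg_ex[l ul]; exists l => //; apply/cvg_ex; exists (rC l).
by rewrite (_ : series u = fun N => rC (series (fun k => complex.Re (u k)) N)); [exact: rC_cvg|exact/funext].
Qed.

Lemma abs_series_cvg u B : (forall N, \sum_(k < N) `|u k| <= rC B) ->
  exists l : C, (fun N => \sum_(k < N) u k) @ \oo --> l.
Proof.
move=> uB.
have aux (p : C -> R) : (forall z w, p (z + w) = p z + p w) -> p 0 = 0 ->
    (forall z : C, rC `|p z| <= `|z|) ->
    exists l : R, (fun N => p (\sum_(k < N) u k)) @ \oo --> l.
  move=> pD p0 pn.
  have : cvgn (series (fun k => p (u k))).
    apply: normed_cvg; apply: nondecreasing_is_cvgn.
      by apply/nondecreasing_seqP => N; rewrite [leRHS]seriesSr lerDl; exact: normr_ge0.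
    exists B => _ [N _ <-]; rewrite -rC_le; apply: le_trans (uB N).
    by rewrite /series /= rC_sum big_mkord; apply: ler_sum => k _; exact: pn.
  move=> /cvg_ex[l ul]; exists l.
  rewrite (_ : (fun _ => _) = series (fun k => p (u k))) //; apply/funext => N.
  by rewrite /series /= big_mkord (big_morph p pD p0).
have [a ua] := aux (fun z => complex.Re z) (fun z w => raddfD _ z w) (raddf0 _) (@normRe_le R).
have [b ub] := aux (fun z => complex.Im z) (fun z w => raddfD _ z w) (raddf0 _) (@normIm_le R).
exists (Complex a b); apply/cvg_rCP => e e0.
have e2 : 0 < e / 2 by rewrite divr_gt0.
move/cvgrPdist_lt: ua => /(_ _ e2) ua; move/cvgrPdist_lt: ub => /(_ _ e2) ub.
apply: filterS (filterI ua ub) => N [/= h1 h2].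
apply: le_lt_trans (norm_le_ReIm _) _; rewrite rC_lt (splitr e).
by apply: ltrD; rewrite raddfB.
Qed.

Lemma cvg_series_bounded u : (forall k, 0 <= u k) -> cvgn (series u) ->
  exists B : R, forall N, \sum_(k < N) u k <= rC B.
Proof.
move=> u0 /cvg_ex[l /cvg_rCP /(_ 1 ltr01) [M _ MP]].
have [B B0 BE] := ge0_rC (addr_ge0 (normr_ge0 l) (ler01 : 0 <= 1 :> C)).
exists B => N; rewrite -BE.
have mono : \sum_(k < N) u k <= series u (maxn N M).
  rewrite /series /= big_mkord -(subnKC (leq_maxl N M)) big_split_ord /= lerDl.
  by apply: sumr_ge0.
apply: le_trans mono _.
have h := MP (maxn N M) (leq_maxr N M).
rewrite -[leLHS]ger0_norm; last by rewrite /series /=; apply: sumr_ge0.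
rewrite -[series u _](subrK l) addrC; apply: le_trans (ler_normD _ _) _.
by rewrite lerD2l distrC; apply: ltW.
Qed.

End ComplexSeries.

Section Expansions.
Variables (R : realType) (n : nat).
Local Notation C := (Cplx R).
Local Notation Cn := 'rV[C]_n.
Implicit Types (f g h : Cn -> C) (x : Cn) (s t : nat -> form R n).

Definition order_ge N (D : Cn -> C) := exists rho K : R,
  0 < rho /\ forall x, `|x| <= rC rho -> `|D x| <= rC K * `|x| ^+ N.

(** The convergence condition bounds coefficients rather than values, because such a bound passes to
    products and inverses through Cauchy products. [expansion_analytic] and [analytic_expansion]
    compare it with [power_series_of]. *)
Definition expansion f s := (forall k, homog k (s k)) /\
  exists rho B : R, [/\ 0 < rho,
    forall N, \sum_(k < N) fnorm (s k) * rC rho ^+ k <= rC B &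
    forall x, `|x| <= rC rho -> (fun N => \sum_(k < N) feval (s k) x) @ \oo --> f x].

Lemma expansion_analytic f s : expansion f s -> power_series_of f (coef_of s).
Proof.
move=> [sk [rho [B [rho0 sB sf]]]]; apply/nbhs_rC; exists rho => // x.
rewrite subr0 => /ltW xr; split.
  have [||l _ //] := @nonneg_series_cvg R (fun k => degree_sum k (fun al =>
     `|coef_of s al * monomial al x|)) B.
    by move=> k; apply: sumr_ge0.
  move=> N; apply: le_trans (sB N); apply: ler_sum => k _.
  apply: le_trans (norm_coef_of _ (sk k)) _; rewrite ler_wpM2l ?fnorm_ge0 //.
  by rewrite lerXn2r ?nnegrE // -rC0 rC_le ltW.
rewrite (_ : series _ = fun N => \sum_(k < N) feval (s k) x); first exact: sf.
apply/funext => N; rewrite /series /= big_mkord; apply: eq_bigr => k _.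
exact: hom_component_coef_of.
Qed.

Lemma analytic_expansion f a : power_series_of f a -> expansion f (form_of a).
Proof.
move=> /nbhs_rC[r r0 rP]; split; first by move=> k; exact: homog_form_of.
(* At a point with equal coordinates, all monomials of degree [k] have the same value [(r / 2) ^ k];
   absolute convergence there is the bound on the coefficients. *)
pose y : Cn := const_mx (rC (r / 2)).
have r2 : 0 < r / 2 by rewrite divr_gt0.
have r20 : 0 <= rC (r / 2) by rewrite -rC0 rC_le ltW.
have yr : `|y - 0| < rC r.
  rewrite subr0; apply: (@le_lt_trans _ _ (rC (r / 2))); last by rewrite rC_lt; lra.
  by apply: norm_le_coord => // i; rewrite mxE ger0_norm.
have [yc _] := rP y yr.
have [B yB] := cvg_series_bounded (fun k => sumr_ge0 _ (fun b _ => normr_ge0 _)) yc.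
exists (r / 2), B; split; first exact: r2.
  move=> N; apply: le_trans (yB N); apply: ler_sum => k _.
  rewrite fnorm_form_of mulr_suml; apply: ler_sum => b /eqP bk.
  rewrite normrM ler_wpM2l // /monomial (eq_bigr (fun i => rC (r / 2) ^+ b i)); last first.
    by move=> i _; rewrite mxE ffunE.
  by rewrite prodrXr bk normrX ger0_norm.
move=> x xr; have [|_] := rP x.
  by rewrite subr0; apply: le_lt_trans xr _; rewrite rC_lt; lra.
rewrite (_ : series _ = fun N => \sum_(k < N) feval (form_of a k) x) //.
apply/funext => N; rewrite /series /= big_mkord; apply: eq_bigr => k _.
by rewrite feval_form_of.
Qed.

(** A term of degree k >= N is at most its majorant at radius [rho] times (|x| / rho)^N, which gives
    the constant [B / rho ^+ N]. *)
Lemma expansion_remainder f s N : expansion f s ->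
  order_ge N (fun x => f x - \sum_(k < N) feval (s k) x).
Proof.
move=> [sk [rho [B [rho0 sB sf]]]].
have rr : 0 < rC rho by rewrite -rC0 rC_lt.
exists rho, (B / rho ^+ N); split => // x xr.
have B0 : 0 <= rC B by apply: le_trans (sB 0%N); rewrite big_ord0.
apply: norm_lim_le (sf x xr) _.
  by rewrite mulr_ge0 // rCM mulr_ge0 // -rC0 rC_le invr_ge0 exprn_ge0 // ltW.
exists N => // M /= NM.
have -> : rC (B / rho ^+ N) * `|x| ^+ N = rC B * (`|x| / rC rho) ^+ N.
  by rewrite rCM expr_div_n rCV rCX mulrAC mulrA.
have q0 : 0 <= `|x| / rC rho by rewrite divr_ge0 // ltW.
have q1 : `|x| / rC rho <= 1 by rewrite ler_pdivrMr // mul1r.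
rewrite -(subnKC NM) big_split_ord /= [X in X - _]addrC addrK.
apply: le_trans (ler_norm_sum _ _ _) _.
apply: (@le_trans _ _ ((\sum_(k < N + (M - N)) fnorm (s k) * rC rho ^+ k) *
    (`|x| / rC rho) ^+ N)); last by rewrite ler_wpM2r ?exprn_ge0.
rewrite big_split_ord /= mulrDl ler_wpDl //.
  rewrite mulr_ge0 ?exprn_ge0 //; apply: sumr_ge0 => k _.
  by rewrite mulr_ge0 ?fnorm_ge0 ?exprn_ge0 // ltW.
rewrite mulr_suml; apply: ler_sum => k _.
apply: le_trans (norm_feval x (sk _)) _.
rewrite -mulrA ler_wpM2l ?fnorm_ge0 //.
have -> : `|x| = `|x| / rC rho * rC rho by rewrite divfK ?gt_eqF.
rewrite mulfK ?gt_eqF // exprMn mulrC ler_wpM2l ?exprn_ge0 ?(ltW rr) //.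
by rewrite exprD ler_piMr ?exprn_ge0 ?exprn_ile1.
Qed.

Lemma order_ge_germ_eq N D D' : germ_eq D D' -> order_ge N D -> order_ge N D'.
Proof.
move=> /nbhs_rC[r r0 DD'] [rho [K [rho0 H]]].
exists (Num.min (r / 2) rho), K; split; first by rewrite lt_min rho0 divr_gt0.
move=> x xr; rewrite -DD'; last first.
  rewrite subr0; apply: le_lt_trans xr _; rewrite rC_lt.
  by rewrite (@le_lt_trans _ _ (r / 2)) // ?ge_min ?lexx //; lra.
by apply: H; apply: le_trans xr _; rewrite rC_le ge_min lexx orbT.
Qed.

Lemma order_ge_mono N D (r : R) : order_ge N D -> 0 < r ->
  exists rho K : R, [/\ 0 < rho, rho <= r, 0 <= K &
    forall x, `|x| <= rC rho -> `|D x| <= rC K * `|x| ^+ N].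
Proof.
move=> [rho [K [rho0 H]]] r0; exists (Num.min r rho), `|K|; split => //.
- by rewrite lt_min r0.
- by rewrite ge_min lexx.
move=> x xr; apply: le_trans (H x _) _.
  by apply: le_trans xr _; rewrite rC_le ge_min lexx orbT.
by rewrite ler_wpM2r ?exprn_ge0 // rC_le ler_norm.
Qed.

Lemma order_geD N D D' : order_ge N D -> order_ge N D' ->
  order_ge N (fun x => D x + D' x).
Proof.
move=> oD oD'; have [r [K [r0 _ K0 H]]] := order_ge_mono oD ltr01.
have [r' [K' [r'0 r'r K'0 H']]] := order_ge_mono oD' r0.
exists r', (K + K'); split => // x xr; apply: le_trans (ler_normD _ _) _.
rewrite rCD mulrDl lerD ?H' // H //; apply: le_trans xr _.
by rewrite rC_le.
Qed.

Lemma order_geM N M D D' : order_ge N D -> order_ge M D' ->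
  order_ge (N + M) (fun x => D x * D' x).
Proof.
move=> oD oD'; have [r [K [r0 _ K0 H]]] := order_ge_mono oD ltr01.
have [r' [K' [r'0 r'r K'0 H']]] := order_ge_mono oD' r0.
exists r', (K * K'); split => // x xr.
rewrite normrM rCM exprD mulrACA ler_pM ?H' // H //; apply: le_trans xr _.
by rewrite rC_le.
Qed.

Lemma order_ge_weaken N M D : (N <= M)%N -> order_ge M D -> order_ge N D.
Proof.
move=> NM oD; have [r [K [r0 r1 K0 H]]] := order_ge_mono oD ltr01.
exists r, K; split => // x xr; apply: le_trans (H x xr) _.
rewrite ler_wpM2l -?rC0 ?rC_le // -(subnKC NM) exprD ler_piMr ?exprn_ge0 //.
by rewrite exprn_ile1 //; apply: le_trans xr _; rewrite -rC1 rC_le.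
Qed.

Lemma order_ge_feval k (s : form R n) : homog k s -> order_ge k (feval s).
Proof.
move=> sk; have [B _ BE] := ge0_rC (fnorm_ge0 s).
by exists 1, B; split => // x _; rewrite -BE; exact: norm_feval.
Qed.

(** Along the ray t x the value scales exactly as t^k but is bounded by a multiple of t^(k+1), so a
    small t > 0 gives a contradiction. This is how homogeneous parts are identified throughout. *)
Lemma order_ge_homogeneous k D :
  (forall c x, D (c *: x) = c ^+ k * D x) -> order_ge k.+1 D -> forall x, D x = 0.
Proof.
move=> Dh oD x; apply/eqP; rewrite -normr_eq0; apply/negPn/negP => Dx.
have {Dx} Dx : 0 < `|D x| by rewrite lt_def Dx normr_ge0.
have [de de0 deE] := gt0_rC Dx; have [X X0 XE] := ge0_rC (normr_ge0 x).
have [rho [K [rho0 _ K0 H]]] := order_ge_mono oD ltr01.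
pose t := Num.min (rho / (X + 1)) (de / (K * X ^+ k.+1 + 1)).
have KX0 : 0 <= K * X ^+ k.+1 by rewrite mulr_ge0 ?exprn_ge0.
have t0 : 0 < t by rewrite lt_min !divr_gt0 ?ltr_wpDl.
have t1 : t * X <= rho.
  apply: (@le_trans _ _ (rho / (X + 1) * X)); first by rewrite ler_wpM2r // ge_min lexx.
  by rewrite mulrAC ler_pdivrMr ?ltr_wpDl // ler_wpM2l ?lerDl // ltW.
have t2 : K * X ^+ k.+1 * t < de.
  apply: (@le_lt_trans _ _ (K * X ^+ k.+1 * (de / (K * X ^+ k.+1 + 1)))).
    by rewrite ler_wpM2l // ge_min lexx orbT.
  by rewrite mulrA ltr_pdivrMr ?ltr_wpDl // mulrC ltr_pM2l // ltrDl.
have tC : `|rC t| = rC t by rewrite ger0_norm // -rC0 rC_le ltW.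
have := H (rC t *: x); rewrite normrZ tC XE -rCM rC_le => /(_ t1).
rewrite Dh normrM normrX tC deE -!rCX -!rCM rC_le exprMn exprSr => h.
have : t ^+ k * de <= t ^+ k * (K * X ^+ k.+1 * t).
  by apply: le_trans h _; rewrite le_eqVlt; apply/orP; left; apply/eqP; ring.
by rewrite ler_pM2l ?exprn_gt0 // leNgt t2.
Qed.

Lemma expansion_germ_eq f g s : germ_eq f g -> expansion f s -> expansion g s.
Proof.
move=> /nbhs_rC[r r0 fg] [sk [rho [B [rho0 sB sf]]]]; split; first exact: sk.
exists (Num.min (r / 2) rho), B; split.
- by rewrite lt_min rho0 divr_gt0.
- move=> N; apply: le_trans (sB N); apply: ler_sum => k _.
  rewrite ler_wpM2l ?fnorm_ge0 // lerXn2r ?nnegrE -?rC0 ?rC_le ?(ltW rho0) //.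
    by rewrite le_min (ltW rho0) divr_ge0 // ltW.
  by rewrite ge_min lexx orbT.
move=> x xr; rewrite -fg.
  by apply: sf; apply: le_trans xr _; rewrite rC_le ge_min lexx orbT.
rewrite subr0; apply: le_lt_trans xr _; rewrite rC_lt.
by rewrite (@le_lt_trans _ _ (r / 2)) // ?ge_min ?lexx //; lra.
Qed.

(** Once the lower degrees agree, the difference of the two remainders is, to order [k.+1], the
    difference of the forms of degree [k], and [order_ge_homogeneous] kills it. *)
Lemma expansion_unique f s t : expansion f s -> expansion f t ->
  forall k x, feval (s k) x = feval (t k) x.
Proof.
move=> fs ft k; elim/ltn_ind: k => k IHk x; apply/eqP; rewrite -subr_eq0; apply/eqP.
apply: (@order_ge_homogeneous k (fun x => feval (s k) x - feval (t k) x)).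
  by move=> c y; rewrite (feval_scale _ _ (fs.1 k)) (feval_scale _ _ (ft.1 k)) mulrBr.
have [rho [K [rho0 H]]] := expansion_remainder k.+1 fs.
have o1 := expansion_remainder k.+1 ft.
have o2 : order_ge k.+1 (fun x => - (f x - \sum_(j < k.+1) feval (s j) x)).
  by exists rho, K; split => // y yr; rewrite normrN; exact: H.
have := order_geD o2 o1; congr order_ge; apply/funext => y.
rewrite opprB addrA subrK !big_ord_recr /=.
rewrite (eq_bigr (fun j : 'I_k => feval (t j) y)) => [|j _]; last by rewrite IHk.
by rewrite opprD addrACA subrr add0r.
Qed.

End Expansions.

(** * Products and inverses of convergent power series *)

Lemma sum_triangle (V : nmodType) (F : nat -> nat -> V) N :
  \sum_(k < N) \sum_(i < k.+1) F i (k - i)%N =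
  \sum_(i < N) \sum_(j < N | (i + j < N)%N) F i j.
Proof.
transitivity (\sum_(k < N) \sum_(i < N) \sum_(j < N | (i + j == k)%N) F i j).
  apply: eq_bigr => k _; rewrite (big_ord_widen N (fun i => F i (k - i)%N)) //.
  rewrite big_mkcond; apply: eq_bigr => i _; case: ltnP => ik.
    have kiN : (k - i < N)%N by apply: leq_ltn_trans (leq_subr _ _) (ltn_ord k).
    rewrite (big_pred1 (Ordinal kiN)) // => j; rewrite /= -val_eqE /=; lia.
  by rewrite big_pred0 // => j; lia.
rewrite exchange_big; apply: eq_bigr => i _ /=.
rewrite (exchange_big_dep predT) //= [RHS]big_mkcond; apply: eq_bigr => j _.
case: ltnP => ij; last by rewrite big_pred0 // => k; have := ltn_ord k; lia.
by rewrite (big_pred1 (Ordinal ij)) // => k; rewrite /= -val_eqE eq_sym.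
Qed.

Lemma cauchy_le (K : numDomainType) (a b : nat -> K) N :
  (forall i, 0 <= a i) -> (forall i, 0 <= b i) ->
  \sum_(k < N) \sum_(i < k.+1) a i * b (k - i)%N <=
  (\sum_(i < N) a i) * (\sum_(j < N) b j).
Proof.
move=> a0 b0; rewrite (sum_triangle (fun i j => a i * b j)) mulr_suml.
apply: ler_sum => i _; rewrite mulr_sumr [leRHS](bigID (fun j : 'I_N => (i + j < N)%N)) /=.
by rewrite lerDl sumr_ge0 // => j _; rewrite mulr_ge0.
Qed.

(** Only the pairs with i + j >= N survive in the difference, and each is at most a_i b_j q^(i+j),
    hence at most a_i b_j q^N. *)
Lemma cauchy_diff (K : numDomainType) (u v a b : nat -> K) (q : K) N :
  0 <= q <= 1 -> (forall i, 0 <= a i) -> (forall i, 0 <= b i) ->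
  (forall i, `|u i| <= a i * q ^+ i) -> (forall i, `|v i| <= b i * q ^+ i) ->
  `|(\sum_(i < N) u i) * (\sum_(j < N) v j) -
    \sum_(k < N) \sum_(i < k.+1) u i * v (k - i)%N| <=
  (\sum_(i < N) a i) * (\sum_(j < N) b j) * q ^+ N.
Proof.
move=> /andP[q0 q1] a0 b0 ua vb.
rewrite (sum_triangle (fun i j => u i * v j)) mulr_suml -sumrB -mulrA mulr_suml.
apply: le_trans (ler_norm_sum _ _ _) _; apply: ler_sum => i _.
rewrite mulr_sumr (bigID (fun j : 'I_N => (i + j < N)%N)) /= [X in X - _]addrC addrK.
apply: le_trans (ler_norm_sum _ _ _) _; rewrite mulr_suml mulr_sumr.
rewrite [leRHS](bigID (fun j : 'I_N => ~~ (i + j < N)%N)) /= ler_wpDr //.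
  by apply: sumr_ge0 => j _; rewrite !mulr_ge0 ?exprn_ge0.
apply: ler_sum => j; rewrite -leqNgt => Nij; rewrite normrM.
apply: le_trans (ler_pM _ _ (ua i) (vb j)) _ => //.
rewrite mulrACA -exprD mulrA ler_wpM2l ?mulr_ge0 //.
by rewrite -(subnKC Nij) exprD ler_piMr ?exprn_ge0 ?exprn_ile1.
Qed.

Section ExpansionRing.
Variables (R : realType) (n : nat).
Local Notation C := (Cplx R).
Local Notation Cn := 'rV[C]_n.
Implicit Types (f g h : Cn -> C) (x : Cn) (s t : nat -> form R n).

Definition conv s t k : form R n :=
  flatten [seq fmul (s i) (t (k - i)%N) | i <- iota 0 k.+1].

Lemma feval_conv s t k x :
  feval (conv s t k) x = \sum_(i < k.+1) feval (s i) x * feval (t (k - i)%N) x.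
Proof.
rewrite /feval /conv big_flatten big_map -[iota 0 k.+1]/(index_iota 0 k.+1) big_mkord.
by apply: eq_bigr => i _; exact: feval_mul.
Qed.

Lemma fnorm_conv s t k :
  fnorm (conv s t k) = \sum_(i < k.+1) fnorm (s i) * fnorm (t (k - i)%N).
Proof.
rewrite /fnorm /conv big_flatten big_map -[iota 0 k.+1]/(index_iota 0 k.+1) big_mkord.
by apply: eq_bigr => i _; exact: fnorm_mul.
Qed.

Lemma homog_conv s t : (forall k, homog k (s k)) -> (forall k, homog k (t k)) ->
  forall k, homog k (conv s t k).
Proof.
move=> sk tk k; rewrite /homog /conv.
have : all (fun i => i <= k)%N (iota 0 k.+1).
  by apply/allP => i; rewrite mem_iota.
elim: (iota _ _) => //= i r IHr /andP[ik rk]; rewrite all_cat IHr // andbT.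
by have := homog_mul (sk i) (tk (k - i)%N); rewrite subnKC.
Qed.

Lemma expansion_rho f s (r : R) : 0 < r -> expansion f s ->
  exists rho B : R, [/\ 0 < rho, rho <= r, 0 <= B,
    forall N, \sum_(k < N) fnorm (s k) * rC rho ^+ k <= rC B &
    forall x, `|x| <= rC rho -> (fun N => \sum_(k < N) feval (s k) x) @ \oo --> f x].
Proof.
move=> r0 [sk [rho [B [rho0 sB sf]]]].
have m0 : 0 < Num.min r rho by rewrite lt_min r0.
exists (Num.min r rho), B; split.
- exact: m0.
- by rewrite ge_min lexx.
- by rewrite -rC_le; apply: le_trans (sB 0%N); rewrite big_ord0.
- move=> N; apply: le_trans (sB N); apply: ler_sum => k _.
  rewrite ler_wpM2l ?fnorm_ge0 // lerXn2r ?nnegrE -?rC0 ?rC_le ?(ltW rho0) ?(ltW m0) //.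
  by rewrite ge_min lexx orbT.
by move=> x xr; apply: sf; apply: le_trans xr _; rewrite rC_le ge_min lexx orbT.
Qed.

Lemma expansion_mul f g s t : expansion f s -> expansion g t ->
  expansion (fun x => f x * g x) (conv s t).
Proof.
move=> fs gt; have [r [B [r0 _ B0 sB sf]]] := expansion_rho ltr01 fs.
have [rho [B' [rho0 rr B'0 tB tg]]] := expansion_rho r0 gt.
have rho0' : 0 <= rC rho by rewrite -rC0 rC_le ltW.
have {}sB N : \sum_(k < N) fnorm (s k) * rC rho ^+ k <= rC B.
  apply: le_trans (sB N); apply: ler_sum => k _.
  by rewrite ler_wpM2l ?fnorm_ge0 // lerXn2r ?nnegrE ?rC_le // ltW.
(* On the ball of half the radius, a term of degree i gains the factor 2^-i; this is [cauchy_diff]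
   with q = 1/2, whose error tends to 0. *)
have h0 : 0 < rho / 2 by rewrite divr_gt0.
have hr : rC (rho / 2) = rC rho / 2.
  by rewrite rCM rCV; congr (_ / _); rewrite -[2]/(1 + 1) rCD rC1.
split; first exact: homog_conv fs.1 gt.1.
exists (rho / 2), (B * B'); split; first exact: h0.
  move=> N; rewrite (rCM B).
  have a0 (w : nat -> form R n) k : 0 <= fnorm (w k) * rC rho ^+ k.
    by rewrite mulr_ge0 ?fnorm_ge0 ?exprn_ge0.
  have sum0 (w : nat -> form R n) : 0 <= \sum_(k < N) fnorm (w k) * rC rho ^+ k.
    by apply: sumr_ge0 => k _; exact: a0.
  have le_BB := ler_pM (sum0 s) (sum0 t) (sB N) (tB N).
  apply: (le_trans _ le_BB).
  apply: (le_trans _ (cauchy_le N (a0 s) (a0 t))).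
  apply: ler_sum => k _; rewrite fnorm_conv mulr_suml; apply: ler_sum => i _.
  rewrite mulrACA -exprD subnKC; last by rewrite -ltnS.
  rewrite ler_wpM2l ?mulr_ge0 ?fnorm_ge0 // lerXn2r ?nnegrE //.
    by rewrite -rC0 rC_le ltW.
  by rewrite rC_le; lra.
move=> x xr.
have xr1 : `|x| <= rC r by apply: le_trans xr _; rewrite rC_le; lra.
have xr2 : `|x| <= rC rho by apply: le_trans xr _; rewrite rC_le; lra.
pose a i := fnorm (s i) * rC rho ^+ i; pose b i := fnorm (t i) * rC rho ^+ i.
have a0 i : 0 <= a i by rewrite mulr_ge0 ?fnorm_ge0 ?exprn_ge0.
have b0 i : 0 <= b i by rewrite mulr_ge0 ?fnorm_ge0 ?exprn_ge0.
have bound (w : nat -> form R n) (wk : forall k, homog k (w k)) i :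
    `|feval (w i) x| <= fnorm (w i) * rC rho ^+ i * 2^-1 ^+ i.
  apply: le_trans (norm_feval x (wk i)) _.
  rewrite -mulrA -exprMn -hr ler_wpM2l ?fnorm_ge0 // lerXn2r ?nnegrE //.
  by rewrite -rC0 rC_le ltW.
have q01 : 0 <= (2^-1 : C) <= 1 by rewrite invr_ge0 ler0n invf_le1 ?ltr0n ?ler1n.
have D N := cauchy_diff N q01 a0 b0 (bound s fs.1) (bound t gt.1).
have P := cvgM (sf x xr1) (tg x xr2).
rewrite (_ : (fun N => _) = (fun N =>
  (\sum_(i < N) feval (s i) x) * (\sum_(j < N) feval (t j) x) -
  ((\sum_(i < N) feval (s i) x) * (\sum_(j < N) feval (t j) x) -
  \sum_(k < N) \sum_(i < k.+1) feval (s i) x * feval (t (k - i)%N) x))); last first.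
  by apply/funext => N; rewrite subKr; apply: eq_bigr => k _; exact: feval_conv.
rewrite -[f x * g x]subr0; apply: cvgB; first exact: P.
apply/cvg_rCP => e e0; have e1 : 0 < e / (B * B' + 1).
  by rewrite divr_gt0 // ltr_wpDl // mulr_ge0.
have /cvgrPdist_lt /(_ _ e1) : (fun N => 2^-1 ^+ N : R) @ \oo --> (0 : R).
  by apply: cvg_expr; rewrite ger0_norm ?invf_lt1 ?ltr1n.
apply: filterS => N; rewrite !sub0r !normrN => qN.
apply: le_lt_trans (D N) _.
apply: (@le_lt_trans _ _ (rC B * rC B' * 2^-1 ^+ N)).
  rewrite ler_wpM2r ?exprn_ge0 ?(andP q01).1 // ler_pM ?sB ?tB //.
    by apply: sumr_ge0 => k _; exact: a0.
  by apply: sumr_ge0 => k _; exact: b0.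
have -> : (2^-1 : C) = rC 2^-1.
  by rewrite rCV; congr (_^-1); rewrite -[2]/(1 + 1) rCD rC1.
rewrite -rCX -!rCM rC_lt; move: qN; rewrite ger0_norm ?exprn_ge0 ?invr_ge0 //.
rewrite ltr_pdivlMr ?ltr_wpDl ?mulr_ge0 //; apply: le_lt_trans.
by rewrite mulrC ler_wpM2l ?exprn_ge0 ?invr_ge0 ?lerDl.
Qed.

End ExpansionRing.

Section ExpansionOps.
Variables (R : realType) (n : nat).
Local Notation C := (Cplx R).
Local Notation Cn := 'rV[C]_n.
Implicit Types (f g h : Cn -> C) (x : Cn) (s t : nat -> form R n).

Lemma expansion_add f g s t : expansion f s -> expansion g t ->
  expansion (fun x => f x + g x) (fun k => s k ++ t k).
Proof.
move=> fs gt; have [r [B [r0 _ B0 sB sf]]] := expansion_rho ltr01 fs.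
have [rho [B' [rho0 rr B'0 tB tg]]] := expansion_rho r0 gt.
split; first by move=> k; rewrite homog_cat fs.1 gt.1.
exists rho, (B + B'); split; first exact: rho0.
  move=> N; rewrite rCD; apply: le_trans (lerD (sB N) (tB N)).
  rewrite -big_split /=; apply: ler_sum => k _.
  rewrite fnorm_cat mulrDl lerD2r ler_wpM2l ?fnorm_ge0 //.
  by rewrite lerXn2r ?nnegrE -?rC0 ?rC_le // ltW.
move=> x xr; rewrite (_ : (fun N => _) = (fun N => \sum_(k < N) feval (s k) x +
    \sum_(k < N) feval (t k) x)); last first.
  by apply/funext => N; rewrite -big_split /=; apply: eq_bigr => k _; rewrite feval_cat.
by apply: cvgD; [apply: sf; apply: le_trans xr _; rewrite rC_le|exact: tg].
Qed.

Definition single (k : nat) (s0 : form R n) (j : nat) : form R n := if j == k then s0 else [::].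

Lemma sum_single (V : nmodType) k N (F : form R n -> V) (s0 : form R n) : F [::] = 0 ->
  \sum_(j < N) F (single k s0 j) = if (k < N)%N then F s0 else 0.
Proof.
move=> F0; case: ltnP => kN.
  rewrite (bigD1 (Ordinal kN)) //= /single eqxx big1 ?addr0 // => j.
  by rewrite -val_eqE /= => /negbTE ->.
rewrite big1 // => j _; rewrite /single ltn_eqF //.
exact: leq_trans (ltn_ord j) kN.
Qed.

Lemma expansion_feval k (s0 : form R n) :
  homog k s0 -> expansion (feval s0) (single k s0).
Proof.
move=> sk; split; first by move=> j; rewrite /single; case: eqP => [->|].
have [B B0 BE] := ge0_rC (fnorm_ge0 s0).
exists 1, B; split; first exact: ltr01.
  move=> N; rewrite (eq_bigr (fun j : 'I_N => fnorm (single k s0 j))); last first.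
    by move=> j _; rewrite rC1 expr1n mulr1.
  rewrite sum_single ?fnorm_nil // -BE; case: ltnP => // _.
  exact: fnorm_ge0.
move=> x _; apply: cvg_near_cst; exists k.+1 => // N /= kN.
by rewrite (@sum_single _ k N (fun w => feval w x)) ?feval_nil ?kN.
Qed.

(* The coefficients of the inverse series solve [c q_(k+1) = - sum_j h_(j+1)
   q_(k-j)]; the table is built by course-of-values recursion. *)
Fixpoint inv_table (c : C) s k : nat -> form R n :=
  if k is k'.+1 then
    fun i => if i == k then
        flatten [seq fscale (- c^-1) (fmul (s j.+1) (inv_table c s k' (k' - j)%N))
                | j <- iota 0 k]
      else inv_table c s k' i
  else fun=> [:: (c^-1, [::])].

Definition inv_forms c s k := inv_table c s k k.

Lemma inv_table_stable c s k i : (i <= k)%N -> inv_table c s k i = inv_forms c s i.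
Proof.
elim: k => [|k IHk]; first by rewrite leqn0 => /eqP ->.
rewrite leq_eqVlt ltnS => /orP[/eqP -> //|ik].
by rewrite /= ltn_eqF ?ltnS // IHk.
Qed.

Lemma inv_formsS c s k : inv_forms c s k.+1 =
  flatten [seq fscale (- c^-1) (fmul (s j.+1) (inv_forms c s (k - j)%N))
          | j <- iota 0 k.+1].
Proof.
have -> : inv_forms c s k.+1 =
    flatten [seq fscale (- c^-1) (fmul (s j.+1) (inv_table c s k (k - j)%N))
            | j <- iota 0 k.+1] by rewrite /inv_forms /= eqxx.
by congr flatten; apply: eq_map => j; rewrite inv_table_stable // leq_subr.
Qed.

Lemma feval_inv_formsS c s k x : feval (inv_forms c s k.+1) x =
  - c^-1 * \sum_(j < k.+1) feval (s j.+1) x * feval (inv_forms c s (k - j)%N) x.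
Proof.
rewrite inv_formsS {1}/feval big_flatten big_map -[iota 0 k.+1]/(index_iota 0 k.+1) big_mkord.
rewrite mulr_sumr; apply: eq_bigr => j _.
by rewrite -/(feval _ x) feval_fscale feval_mul.
Qed.

Lemma fnorm_inv_formsS c s k : fnorm (inv_forms c s k.+1) =
  `|c|^-1 * \sum_(j < k.+1) fnorm (s j.+1) * fnorm (inv_forms c s (k - j)%N).
Proof.
rewrite inv_formsS {1}/fnorm big_flatten big_map -[iota 0 k.+1]/(index_iota 0 k.+1) big_mkord.
rewrite mulr_sumr; apply: eq_bigr => j _.
by rewrite -/(fnorm _) fnorm_fscale fnorm_mul normrN normfV.
Qed.

Lemma homog_inv_forms c s : (forall k, homog k (s k)) ->
  forall k, homog k (inv_forms c s k).
Proof.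
move=> sk k; elim/ltn_ind: k => -[//|k] IHk; rewrite inv_formsS /homog.
have : all (fun j => j <= k)%N (iota 0 k.+1).
  by apply/allP => i; rewrite mem_iota.
elim: (iota _ _) => //= i r IHr /andP[ik rk]; rewrite all_cat IHr // andbT.
have := homog_mul (sk i.+1) (IHk (k - i)%N _); rewrite -(homog_fscale _ (- c^-1)).
by rewrite addSn subnKC //; apply; rewrite ltnS leq_subr.
Qed.

Lemma feval_homog0 (s0 : form R n) x y : homog 0 s0 -> feval s0 x = feval s0 y.
Proof.
move=> /allP s0h; apply: eq_big_seq => c /s0h; rewrite size_eq0 => /eqP ->.
by rewrite !big_nil.
Qed.

Lemma expansion_at0 f s : expansion f s -> f 0 = feval (s 0%N) 0.
Proof.
move=> [sk [rho [B [rho0 _ sf]]]].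
have /sf : `|0 : Cn| <= rC rho by rewrite normr0 -rC0 rC_le ltW.
move=> cf; apply: (norm_cvg_unique cf); apply: cvg_near_cst; exists 1%N => // -[//|N] _ /=.
rewrite big_ord_recl big1 ?addr0 // => i _.
by rewrite -(scale0r 0) (feval_scale _ _ (sk _)) /= expr0n mul0r.
Qed.

Lemma analytic_inverse h : analytic_germ h -> h 0 != 0 ->
  exists2 q, analytic_germ q & germ_eq (cst 1) (fun x => q x * h x).
Proof.
move=> [a /analytic_expansion]; move: (form_of a) => s {a} hs h0.
pose c := h 0; pose r := inv_forms c s.
have c0 : 0 < `|c| by rewrite normr_gt0.
have [rho1 [B [rho10 _ B0 sB _]]] := expansion_rho ltr01 hs.
have [d d0 dE] := gt0_rC c0.
(* The radius shrinks by [th] until the nonconstant part of [h] has norm at most d / 2, half of |h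
   0|. That part has degree at least 1, and [th <= 1], so one factor [th] can be extracted from each
   term. *)
pose th := Num.min 1 (d / (2 * (B + 1))).
have th0 : 0 < th by rewrite lt_min ltr01 divr_gt0 // mulr_gt0 // ltr_wpDl.
have thB : th * B <= d / 2.
  apply: (@le_trans _ _ (d / (2 * (B + 1)) * B)).
    by rewrite ler_wpM2r // ge_min lexx orbT.
  rewrite invfM mulrA -mulrA ler_piMr ?divr_ge0 ?(ltW d0) //.
  by rewrite mulrC ler_pdivrMr ?ltr_wpDl // mul1r lerDl.
have r10 : 0 <= rC rho1 by rewrite -rC0 rC_le ltW.
have th0' : 0 <= rC th by rewrite -rC0 rC_le ltW.
have th1 : rC th <= 1 by rewrite -rC1 rC_le ge_min lexx.
pose rho := rho1 * th.
have rho0 : 0 < rho by rewrite mulr_gt0.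
have rho0' : 0 <= rC rho by rewrite -rC0 rC_le ltW.
pose U j := fnorm (s j.+1) * rC rho ^+ j.+1.
pose V j := fnorm (r j) * rC rho ^+ j.
have U0 j : 0 <= U j by rewrite mulr_ge0 ?fnorm_ge0 ?exprn_ge0.
have V0 j : 0 <= V j by rewrite mulr_ge0 ?fnorm_ge0 ?exprn_ge0.
have Usum N : \sum_(j < N) U j <= rC (d / 2).
  apply: (@le_trans _ _ (rC th * \sum_(j < N) fnorm (s j.+1) * rC rho1 ^+ j.+1)).
    rewrite mulr_sumr; apply: ler_sum => j _; rewrite mulrCA ler_wpM2l ?fnorm_ge0 //.
    rewrite /rho rCM exprMn mulrC ler_wpM2r ?exprn_ge0 //.
    by rewrite exprS ler_piMr ?exprn_ile1.
  apply: (@le_trans _ _ (rC (th * B))); last by rewrite rC_le.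
  rewrite rCM ler_wpM2l //; apply: (le_trans _ (sB N.+1)).
  by rewrite big_ord_recl lerDr mulr_ge0 ?fnorm_ge0 ?exprn_ge0.
have VS k : V k.+1 = rC d^-1 * \sum_(j < k.+1) U j * V (k - j)%N.
  rewrite /V /r fnorm_inv_formsS dE -rCV -mulrA mulr_suml; congr (_ * _).
  apply: eq_bigr => j _; rewrite mulrACA -exprD; congr (_ * _ ^+ _).
  by rewrite addSn subnKC // -ltnS.
(* The bound reproduces itself under the recursion, since 2/d = 1/d + (1/d) (d/2) (2/d). *)
have Vsum N : \sum_(k < N) V k <= rC (2 / d).
  elim: N => [|N IHN]; first by rewrite big_ord0 -rC0 rC_le divr_ge0 // ltW.
  rewrite big_ord_recl /= {1}/V expr0 mulr1.
  have -> : fnorm (r 0%N) = rC d^-1.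
    by rewrite /r /inv_forms /= /fnorm big_seq1 normfV dE rCV.
  have -> : 2 / d = d^-1 + d^-1 * (d / 2 * (2 / d)).
    by field; rewrite gt_eqF.
  rewrite [rC (_ + _)]rCD lerD2l [rC (_ * _)]rCM.
  under eq_bigr => k _ do rewrite VS.
  rewrite -mulr_sumr ler_wpM2l -?rC0 ?rC_le ?invr_ge0 ?(ltW d0) //.
  apply: le_trans (cauchy_le N U0 V0) _; rewrite rCM.
  by apply: ler_pM; [exact: sumr_ge0|exact: sumr_ge0|exact: Usum|exact: IHN].
have rk := homog_inv_forms c hs.1.
have qex x : exists l : C, `|x| <= rC rho -> (fun N => \sum_(k < N) feval (r k) x) @ \oo --> l.
  have [xr|xr] := boolP (`|x| <= rC rho); last by exists 0.
  have [|l rl] := @abs_series_cvg R (fun k => feval (r k) x) (2 / d); last by exists l.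
  move=> N; apply: le_trans (Vsum N); apply: ler_sum => k _.
  apply: le_trans (norm_feval x (rk k)) _.
  by rewrite ler_wpM2l ?fnorm_ge0 // lerXn2r ?nnegrE.
have [q qP] := choice qex.
have qr : expansion q r.
  split; first exact: rk.
  by exists rho, (2 / d); split; [exact: rho0|exact: Vsum|exact: qP].
exists q; first by exists (coef_of r); exact: expansion_analytic.
have [_ [e [E [e0 _ He]]]] := expansion_mul hs qr.
apply/nbhs_rC; exists e => // x; rewrite subr0 => /ltW /He; rewrite mulrC => cvq.
apply/esym; apply: (norm_cvg_unique cvq); apply: cvg_near_cst; exists 1%N => // -[//|N] _ /=.
have s0 : feval (s 0%N) x = c.
  by rewrite (feval_homog0 x 0 (hs.1 0%N)) -(expansion_at0 hs).
rewrite big_ord_recl big1 ?addr0.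
  rewrite feval_conv big_ord_recl big_ord0 addr0 /= s0 /r /inv_forms /=.
  by rewrite /feval big_seq1 big_nil mulr1 divff.
move=> k _; rewrite feval_conv big_ord_recl /= s0 subn0 /r feval_inv_formsS.
rewrite mulrA mulrN divff // mulN1r.
by apply/eqP; rewrite addrC subr_eq0; apply/eqP/eq_bigr => j _; rewrite /bump /= add1n subSS.
Qed.

End ExpansionOps.

Section Pullback.
Variables (R : realType) (n m : nat) (sg : 'I_n -> 'I_m).
Local Notation C := (Cplx R).

Lemma norm_reindex (y : 'rV[C]_m) : `|(\row_i y 0 (sg i) : 'rV[C]_n)| <= `|y|.
Proof. by apply: norm_le_coord => // i; rewrite mxE norm_coord. Qed.

Lemma expansion_pullback (f : 'rV[C]_n -> C) (s : nat -> form R n) :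
  expansion f s ->
  expansion (fun y : 'rV[C]_m => f (\row_i y 0 (sg i))) (fun k => fmap sg (s k)).
Proof.
move=> [sk [rho [B [rho0 sB sf]]]]; split; first by move=> k; rewrite homog_fmap.
exists rho, B; split; first exact: rho0.
  by move=> N; under eq_bigr => k _ do rewrite fnorm_fmap; exact: sB.
move=> y yr; rewrite (_ : (fun N => _) = fun N => \sum_(k < N) feval (s k) (\row_i y 0 (sg i))).
  by apply: sf; apply: le_trans yr; exact: norm_reindex.
by apply/funext => N; apply: eq_bigr => k _; rewrite feval_fmap.
Qed.
End Pullback.

(** * Square factors and multiplicity *)

Section Convolution.
Variable A : comNzRingType.
Implicit Types u v w : nat -> A.

Definition cv u v k := \sum_(i < k.+1) u i * v (k - i)%N.

Lemma eq_cv u u' v v' k : (forall i, (i <= k)%N -> u i = u' i) ->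
  (forall i, (i <= k)%N -> v i = v' i) -> cv u v k = cv u' v' k.
Proof.
move=> uu' vv'; apply: eq_bigr => i _; rewrite uu' ?vv' ?leq_subr //.
by rewrite -ltnS.
Qed.

Lemma cv_coef u v k N : (k < N)%N ->
  cv u v k = (\poly_(i < N) u i * \poly_(i < N) v i)`_k.
Proof.
move=> kN; rewrite coefM; apply: eq_cv => i ik; rewrite coef_poly ifT //.
  exact: leq_ltn_trans kN.
exact: leq_ltn_trans kN.
Qed.

Lemma cv_coefr u (P : {poly A}) v k N : (k < N)%N ->
  (forall i, (i <= k)%N -> v i = P`_i) -> cv u v k = (\poly_(i < N) u i * P)`_k.
Proof.
move=> kN vP; rewrite coefM; apply: eq_cv => i ik; last exact: vP.
by rewrite coef_poly ifT // (leq_ltn_trans ik).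
Qed.

End Convolution.

Lemma deriv_cv (K : comNzRingType) (u v : nat -> {poly K}) k :
  (cv u v k)^`() = cv (fun i => (u i)^`()) v k + cv u (fun i => (v i)^`()) k.
Proof. by rewrite /cv raddf_sum -big_split /=; apply: eq_bigr => i _; rewrite derivM. Qed.

Section Squarefree.
Variables (K : numFieldType) (h q : nat -> {poly K}) (phi : nat -> K) (k : nat).
Hypothesis k0 : (0 < k)%N.
Hypothesis sh : forall i, (size (h i) <= i.+1)%N.
Hypothesis sq : forall i, (size (q i) <= i.+1)%N.
Hypothesis eq_phi : forall j, cv q (cv h h) j = (phi j)%:P + (j == k)%:R *: 'X^k.
Hypothesis phi_neq0 : exists j, phi j != 0.

Let W j := cv (fun i => (q i)^`()) h j + cv q (fun i => (h i)^`()) j *+ 2.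

(** Differentiation in y lowers the size of one factor by one; this drop keeps y^(k-1) out of [W j]
    for j < k. *)
Lemma size_W j : (size (W j) <= j)%N.
Proof.
have sd (u : nat -> {poly K}) i : (size (u i) <= i.+1)%N -> (size (u i)^`() <= i)%N.
  by move=> ui; apply: leq_trans (size_poly _ _) _; rewrite -ltnS; case: (size _) ui => //.
have sz (u v : {poly K}) a b : (size u + size v <= (a + b).+1)%N -> (size (u * v)%R <= a + b)%N.
  by move=> uv; apply: leq_trans (size_polyMleq _ _) _; lia.
have A : (size (cv (fun i => (q i)^`()) h j) <= j)%N.
  apply: (leq_trans (size_sum _ _ _)); apply/bigmax_leqP => i _.
  have ij : (i <= j)%N by rewrite -ltnS.
  have := @sz (q i)^`() (h (j - i)%N) i (j - i)%N; rewrite subnKC //; apply.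
  by have := sd q i (sq i); have := sh (j - i)%N; lia.
have B : (size (cv q (fun i => (h i)^`()) j) <= j)%N.
  apply: (leq_trans (size_sum _ _ _)); apply/bigmax_leqP => i _.
  have ij : (i <= j)%N by rewrite -ltnS.
  have := @sz (q i) (h (j - i)%N)^`() i (j - i)%N; rewrite subnKC //; apply.
  by have := sd h _ (sh (j - i)%N); have := sq i; lia.
rewrite /W mulr2n (leq_trans (size_polyD _ _)) // geq_max A.
by rewrite (leq_trans (size_polyD _ _)) // geq_max B.
Qed.

Lemma cv_h_W j : cv h W j = (j == k)%:R *: ('X^(k.-1) *+ k).
Proof.
transitivity ((cv q (cv h h) j)^`()); last first.
  by rewrite eq_phi derivD derivC add0r derivZ derivXn.
rewrite deriv_cv.
(* Truncated beyond degree [j], the sequences are polynomials in t, and convolutions up to [j] are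
   coefficients of their products; the product rule for [q h^2] then becomes a [ring] identity. *)
pose N := j.+1; pose tr (u : nat -> {poly K}) : {poly {poly K}} := \poly_(i < N) u i.
pose h' i := (h i)^`(); pose q' i := (q i)^`().
have c2 (u v : nat -> {poly K}) i : (i <= j)%N -> cv u v i = (tr u * tr v)`_i.
  by move=> ij; apply: cv_coef.
have -> : cv h W j = (tr h * (tr q' * tr h + tr q * tr h' *+ 2))`_j.
  apply: cv_coefr => // i ij; rewrite coefD coefMn /W.
  by rewrite (c2 _ _ _ ij) (c2 _ _ _ ij).
have -> : cv q' (cv h h) j = (tr q' * (tr h * tr h))`_j.
  by apply: cv_coefr => // i ij; exact: c2.
have -> : cv q (fun i => (cv h h i)^`()) j = (tr q * (tr h' * tr h + tr h * tr h'))`_j.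
  apply: cv_coefr => // i ij; rewrite deriv_cv coefD.
  by rewrite (c2 _ _ _ ij) (c2 _ _ _ ij).
rewrite -coefD; apply: (congr1 (fun P : {poly {poly K}} => P`_j)); ring.
Qed.

(* [h] and [q] hold the coefficients in [t] of [H] and [Q], polynomials in [y],
   where [H^2 Q = phi(t) + (t y)^k]. Differentiating in [y] gives
   [H W = k y^(k-1) t^k] with [W = H Q' + 2 H' Q]; comparing lowest terms, with
   [size (W j) <= j], excludes [h 0 0 = 0]. *)
Lemma squarefree_unit : (h 0%N)`_0 != 0.
Proof.
(* [p] is the order in t of H at y = 0. It is finite because H^2 Q restricts there to [phi], which
   is not zero. *)
have [p [hp pmin]] : exists p, (h p)`_0 != 0 /\ forall i, (i < p)%N -> (h i)`_0 = 0.
  have [j phij] := phi_neq0.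
  have : exists p, (h p)`_0 != 0.
    have [/existsP[i hi]|/existsPn H] := boolP [exists i : 'I_j.+1, (h i)`_0 != 0].
      by exists i.
    case/eqP: phij; have := congr1 (fun P : {poly K} => P`_0) (eq_phi j).
    rewrite /cv coef_sum big1 => [|i _]; last first.
      rewrite coef0M coef_sum big1 ?mulr0 // => l _.
      have lj : (l < j.+1)%N by have := ltn_ord l; have := ltn_ord i; lia.
      by have := H (Ordinal lj); rewrite negbK coef0M /= => /eqP ->; rewrite mul0r.
    by rewrite coefD coefC coefZ coefXn (ltn_eqF k0) mulr0 addr0.
  move=> /ex_minnP[p hp pmin]; exists p; split => // i ip; apply/eqP.
  by apply: contraLR ip => /pmin; rewrite -leqNgt.
case: p hp pmin => [//|p] hp pmin; exfalso.
(* In the coefficient of t^(p+1+j) y^r of H W, the inductions on [r] and [j] and the minimality of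
   [p.+1] leave only the constant term of [h p.+1] times the coefficient of y^r in [W j]. The right
   side has no term y^r. *)
have W0 r : (r < k.-1)%N -> forall j, (W j)`_r = 0.
  elim/ltn_ind: r => r IHr rk; elim/ltn_ind => j IHj.
  have := congr1 (fun P : {poly K} => P`_r) (cv_h_W (p.+1 + j)).
  rewrite /= coefZ coefMn coefXn (ltn_eqF rk) mul0rn mulr0 /cv coef_sum.
  have lt_p : (p.+1 < (p.+1 + j).+1)%N by lia.
  rewrite (bigD1 (Ordinal lt_p)) //= big1 ?addr0.
    rewrite addKn coefM big_ord_recl /= subn0 big1 ?addr0.
      by move=> /eqP; rewrite mulf_eq0 (negbTE hp) => /eqP.
    by move=> a _; rewrite IHr ?mulr0 // /bump /=; have := ltn_ord a; lia.
  move=> i ip; rewrite coefM big_ord_recl /= subn0 big1 ?addr0.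
    have [lt_ip|] := ltnP i p.+1; first by rewrite pmin // mul0r.
    rewrite leq_eqVlt => /orP[/eqP E|pi].
      by case/eqP: ip; apply/val_inj.
    by rewrite IHj ?mulr0 //; have := ltn_ord i; lia.
  by move=> a _; rewrite IHr ?mulr0 // /bump /=; have := ltn_ord a; lia.
(* In the coefficient of t^k y^(k-1), the term with [h 0] vanishes because the order is positive,
   and the others by [size_W]; yet the right side is k. *)
have := congr1 (fun P : {poly K} => P`_k.-1) (cv_h_W k).
rewrite /= eqxx scale1r coefMn coefXn eqxx /cv coef_sum big1.
  by move/eqP; rewrite eq_sym -[_ *+ k]/(k%:R) pnatr_eq0 gtn_eqF.
move=> i _; rewrite coefM big_ord_recl /= subn0 big1 ?addr0.
  case: i => -[|i] ik /=; first by rewrite pmin ?mul0r.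
  by rewrite (nth_default 0 (s := W _)) ?mulr0 // (leq_trans (size_W _)) //; lia.
by move=> a _; rewrite W0 ?mulr0 // /bump /=; have := ltn_ord a; lia.
Qed.

End Squarefree.

Section Multiplicity.
Variables (R : realType) (n : nat).
Local Notation C := (Cplx R).
Local Notation Cn := 'rV[C]_n.
Implicit Types (f g h : Cn -> C) (x : Cn) (s t : nat -> form R n).

Lemma analytic_germP f : analytic_germ f <-> exists s, expansion f s.
Proof.
split=> [[a /analytic_expansion fa]|[s /expansion_analytic fs]]; first by exists (form_of a).
by exists (coef_of s).
Qed.

Lemma analytic_cst (c : C) : analytic_germ (cst c : Cn -> C).
Proof.
apply/analytic_germP; exists (single 0 [:: (c, [::])]).
rewrite (_ : cst c = feval [:: (c, [::])]); first exact: expansion_feval.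
by apply/funext => x; rewrite /feval big_seq1 big_nil mulr1.
Qed.

Lemma homogeneous_part_expansion f s k :
  expansion f s -> homogeneous_part f k = feval (s k).
Proof.
move=> fs; have ft : power_series_of f (taylor f).
  by rewrite /taylor; apply: (xgetPex (fun=> 0)); exists (coef_of s); exact: expansion_analytic.
apply/funext => x; rewrite /homogeneous_part -feval_form_of.
exact: expansion_unique (analytic_expansion ft) fs k x.
Qed.

Lemma homogeneous_part_scale f k a x : analytic_germ f ->
  homogeneous_part f k (a *: x) = a ^+ k * homogeneous_part f k x.
Proof.
move=> /analytic_germP[s fs]; rewrite (homogeneous_part_expansion k fs).
exact: feval_scale (fs.1 k).
Qed.

Lemma order_ge_homogeneous_part f k : analytic_germ f ->
  order_ge k (homogeneous_part f k).
Proof.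
move=> /analytic_germP[s fs]; rewrite (homogeneous_part_expansion k fs).
exact: order_ge_feval (fs.1 k).
Qed.

Lemma multiplicity_unique f m : homogeneous_part f m <> cst 0 ->
  (forall k, (k < m)%N -> homogeneous_part f k = cst 0) -> multiplicity f = m.
Proof.
move=> fm f0; rewrite /multiplicity; set P := (X in xget _ X).
have [Pm P0] : P (xget 0%N P) by apply: (xgetPex 0%N); exists m.
by case: (ltngtP (xget 0%N P) m) => // [/f0|/P0].
Qed.

Lemma multiplicityP f : analytic_germ f -> ~ germ_eq f (cst 0) ->
  homogeneous_part f (multiplicity f) <> cst 0 /\
  forall k, (k < multiplicity f)%N -> homogeneous_part f k = cst 0.
Proof.
move=> /analytic_germP[s fs] f0.
have : exists k, `[< homogeneous_part f k <> cst 0 >].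
  apply: contrapT => no; apply: f0.
  have [_ [rho [B [rho0 _ sf]]]] := fs.
  apply/nbhs_rC; exists rho => // x; rewrite subr0 => /ltW /sf cf.
  apply: (norm_cvg_unique cf); apply: cvg_near_cst; exists 0%N => // N _ /=.
  rewrite big1 // => k _; rewrite -(homogeneous_part_expansion k fs).
  by apply: contrapT => fk; apply: no; exists k; apply/asboolP => E; apply: fk; rewrite E.
move=> /ex_minnP[m /asboolP fm mmin].
have f0m k : (k < m)%N -> homogeneous_part f k = cst 0.
  move=> km; apply: contrapT => fk.
  by have /mmin := asboolT fk; rewrite leqNgt km.
by rewrite (multiplicity_unique fm f0m).
Qed.

Lemma order_ge_initial f : analytic_germ f -> ~ germ_eq f (cst 0) ->
  order_ge (multiplicity f).+1
    (fun x => f x - homogeneous_part f (multiplicity f) x).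
Proof.
move=> fa f0; have [_ f0m] := multiplicityP fa f0.
have /analytic_germP[s fs] := fa.
have := expansion_remainder (multiplicity f).+1 fs; congr order_ge.
apply/funext => x; rewrite big_ord_recr /= big1 ?add0r => [|k _].
  by rewrite (homogeneous_part_expansion _ fs).
by rewrite -(homogeneous_part_expansion k fs) f0m.
Qed.

Lemma order_geN N (D : Cn -> C) : order_ge N D -> order_ge N (fun x => - D x).
Proof. by move=> [r [K [r0 H]]]; exists r, K; split => // x xr; rewrite normrN H. Qed.

(** The parts of [f] below degree [M], and the difference of its part of degree [M] with [P], are
    homogeneous of an order above their degree, hence zero. *)
Lemma initial_partP f P M : analytic_germ f ->
  (forall a x, P (a *: x) = a ^+ M * P x) -> order_ge M P -> P <> cst 0 ->
  order_ge M.+1 (fun x => f x - P x) ->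
  multiplicity f = M /\ homogeneous_part f M = P.
Proof.
move=> fa PM oP P0 fP; have /analytic_germP[s fs] := fa.
have E k x : homogeneous_part f k x = feval (s k) x by rewrite (homogeneous_part_expansion _ fs).
have f0 k : (k < M)%N -> homogeneous_part f k = cst 0.
  elim/ltn_ind: k => k IHk kM; apply/funext => x.
  apply: (@order_ge_homogeneous _ _ k) => [a y|]; first exact: homogeneous_part_scale.
  have o1 : order_ge k.+1 (fun x => f x - P x) by apply: order_ge_weaken fP; exact: leqW.
  have o2 : order_ge k.+1 P by exact: order_ge_weaken oP.
  have o3 := order_geN (expansion_remainder k.+1 fs).
  have := order_geD (order_geD o1 o2) o3; congr order_ge; apply/funext => y.
  rewrite big_ord_recr /= big1 ?add0r => [|i _]; first by rewrite E; ring.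
  by rewrite -E IHk // (ltn_trans (ltn_ord i)).
have fM : homogeneous_part f M = P.
  apply/funext => x; apply/eqP; rewrite -subr_eq0; apply/eqP.
  apply: (@order_ge_homogeneous _ _ M (fun x => homogeneous_part f M x - P x)) => [a y|].
    by rewrite homogeneous_part_scale // PM mulrBr.
  have := order_geD fP (order_geN (expansion_remainder M.+1 fs)); congr order_ge.
  apply/funext => y.
  rewrite big_ord_recr /= big1 ?add0r => [|i _]; first by rewrite E; ring.
  by rewrite -E f0.
by split=> //; apply: multiplicity_unique; rewrite ?fM.
Qed.

Lemma multiplicity_gt0 f : analytic_germ f -> ~ germ_eq f (cst 0) -> f 0 = 0 ->
  (0 < multiplicity f)%N.
Proof.
move=> fa f0 f00; rewrite lt0n; apply/eqP => m0.
have [f0m _] := multiplicityP fa f0; apply: f0m; rewrite m0.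
have /analytic_germP[s fs] := fa.
apply/funext => x; rewrite (homogeneous_part_expansion _ fs).
by rewrite (feval_homog0 x 0 (fs.1 0%N)) -(expansion_at0 fs).
Qed.

End Multiplicity.

(** * Adding a power of a new variable yields a reduced germ *)

Section Suspension.
Variables (R : realType) (N : nat).
Local Notation C := (Cplx R).
Variables (A : 'rV[C]_N -> C) (k : nat).

Definition drop_last (v : 'rV[C]_(N + 1)) : 'rV[C]_N := \row_i v 0 (lshift 1 i).
Definition last_coord (v : 'rV[C]_(N + 1)) : C := v 0 (rshift N ord0).

Definition suspension v := A (drop_last v) + last_coord v ^+ k.

Definition last_power : form R (N + 1) := [:: (1, nseq k (rshift N ord0))].

Lemma feval_last_power v : feval last_power v = last_coord v ^+ k.
Proof.
rewrite /feval big_seq1 mul1r; elim: (k) => [|j IHj]; first by rewrite big_nil.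
by rewrite big_cons IHj exprS.
Qed.

Lemma expansion_suspension s : expansion A s ->
  expansion suspension (fun j => fmap (lshift 1) (s j) ++ single k last_power j).
Proof.
move=> As; apply: expansion_add; first exact: expansion_pullback As.
rewrite (_ : (fun v => _) = feval last_power); last first.
  by apply/funext => v; rewrite feval_last_power.
by apply: expansion_feval; rewrite /homog /= size_nseq eqxx.
Qed.

Lemma poly_eq_horner (K : numFieldType) (p q : {poly K}) :
  (forall y, p.[y] = q.[y]) -> p = q.
Proof.
move=> pq; apply/eqP; rewrite -subr_eq0; apply/eqP.
apply: contrapT => /eqP d0.
have := max_poly_roots d0 (rs := [seq i%:R | i <- iota 0 (size (p - q))]).
rewrite size_map size_iota ltnn => F; apply: notF; apply: F.
  by apply/allP => _ /mapP[i _ ->]; rewrite rootE hornerD hornerN pq subrr.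
by rewrite map_inj_uniq ?iota_uniq // => i j /eqP; rewrite eqr_nat => /eqP.
Qed.

(** On the points (t x0, t y) the factorization becomes the identity H^2 Q = phi(t) + (t y)^k of
    [squarefree_unit]: the part of degree j contributes t^j times a polynomial in y of degree at
    most j. *)
Lemma suspension_squarefree h q : (0 < k)%N -> analytic_germ A ->
  ~ germ_eq A (cst 0) -> analytic_germ h -> analytic_germ q ->
  germ_eq suspension (fun v => q v * h v ^+ 2) -> h 0 != 0.
Proof.
move=> k0 Aa A0 /analytic_germP[sh hs] /analytic_germP[sq qs] E.
have [AM _] := multiplicityP Aa A0.
have /analytic_germP[sA As] := Aa.
(* A direction off the tangent cone of [A], so that the series [phi] in t is not zero. *)
have [x0 Ax0] : exists x0, feval (sA (multiplicity A)) x0 != 0.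
  apply: contrapT => no; apply: AM; apply/funext => x.
  rewrite (homogeneous_part_expansion _ As); apply/eqP.
  by apply: contrapT => h0; apply: no; exists x; apply/negP.
have U := expansion_unique (expansion_germ_eq E (expansion_suspension As))
  (expansion_mul qs (expansion_mul hs hs)).
pose v0 : 'rV[C]_(N + 1) := \row_(i < N + 1) (if fintype.split i is inl j then x0 0 j else 0).
pose e : 'rV[C]_(N + 1) := delta_mx 0 (rshift N ord0).
have vd y : drop_last (v0 + y *: e) = x0.
  apply/rowP => i; rewrite !mxE (unsplitK (inl _ i)) eqxx /=.
  by rewrite eq_lrshift mulr0 addr0.
have vl y : last_coord (v0 + y *: e) = y.
  by rewrite /last_coord !mxE (unsplitK (inr _ ord0)) !eqxx mulr1 add0r.
have line (s : nat -> form R (N + 1)) : (forall j, homog j (s j)) ->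
    exists P : nat -> {poly C}, forall j, (size (P j) <= j.+1)%N /\
      forall y, (P j).[y] = feval (s j) (v0 + y *: e).
  move=> sj; have : forall j, exists P : {poly C}, (size P <= j.+1)%N /\
      forall y, P.[y] = feval (s j) (v0 + y *: e).
    by move=> j; have [P Ps Py] := feval_line v0 e (sj j); exists P.
  by move=> /choice[P PP]; exists P.
have [Ph PhP] := line sh hs.1; have [Pq PqP] := line sq qs.1.
have := @squarefree_unit C Ph Pq (fun j => feval (sA j) x0) k k0
  (fun i => (PhP i).1) (fun i => (PqP i).1).
have -> : (Ph 0%N)`_0 = h 0.
  rewrite -horner_coef0 (PhP 0%N).2 (expansion_at0 hs).
  exact: feval_homog0 (hs.1 0%N).
apply; last by exists (multiplicity A).
move=> j; apply: poly_eq_horner => y.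
rewrite hornerD hornerC hornerZ hornerXn.
have := U j (v0 + y *: e); rewrite feval_cat feval_fmap -/(drop_last _) vd feval_conv.
have -> : feval (single k last_power j) (v0 + y *: e) = (j == k)%:R * y ^+ k.
  rewrite /single; case: eqP => _; last by rewrite feval_nil mul0r.
  by rewrite feval_last_power vl mul1r.
move=> ->; rewrite /cv horner_sum; apply: eq_bigr => i _.
rewrite hornerM (PqP i).2 feval_conv horner_sum; congr (_ * _).
by apply: eq_bigr => l _; rewrite hornerM !(PhP _).2.
Qed.

Lemma reduced_suspension : (0 < k)%N -> analytic_germ A -> A 0 = 0 ->
  ~ germ_eq A (cst 0) -> reduced_germ suspension.
Proof.
move=> k0 Aa A00 A0; have /analytic_germP[s As] := Aa.
have a0 : drop_last 0 = 0 by apply/rowP => i; rewrite !mxE.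
split.
- by apply/analytic_germP; eexists; exact: expansion_suspension As.
- by rewrite /suspension a0 A00 /last_coord mxE expr0n gtn_eqF // addr0.
(* If the germ vanished, it would be 0 times 0^2, and [suspension_squarefree] would make the
   constant 0 nonzero at the origin. *)
- move=> E; have c0 := @analytic_cst R (N + 1) 0.
  have : (cst 0 : 'rV[C]_(N + 1) -> C) 0 != 0; last by rewrite eqxx.
  apply: (suspension_squarefree (q := cst 0) k0 Aa A0 c0 c0).
  by apply: filterS E => v ->; rewrite mul0r.
move=> h [ha _ hu _] [q qa E].
by apply: hu; split=> //; apply: analytic_inverse => //; exact: suspension_squarefree E.
Qed.

End Suspension.

(** * The auxiliary germs and their initial parts *)

Section LastCoordinate.
Variables (R : realType) (N : nat).
Local Notation C := (Cplx R).
Local Notation V := 'rV[C]_(N + 1).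
Implicit Types (v : V) (x : 'rV[C]_N) (y : C).

Definition add_last x y : V := row_mx x (const_mx y).

Lemma drop_add_last x y : drop_last (add_last x y) = x.
Proof. by apply/rowP => i; rewrite !mxE (unsplitK (inl _ i)). Qed.

Lemma last_add_last x y : last_coord (add_last x y) = y.
Proof. by rewrite /last_coord !mxE (unsplitK (inr _ ord0)) mxE. Qed.

Lemma add_lastK v : add_last (drop_last v) (last_coord v) = v.
Proof.
apply/rowP => i; rewrite !mxE; case: fintype.splitP => j ij.
  by rewrite mxE; congr (v 0 _); apply/val_inj.
by rewrite !mxE /last_coord; congr (v 0 _); apply/val_inj; rewrite /= ij ord1.
Qed.

Lemma drop_lastZ a v : drop_last (a *: v) = a *: drop_last v.
Proof. by apply/rowP => i; rewrite !mxE. Qed.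

Lemma drop_lastD v w : drop_last (v + w) = drop_last v + drop_last w.
Proof. by apply/rowP => i; rewrite !mxE. Qed.

Lemma drop_last0 : drop_last (0 : V) = 0.
Proof. by apply/rowP => i; rewrite !mxE. Qed.

Lemma last_coordZ a v : last_coord (a *: v) = a * last_coord v.
Proof. by rewrite /last_coord mxE. Qed.

Lemma last_coordD v w : last_coord (v + w) = last_coord v + last_coord w.
Proof. by rewrite /last_coord mxE. Qed.

Lemma last_coord0 : last_coord (0 : V) = 0.
Proof. by rewrite /last_coord mxE. Qed.

Lemma add_lastZ a x y : a *: add_last x y = add_last (a *: x) (a * y).
Proof. by rewrite -[LHS]add_lastK drop_lastZ last_coordZ drop_add_last last_add_last. Qed.

Lemma add_lastD x y x' y' : add_last x y + add_last x' y' = add_last (x + x') (y + y').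
Proof. by rewrite -[LHS]add_lastK drop_lastD last_coordD !drop_add_last !last_add_last. Qed.

Lemma add_last0 : add_last 0 0 = 0.
Proof. by rewrite -[RHS]add_lastK drop_last0 last_coord0. Qed.

Lemma norm_drop_last v : `|drop_last v| <= `|v|.
Proof. exact: norm_reindex. Qed.

Lemma norm_last_coord v : `|last_coord v| <= `|v|.
Proof. exact: norm_coord. Qed.

Lemma norm_add_last x y e : `|x| <= e -> `|y| <= e -> `|add_last x y| <= e.
Proof.
move=> xe ye; apply: norm_le_coord => [|i]; first exact: le_trans xe.
rewrite mxE; case: fintype.splitP => j _; last by rewrite mxE.
exact: le_trans (norm_coord x j) xe.
Qed.

Lemma order_ge_drop_last k (D : 'rV[C]_N -> C) :
  order_ge k D -> order_ge k (fun v : V => D (drop_last v)).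
Proof.
move=> oD; have [r [K [r0 _ K0 H]]] := order_ge_mono oD ltr01.
exists r, K; split => // v vr; apply: le_trans (H _ _) _.
  exact: le_trans (norm_drop_last v) vr.
by rewrite ler_wpM2l -?rC0 ?rC_le // lerXn2r ?nnegrE // norm_drop_last.
Qed.

Lemma order_ge_last_coord : order_ge 1 (@last_coord R N).
Proof. by exists 1, 1; split => // v _; rewrite mul1r expr1 norm_last_coord. Qed.

Lemma order_ge_last_power k : order_ge k (fun v : V => last_coord v ^+ k).
Proof.
by exists 1, 1; split => // v _; rewrite mul1r normrX lerXn2r ?nnegrE // norm_last_coord.
Qed.

Definition lift_last (h : 'rV[C]_N -> 'rV[C]_N) v : V :=
  add_last (h (drop_last v)) (last_coord v).

Lemma nbhs_drop_last v (P : set 'rV[C]_N) :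
  nbhs (drop_last v) P -> nbhs v [set w | P (drop_last w)].
Proof.
move=> /nbhs_rC[r r0 rP]; apply/nbhs_rC; exists r => // w wv; apply: rP.
by apply: le_lt_trans wv; rewrite -scaleN1r -drop_lastZ -drop_lastD scaleN1r norm_drop_last.
Qed.

Lemma within_lift_last (A : set 'rV[C]_N) h :
  {within A, continuous h} ->
  {within [set v | A (drop_last v)], continuous (lift_last h)}.
Proof.
move=> /subspace_continuousP hc; apply/subspace_continuousP => v Av W.
move=> /nbhs_rC[e e0 eW].
have e2 : 0 < e / 2 by rewrite divr_gt0.
have hN : nbhs (h (drop_last v)) [set u | `|u - h (drop_last v)| < rC (e / 2)].
  by apply/nbhs_rC; exists (e / 2).
have /nbhs_drop_last N1 := hc _ Av _ hN.
have N2 : \forall w \near v, `|w - v| < rC (e / 2) by apply/nbhs_rC; exists (e / 2).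
apply: filterS (near_and N1 N2) => w [/= w1 w2] /w1 w3; apply: eW.
apply: (@le_lt_trans _ _ (rC (e / 2))); last by rewrite rC_lt; lra.
rewrite /lift_last -scaleN1r add_lastZ add_lastD mulN1r scaleN1r norm_add_last ?ltW //.
by apply: le_lt_trans w2; have := norm_last_coord (w - v); rewrite /last_coord !mxE.
Qed.

Lemma germ_homeo_lift_last h : germ_homeo setT setT h -> germ_homeo setT setT (lift_last h).
Proof.
move=> [h0 [U [V [k [[Uo U0] [Vo V0] [hU kV hK kK [hc kc]]]]]]].
split; first by rewrite /lift_last drop_last0 h0 last_coord0 add_last0.
have op (W : set 'rV[C]_N) : open W -> open [set v : 'rV[C]_(N + 1) | W (drop_last v)].
  rewrite !openE => Wo v /= /Wo; exact: nbhs_drop_last.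
exists [set v | U (drop_last v)], [set v | V (drop_last v)], (lift_last k).
split; [by split; [exact: op|rewrite /= drop_last0]|by split; [exact: op|rewrite /= drop_last0]|].
rewrite !setTI in hU kV hK kK hc kc *; split.
- by move=> v /= /hU; rewrite /lift_last drop_add_last.
- by move=> v /= /kV; rewrite /lift_last drop_add_last.
- by move=> v /= /hK E; rewrite /lift_last drop_add_last last_add_last E add_lastK.
- by move=> v /= /kK E; rewrite /lift_last drop_add_last last_add_last E add_lastK.
- split; [exact: (within_lift_last hc)|exact: (within_lift_last kc)].
Qed.

Lemma suspension_lift (A B : 'rV[C]_N -> C) h k :
  germ_eq A (B \o h) -> germ_eq (suspension A k) (suspension B k \o lift_last h).
Proof.
rewrite /germ_eq => AB; have : nbhs (drop_last (0 : V)) [set x | A x = B (h x)].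
  by rewrite drop_last0.
move=> /nbhs_drop_last; apply: filterS => v /= E.
by rewrite /suspension /lift_last drop_add_last last_add_last E.
Qed.

End LastCoordinate.

Section Twist.
Variables (R : realType) (n : nat).
Local Notation C := (Cplx R).
Implicit Types (f g : 'rV[C]_n -> C).

Definition twist f (u : 'rV[C]_(n + 1)) := f (drop_last u) ^+ 2 * last_coord u.

Lemma analytic_twist f : analytic_germ f -> analytic_germ (twist f).
Proof.
move=> /analytic_germP[s /(expansion_pullback (lshift 1)) fs].
apply/analytic_germP; eexists; apply: expansion_mul; first exact: (expansion_mul fs fs).
rewrite (_ : @last_coord R n = feval (last_power R n 1)).
  exact: (@expansion_feval _ _ 1).
by apply/funext => v; rewrite feval_last_power expr1.
Qed.

Lemma twist_lift f g h : germ_eq f (g \o h) -> germ_eq (twist f) (twist g \o lift_last h).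
Proof.
rewrite /germ_eq => AB; have : nbhs (drop_last (0 : 'rV[C]_(n + 1))) [set x | f x = g (h x)].
  by rewrite drop_last0.
move=> /nbhs_drop_last; apply: filterS => v /= E.
by rewrite /twist /lift_last drop_add_last last_add_last E.
Qed.

Section Initial.
Variables (f : 'rV[C]_n -> C).
Hypothesis fa : analytic_germ f.
Hypothesis f0 : ~ germ_eq f (cst 0).
Let a := multiplicity f.
Let fm := homogeneous_part f a.

Lemma twist_homogeneous c (u : 'rV[C]_(n + 1)) :
  twist fm (c *: u) = c ^+ (a + a).+1 * twist fm u.
Proof.
rewrite /twist drop_lastZ last_coordZ /fm homogeneous_part_scale //.
by rewrite exprMn -exprM muln2 addnn [X in _ = X * _]exprSr mulrACA.
Qed.

Lemma order_ge_twist_initial : order_ge (a + a).+1 (twist fm).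
Proof.
rewrite -(addn1 (a + a)); apply: order_geM; last exact: order_ge_last_coord.
by apply: order_geM; apply: order_ge_drop_last; exact: order_ge_homogeneous_part.
Qed.

Lemma order_ge_twist : order_ge (a + a).+1 (twist f).
Proof.
have of_ : order_ge a f.
  have := order_geD (order_ge_weaken (leqnSn a) (order_ge_initial fa f0))
    (order_ge_homogeneous_part a fa).
  by congr order_ge; apply/funext => x; rewrite subrK.
rewrite -(addn1 (a + a)); apply: order_geM; last exact: order_ge_last_coord.
by apply: order_geM; apply: order_ge_drop_last.
Qed.

(** The difference of squares factors as (f - fm)(f + fm), of order (a + 1) + a; the last coordinate
    adds 1. *)
Lemma order_ge_twist_sub :
  order_ge (a + a).+2 (fun u => twist f u - twist fm u).
Proof.
have o1 := order_ge_initial fa f0.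
have o2 := order_ge_homogeneous_part a fa.
have o3 : order_ge a (fun x => f x + fm x).
  have := order_geD (order_ge_weaken (leqnSn a) o1) (order_geD o2 o2).
  by congr order_ge; apply/funext => x; rewrite addrA subrK.
have := order_geM (order_ge_drop_last (order_geM o1 o3)) (@order_ge_last_coord R n).
rewrite (_ : (a.+1 + a + 1 = (a + a).+2)%N); last by lia.
congr order_ge; apply/funext => u.
by rewrite /twist -/a -/fm -subr_sqr mulrBl.
Qed.

Lemma twist_initial_neq0 : exists u, twist fm u != 0.
Proof.
have [fm0 _] := multiplicityP fa f0; apply: contrapT => no; apply: fm0.
apply/funext => x; apply/eqP; apply: contrapT => /negP fx; apply: no.
exists (add_last x 1); rewrite /twist drop_add_last last_add_last mulr1.
by rewrite expf_neq0.
Qed.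

(** A vanishing germ would give the nonzero initial form an order above its degree. *)
Lemma twist_neq0 : ~ germ_eq (twist f) (cst 0).
Proof.
move=> E; have [u /eqP[]] := twist_initial_neq0.
apply: (order_ge_homogeneous twist_homogeneous).
have h1 : order_ge (a + a).+2 (twist f).
  apply: (@order_ge_germ_eq _ _ _ (cst 0)); first by apply: filterS E => v ->.
  by exists 1, 0; split => // v _; rewrite normr0 mul0r.
have := order_geD h1 (order_geN order_ge_twist_sub); congr order_ge.
by apply/funext => v; rewrite opprB addrC subrK.
Qed.

Lemma analytic_suspension_twist k : analytic_germ (suspension (twist f) k).
Proof.
have /analytic_germP[s As] := analytic_twist fa.
by apply/analytic_germP; eexists; exact: expansion_suspension As.
Qed.

Lemma suspension_twist_initial k : k = (a + a).+2 ->
  multiplicity (suspension (twist f) k) = (a + a).+1 /\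
  homogeneous_part (suspension (twist f) k) (a + a).+1 = (fun v => twist fm (drop_last v)).
Proof.
move=> kE; apply: initial_partP.
- exact: analytic_suspension_twist.
- by move=> c v; rewrite drop_lastZ twist_homogeneous.
- by apply: order_ge_drop_last; exact: order_ge_twist_initial.
- have [u tu] := twist_initial_neq0; move=> /(congr1 (fun F => F (add_last u 0))).
  by rewrite drop_add_last => /eqP; rewrite (negbTE tu).
have := order_geD (order_ge_drop_last order_ge_twist_sub) (@order_ge_last_power R (n + 1) (a + a).+2).
by congr order_ge; apply/funext => v; rewrite /suspension kE addrAC.
Qed.

Lemma suspension_power_initial k : (k <= a + a)%N ->
  multiplicity (suspension (twist f) k) = k /\
  homogeneous_part (suspension (twist f) k) k = (fun v => last_coord v ^+ k).
Proof.
move=> ka; apply: initial_partP.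
- exact: analytic_suspension_twist.
- by move=> c v; rewrite last_coordZ exprMn.
- exact: order_ge_last_power.
- move=> /(congr1 (fun F => F (add_last 0 1))).
  by rewrite last_add_last expr1n => /eqP; rewrite oner_eq0.
have := order_ge_weaken (ka : (k.+1 <= (a + a).+1)%N) (order_ge_drop_last order_ge_twist).
by congr order_ge; apply/funext => v; rewrite /suspension addrK.
Qed.

End Initial.

End Twist.

(** * Tangent cones *)

Section LinearContinuous.
Variables (R : realType) (n : nat) (V : normedModType (Cplx R)).
Local Notation C := (Cplx R).

Lemma linear_continuous_rV (f : 'rV[C]_n -> V) (x : 'rV[C]_n) :
  (forall (a : C) u v, f (a *: u + v) = a *: f u + f v) -> {for x, continuous f}.
Proof.
move=> fl.
have f0 : f 0 = 0.
  by have := fl (-1) 0 0; rewrite scaler0 addr0 scaleN1r addNr.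
have fD u v : f (u + v) = f u + f v by have := fl 1 u v; rewrite !scale1r.
have fZ a u : f (a *: u) = a *: f u by have := fl a u 0; rewrite !addr0 f0 addr0.
pose K := \sum_i `|f (delta_mx 0 i)|.
have fK u : `|f u| <= K * `|u|.
  rewrite {1}[u]row_sum_delta (big_morph f fD f0) /K mulr_suml.
  apply: le_trans (ler_norm_sum _ _ _) _; apply: ler_sum => i _.
  by rewrite fZ normrZ mulrC ler_wpM2l // norm_coord.
have [k k0 kE] : exists2 k : R, 0 <= k & K = rC k by apply: ge0_rC; exact: sumr_ge0.
move=> W /nbhs_rC[e e0 eW]; apply/nbhs_rC; exists (e / (k + 1)).
  by rewrite divr_gt0 // ltr_wpDl.
move=> y yx; apply: eW.
have -> : f y - f x = f (y - x) by rewrite fD -[- x]scaleN1r fZ scaleN1r.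
apply: le_lt_trans (fK _) _.
have [d d0 dE] := ge0_rC (normr_ge0 (y - x)).
move: yx; rewrite kE dE -rCM !rC_lt ltr_pdivlMr ?ltr_wpDl //.
by apply: le_lt_trans; rewrite mulrC ler_wpM2l // lerDl.
Qed.

End LinearContinuous.

Section Cone.
Variables (R : realType) (n : nat).
Local Notation C := (Cplx R).
Variables (q : 'rV[C]_n -> C) (a : nat) (w : 'rV[C]_n).
Hypothesis a0 : (0 < a)%N.
Hypothesis qh : forall c x, q (c *: x) = c ^+ a * q x.
Hypothesis qw : q w != 0.

Lemma q0 : q 0 = 0.
Proof. by rewrite -(scale0r w) qh expr0n gtn_eqF // mul0r. Qed.

Definition cone : set 'rV[C]_(n + 1 + 1) := [set v | twist q (drop_last v) = 0].
Definition hyperplane : set 'rV[C]_(n + 1 + 1) := [set v | last_coord v = 0].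

(* [slide] is a retraction of the cone onto its component [z = 0]; on the other
   component [q x = 0] it vanishes only at the origin. *)
Definition slide (u : 'rV[C]_(n + 1)) : 'rV[C]_n :=
  drop_last u - last_coord u *: w.

(** On the kernel x = z w, the function [twist q] equals z^(2a+1) q(w)^2, which vanishes only for z
    = 0. *)
Lemma slide_eq0 u : twist q u = 0 -> slide u = 0 -> u = 0.
Proof.
rewrite /twist /slide => tu /eqP; rewrite subr_eq0 => /eqP E.
suff z0 : last_coord u = 0 by rewrite -[u]add_lastK E z0 scale0r add_last0.
move/eqP: tu; rewrite E qh -/(last_coord u) mulf_eq0 expf_eq0 /= mulf_eq0.
by rewrite (negbTE qw) orbF expf_eq0 a0 /= orbb => /eqP.
Qed.

Lemma twist_axis z : twist q (add_last 0 z) = 0.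
Proof. by rewrite /twist drop_add_last q0 expr0n mul0r. Qed.

Lemma twist_plane x : twist q (add_last x 0) = 0.
Proof. by rewrite /twist last_add_last mulr0. Qed.

Lemma slideZ c u : slide (c *: u) = c *: slide u.
Proof. by rewrite /slide drop_lastZ last_coordZ scalerBr scalerA. Qed.

Lemma slideD u v : slide (u + v) = slide u + slide v.
Proof. by rewrite /slide drop_lastD last_coordD scalerDl opprD addrACA. Qed.

Lemma slide_plane x : slide (add_last x 0) = x.
Proof. by rewrite /slide drop_add_last last_add_last scale0r subr0. Qed.

Lemma cone_not_germ_homeo h : ~ germ_homeo cone hyperplane h.
Proof.
move=> [h0 [U [V [k [[Uo U0] [Vo V0] hk]]]]].
have nU : nbhs (0 : 'rV[C]_(n + 1 + 1)) U by apply: open_nbhs_nbhs.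
have nV : nbhs (0 : 'rV[C]_(n + 1 + 1)) V by apply: open_nbhs_nbhs.
(* [iota] parametrizes the component z = 0 of the cone by (x, y), and [gamma] slides along [w] while
   keeping y. The hyperplane y = 0 has the global chart [drop_last], with inverse [psi']. *)
pose iota (u : 'rV[C]_(n + 1)) : 'rV[C]_(n + 1 + 1) :=
  add_last (add_last (drop_last u) 0) (last_coord u).
pose gamma (v : 'rV[C]_(n + 1 + 1)) : 'rV[C]_(n + 1) :=
  add_last (slide (drop_last v)) (last_coord v).
pose psi' (u : 'rV[C]_(n + 1)) : 'rV[C]_(n + 1 + 1) := add_last u 0.
have ic u : {for u, continuous iota}.
  apply: linear_continuous_rV => c u1 u2.
  rewrite /iota !drop_lastD !drop_lastZ !last_coordD !last_coordZ.
  by rewrite add_lastZ add_lastD add_lastZ add_lastD mulr0 addr0.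
have gc v : {for v, continuous gamma}.
  apply: linear_continuous_rV => c u1 u2.
  rewrite /gamma !drop_lastD !drop_lastZ !last_coordD !last_coordZ.
  by rewrite slideD slideZ add_lastZ add_lastD.
have pc v : {for v, continuous (@drop_last R (n + 1))}.
  by apply: linear_continuous_rV => c u1 u2; rewrite drop_lastD drop_lastZ.
have p'c u : {for u, continuous psi'}.
  by apply: linear_continuous_rV => c u1 u2; rewrite /psi' add_lastZ add_lastD mulr0 addr0.
have i0 : iota 0 = 0 by rewrite /iota drop_last0 last_coord0 !add_last0.
have p'0 : psi' 0 = 0 by exact: add_last0.
have coneP u : cone (iota u) by rewrite /cone /= /iota drop_add_last twist_plane.
apply: (@no_homeo_to_chart R (n + 1) _ _ _ _ h k hk 0 _ iota gamma (@drop_last R (n + 1)) psi').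
- by split => //; rewrite -i0.
- exact: i0.
- by apply: filterE => u; exact: ic.
- have U0' : \forall v \near iota 0, U v by rewrite i0.
  by apply: filterS (near_continuous (ic 0) U0') => u Uu; split.
- by apply: filterE => v; exact: gc.
- by apply: filterE => u; rewrite /gamma /iota !drop_add_last slide_plane last_add_last add_lastK.
- apply: filterE => v [cv _]; rewrite /gamma => E.
  have := congr1 (@drop_last R n) E; have := congr1 (@last_coord R n) E.
  rewrite drop_add_last last_add_last drop_last0 last_coord0 => y0.
  by move=> /(slide_eq0 cv) u0; rewrite -[v]add_lastK u0 y0 add_last0.
- move=> M M0.
  (* Nonzero points of the z-axis lie in the cone arbitrarily near 0, but the image of [iota] has z
     = 0. *)
  pose ax (z : C) : 'rV[C]_(n + 1 + 1) := add_last (add_last 0 z) 0.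
  have /nbhs_rC[r r0 rP] : nbhs (0 : 'rV[C]_(n + 1 + 1)) (U `&` M) by apply: filterI.
  have [] := rP (ax (rC (r / 2))).
    rewrite subr0; apply: (@le_lt_trans _ _ (rC (r / 2))); last by rewrite rC_lt; lra.
    have r2 : 0 <= rC (r / 2) by rewrite -rC0 rC_le; lra.
    by rewrite /ax !norm_add_last ?normr0 // ger0_norm.
  move=> Ur Mr; exists (ax (rC (r / 2))); split=> //.
    by split=> //; rewrite /cone /= /ax drop_add_last twist_axis.
  move=> u /(congr1 (fun v => last_coord (drop_last v))).
  rewrite /iota /ax !drop_add_last !last_add_last => /eqP.
  by rewrite eq_sym -rC0 gt_eqF // rC_lt; lra.
- by apply: filterE => v; exact: pc.
- by apply: filterE => u; exact: p'c.
- have V0' : \forall v \near psi' 0, V v by rewrite p'0.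
  rewrite h0 drop_last0; apply: filterS (near_continuous (p'c 0) V0') => u Vu.
  by split=> //; rewrite /hyperplane /= last_add_last.
- by apply: filterE => u; rewrite /psi' drop_add_last.
- by apply: filterE => v [v0 _]; rewrite /psi' -[RHS]add_lastK v0.
Qed.

End Cone.

Section LinearCone.
Variables (R : realType) (n : nat).

Lemma linear_subspace_hyperplane : linear_subspace (@hyperplane R n).
Proof.
exists (lker (linfun (@rsubmx (Cplx R) 1 (n + 1) 1))).
apply/seteqP; split => v /=; rewrite memv_ker lfunE /=.
  by move=> v0; apply/eqP/matrixP => i j; rewrite !mxE !ord1 [LHS]v0.
by move=> /eqP/matrixP/(_ 0 0); rewrite !mxE.
Qed.

End LinearCone.

(** * Exceptional fibers *)

Section ProjectiveSpace.
Local Open Scope quotient_scope.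
Variables (R : realType) (n : nat).
Local Notation C := (Cplx R).
Local Notation Cn := 'rV[C]_n.
Local Notation P := (projective R n).
Local Notation pC := (punctured R n).
Implicit Types (v : Cn) (c : P).

Lemma val_punctured (u : pC) : val u != 0.
Proof. by case: u => v /= /set_mem. Qed.

Definition punct v (v0 : v != 0) : pC := exist _ v (mem_set (v0 : punctured R n v)).

Definition rep c : Cn := val (generic_quotient.repr (c : {eq_quot (@collinear R n)})).

Lemma rep_neq0 c : rep c != 0. Proof. exact: val_punctured. Qed.

Lemma pclass_repr c : pclass (generic_quotient.repr (c : {eq_quot (@collinear R n)})) = c.
Proof. by rewrite /pclass reprK. Qed.

Lemma pclass_eq (u v : pC) (a : C) : a != 0 -> val u = a *: val v -> pclass u = pclass v.
Proof. by move=> a0 uv; apply/eqmodP/asboolP; exists a. Qed.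

Lemma rep_pclass (u : pC) : exists2 a : C, a != 0 & rep (pclass u) = a *: val u.
Proof.
have /eqmodP/asboolP : pclass (generic_quotient.repr (pclass u : {eq_quot (@collinear R n)})) = pclass u.
  exact: pclass_repr.
by case=> a a0 E; exists a.
Qed.

Variable e : pC.

(** A total version of the class of [v]: the auxiliary nonzero vector [e] only serves as the default
    at [v = 0]. *)
Definition pt v : P := pclass (insubd e v).

Lemma val_insubd_punct v : v != 0 -> val (insubd e v) = v.
Proof. by move=> v0; rewrite val_insubd mem_set. Qed.

Lemma rep_pt v : v != 0 -> exists2 a : C, a != 0 & rep (pt v) = a *: v.
Proof.
by move=> v0; have [a a0 E] := rep_pclass (insubd e v); exists a; rewrite // E val_insubd_punct.
Qed.

Lemma pt_rep c : pt (rep c) = c.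
Proof.
rewrite -[RHS]pclass_repr; apply: (@pclass_eq _ _ 1); first exact: oner_neq0.
by rewrite scale1r val_insubd_punct // rep_neq0.
Qed.

Lemma ptZ a v : a != 0 -> v != 0 -> pt (a *: v) = pt v.
Proof.
move=> a0 v0; apply: (pclass_eq a0).
by rewrite !val_insubd_punct // scaler_eq0 negb_or a0.
Qed.

Lemma open_punctured : open (punctured R n).
Proof.
rewrite openE => v /= v0; apply/nbhs_rC.
have [r r0 E] := gt0_rC (etrans (normr_gt0 v) v0); exists r => // w; rewrite -E distrC => h.
by apply: contraTneq h => ->; rewrite subr0 ltxx.
Qed.

Lemma continuous_pt v : v != 0 -> {for v, continuous pt}.
Proof.
move=> v0; have ci : {for v, continuous (fun w => insubd e w : pC)}.
  move=> W; rewrite nbhsE => -[_ [[U Uo <-] /= Uv] UW].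
  rewrite [set_val _]val_insubd_punct // in Uv.
  have nU : nbhs v U by apply: open_nbhs_nbhs.
  have np : nbhs v (punctured R n) by apply: open_nbhs_nbhs; split; [exact: open_punctured|].
  apply: filterS (near_and nU np) => w [Uw w0]; apply: UW => /=.
  by rewrite [set_val _]val_insubd_punct.
exact: (@continuous_comp _ _ _ (fun w => insubd e w : pC) (@pclass R n) v ci (@pi_continuous _ _ _)).
Qed.

(** The chosen representative [rep] need not vary continuously, but a function invariant under
    scaling does not see the choice: its preimages of open sets are open in the quotient
    topology. *)
Lemma continuous_rep (E : topologicalType) (D : set Cn) (f : Cn -> E) c :
  open D -> (forall v a, a != 0 -> D v -> D (a *: v) /\ f (a *: v) = f v) ->
  (forall v, D v -> {for v, continuous f}) -> D (rep c) ->
  {for c, continuous (f \o rep)} /\ \forall c' \near c, D (rep c').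
Proof.
move=> Do fD fc Dc.
suff H (W0 : set E) : open W0 -> W0 (f (rep c)) ->
    nbhs c [set c' | D (rep c') /\ W0 (f (rep c'))].
  split; last by apply: filterS (H setT openT I) => c' [].
  move=> W; rewrite nbhsE => -[W0 [W0o W0c] W0W].
  by apply: filterS (H W0 W0o W0c) => c' [_ /W0W].
move=> W0o W0c; apply: open_nbhs_nbhs; split => //.
rewrite /open /= /quotient_open.
rewrite (_ : _ @^-1` _ = set_val @^-1` [set v | D v /\ W0 (f v)]).
  exists [set v | D v /\ W0 (f v)] => //.
  rewrite openE => v [Dv Wv].
  have n1 : nbhs v D by apply: open_nbhs_nbhs.
  have n2 : nbhs (f v) W0 by apply: open_nbhs_nbhs.
  by apply: filterS (near_and n1 (near_continuous (fc v Dv) n2)) => w [].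
apply/seteqP; split => u /=; have [a a0 Ea] := rep_pclass u.
  rewrite -/(pclass u) Ea => -[Du Wu].
  have /fD : a^-1 != 0 by rewrite invr_eq0.
  move=> /(_ _ Du); rewrite scalerA mulVf // scale1r => -[Dv fv].
  by split=> //; rewrite fv.
by move=> [Du Wu]; rewrite -/(pclass u) Ea; have [Da fa] := fD _ _ a0 Du; rewrite fa.
Qed.

End ProjectiveSpace.

Section ExceptionalFiber.
Variables (R : realType) (n : nat).
Local Notation C := (Cplx R).
Local Notation Cn := 'rV[C]_n.
Implicit Types (F : Cn -> C) (v : Cn).

Lemma continuous_coord (i : 'I_n) v : {for v, continuous (fun x : Cn => x 0 i)}.
Proof.
move=> W /nbhs_rC[r r0 rW]; apply/nbhs_rC; exists r => // y yv; apply: rW.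
by apply: le_lt_trans yv; have := norm_coord (y - v) i; rewrite !mxE.
Qed.

Lemma continuous_feval (s : form R n) v : {for v, continuous (feval s)}.
Proof.
have cw (w : seq 'I_n) : {for v, continuous (fun x : Cn => \prod_(i <- w) x 0 i)}.
  elim: w => [|i w IHw].
    have -> : (fun x : Cn => \prod_(i <- [::]) x 0 i) = cst 1.
      by apply/funext => x; rewrite big_nil.
    exact: cst_continuous.
  have -> : (fun x : Cn => \prod_(j <- i :: w) x 0 j) =
      (fun x : Cn => x 0 i * \prod_(j <- w) x 0 j).
    by apply/funext => x; rewrite big_cons.
  exact: (cvgM (@continuous_coord i v) IHw).
elim: s => [|c s IHs].
  have -> : feval [::] = cst 0 :> (Cn -> C) by apply/funext => x; rewrite feval_nil.
  exact: cst_continuous.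
have -> : feval (c :: s) = (fun x => c.1 * \prod_(i <- c.2) x 0 i + feval s x).
  by apply/funext => x; rewrite /feval big_cons.
exact: (cvgD (cvgM (@cst_continuous Cn C c.1 v) (cw c.2)) IHs).
Qed.

(* Points of [E_0(F)] outside the initial zero set would have a conic
   neighbourhood on which [`|P v| > eta * `|v| ^+ M] for the initial part [P] of
   degree [M], where the remainder of order [M.+1] cannot make [F] vanish. *)
Lemma exceptional_fiber_subset F p : analytic_germ F -> ~ germ_eq F (cst 0) ->
  exceptional_fiber F p ->
  p.1 = 0 /\ homogeneous_part F (multiplicity F) (rep p.2) = 0.
Proof.
move=> Fa F0 [[_ clp] /= p0]; split => //.
have [rho [K [rho0 _ K0 HK]]] := order_ge_mono (order_ge_initial Fa F0) ltr01.
have Ph a v := homogeneous_part_scale (multiplicity F) a v Fa.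
have Pc v : {for v, continuous (homogeneous_part F (multiplicity F))}.
  by have /analytic_germP[s Fs] := Fa; rewrite (homogeneous_part_expansion _ Fs); exact: continuous_feval.
move: HK Ph Pc; set P := homogeneous_part F _; set M := multiplicity F => HK Ph Pc.
apply/eqP; apply: contrapT => /negP Pp.
have [eta [eta0 etaP]] : exists eta : R, 0 < eta /\ rC eta * `|rep p.2| ^+ M < `|P (rep p.2)|.
  have nP : 0 < `|P (rep p.2)| by rewrite normr_gt0.
  have [d d0 dE] := gt0_rC nP; have [r r0 rE] := ge0_rC (normr_ge0 (rep p.2)).
  have rM0 : 0 <= r ^+ M by rewrite exprn_ge0.
  exists (d / (r ^+ M + 1)); split; first by rewrite divr_gt0 // ltr_wpDl.
  rewrite dE rE -rCX -rCM rC_lt mulrAC ltr_pdivrMr ?ltr_wpDl //.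
  by rewrite ltr_pM2l // ltrDl.
(* Both norms are moved to [R], so that the cone [0 < g] is open by the order topology of the
   reals. *)
pose g v : R := complex.Re `|P v| - eta * complex.Re `|v| ^+ M.
have gE v : (0 < g v) = (rC eta * `|v| ^+ M < `|P v|).
  have [r r0 rE] := ge0_rC (normr_ge0 v); have [d d0 dE] := ge0_rC (normr_ge0 (P v)).
  by rewrite /g dE rE -rCX -rCM rC_lt subr_gt0.
have gc v : {for v, continuous g}.
  have cRe (q : Cn -> C) : {for v, continuous q} -> {for v, continuous (fun x => complex.Re (q x) : R)}.
    by move=> qc; apply: (@continuous_comp _ _ _ q (fun z : C => complex.Re z : R)) => //; exact: continuous_Re.
  have c1 : {for v, continuous (fun x : Cn => `|P x| : C)} by exact: cvg_norm (Pc v).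
  have cid : {for v, continuous (fun x : Cn => x)} := cvg_id.
  have c2 : {for v, continuous (fun x : Cn => `|x| : C)} by exact: cvg_norm cid.
  have c3 : {for v, continuous (fun x : Cn => complex.Re `|x| ^+ M : R)}.
    apply: (@continuous_comp _ _ _ (fun x : Cn => complex.Re `|x| : R) (fun y : R => y ^+ M)).
      exact: (cRe (fun x : Cn => `|x| : C) c2).
    exact: exprn_continuous.
  exact: (cvgB (cRe _ c1) (cvgM (@cst_continuous Cn R eta v) c3)).
pose D : set Cn := [set v | 0 < g v].
have Do : open D.
  by rewrite openE => v /= gv; exact: (near_continuous (gc v) (lt_nbhsr gv)).
have Dcone v (a : C) : a != 0 -> D v -> D (a *: v).
  rewrite /D /= !gE => a0 h; rewrite Ph normrM normrX normrZ exprMn mulrCA.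
  by rewrite ltr_pM2l // exprn_gt0 // normr_gt0.
have Drep : D (rep p.2) by rewrite /D /= gE.
have [_ Dn] := @continuous_rep R n C D (cst 0) p.2 Do
  (fun v a a0 Dv => conj (Dcone v a a0 Dv) (erefl _)) (fun v _ => cvg_cst _) Drep.
(* A zero [u] of [F] in the cone satisfies eta |u|^M < K |u|^(M+1), that is eta < K |u|; the second
   bound on |u| excludes this. *)
pose de := Num.min rho (eta / (K + 1)).
have de0 : 0 < de by rewrite lt_min rho0 divr_gt0 // ltr_wpDl.
have nB : nbhs p [set u | `|u.1| < rC de /\ D (rep u.2)].
  exists ([set u : Cn | `|u| < rC de], [set c | D (rep c)]) => //=.
  by split => //=; rewrite p0; apply/nbhs_rC; exists de => // y; rewrite subr0.
have [[u c] /= [[[v [la [/= cE uE]]] [Fu u0]] [ude Dc]]] := clp _ nB.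
have [a a0 Ea] := rep_pclass v.
have la0 : la != 0 by apply: contra_not_neq u0 => la0; rewrite uE la0 scale0r.
have Du : D u.
  have -> : u = (la / a) *: rep c by rewrite uE cE Ea scalerA divfK.
  by apply: Dcone => //; rewrite mulf_neq0 ?invr_eq0.
have un0 : 0 < `|u| by rewrite normr_gt0; apply/eqP.
have := HK u; rewrite Fu sub0r normrN => /(_ _) h.
have {}h : `|P u| <= rC K * `|u| ^+ M.+1.
  by apply: h; apply: ltW; apply: lt_le_trans ude _; rewrite rC_le ge_min lexx.
move: Du; rewrite /D /= gE => /lt_le_trans /(_ h).
rewrite exprS mulrA ltr_pM2r ?exprn_gt0 // => h1.
have [r r0 rE] := gt0_rC un0; move: ude h1; rewrite rE -rCM !rC_lt lt_min => /andP[_].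
rewrite ltr_pdivlMr ?ltr_wpDl // => h2 /(lt_trans h2).
by rewrite mulrC ltr_pM2r // ltNge lerDl ler01.
Qed.

(** The nonzero zeros t v', with t tending to 0 and v' to v, have lifts (t v', [v']) in the blowup,
    and these tend to (0, [v]). *)
Lemma exceptional_fiber_mem F (e : punctured R n) v : v != 0 ->
  (forall eps : R, 0 < eps -> exists (t : C) v',
     [/\ t != 0, `|t| < rC eps, `|v' - v| < rC eps & F (t *: v') = 0]) ->
  exceptional_fiber F (0, pt e v).
Proof.
move=> v0 H; split => //; split.
  by exists (insubd e v), 0; rewrite /= scale0r.
move=> B [[B1 B2] /= [nB1 nB2] BB].
have nv : \forall w \near v, B2 (pt e w) /\ punctured R n w.
  apply: near_and; first exact: (@near_continuous _ _ (pt e) v B2 (@continuous_pt R n e v v0) nB2).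
  by apply: open_nbhs_nbhs; split; [exact: open_punctured|].
move: nB1 nv => /nbhs_rC[r1 r10 rP1] /nbhs_rC[r2 r20 rP2].
have [m m0 mE] := ge0_rC (normr_ge0 v).
(* The entry 1 ensures |v'| <= m + 1, after which the last entry keeps |t v'| below [r1]. *)
pose eps := Num.min (Num.min r2 1) (r1 / (m + 1)).
have eps0 : 0 < eps by rewrite !lt_min r20 ltr01 divr_gt0 // ltr_wpDl.
have [t [v' [t0 te ve Ft]]] := H eps eps0.
have [Bv' v'0] : B2 (pt e v') /\ punctured R n v'.
  by apply: rP2; apply: lt_le_trans ve _; rewrite rC_le !ge_min lexx.
exists (t *: v', pt e v'); split; last first.
  apply: BB; split => //=; apply: rP1; rewrite subr0 normrZ.
  have v'm : `|v'| <= rC (m + 1).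
    rewrite -[v'](subrK v); apply: le_trans (ler_normD _ _) _.
    rewrite addrC rCD mE lerD2l; apply: ltW; apply: lt_le_trans ve _.
    by rewrite rC_le !ge_min lexx orbT.
  apply: (@le_lt_trans _ _ (`|t| * rC (m + 1))); first by rewrite ler_wpM2l.
  have m1 : 0 < rC (m + 1) by rewrite -rC0 rC_lt ltr_wpDl.
  rewrite -ltr_pdivlMr // -rCV -rCM; apply: lt_le_trans te _.
  by rewrite rC_le ge_min lexx orbT.
split; first by exists (insubd e v'), t; rewrite /= val_insubd_punct.
split => //=; apply/eqP; rewrite scaler_eq0 negb_or t0; exact: v'0.
Qed.

End ExceptionalFiber.

(** * Zeros approaching prescribed points of the exceptional fibers *)

Section Norms.
Variables (R : realType) (N : nat).
Local Notation C := (Cplx R).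

Lemma add_lastB (x x' : 'rV[C]_N) (y y' : C) :
  add_last x y - add_last x' y' = add_last (x - x') (y - y').
Proof. by rewrite -scaleN1r add_lastZ add_lastD scaleN1r mulN1r. Qed.

Lemma norm_add_last_lt (x : 'rV[C]_N) (y : C) e :
  `|x| < e -> `|y| < e -> `|add_last x y| < e.
Proof.
move=> xe ye.
have : `|add_last x y| <= `|x| \/ `|add_last x y| <= `|y|.
  case: (real_leP (normr_real x) (normr_real y)) => h; [right|left].
    exact: norm_add_last.
  by apply: norm_add_last => //; exact: ltW.
by case=> h; apply: le_lt_trans h _.
Qed.

Lemma lt_exprn2 k (a b : C) : 0 <= b -> `|a| ^+ k.+1 < b ^+ k.+1 -> `|a| < b.
Proof.
move=> b0; have [r r0 ->] := ge0_rC b0; have [s s0 ->] := ge0_rC (normr_ge0 a).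
have s0' : 0 <= s by []; rewrite -!rCX !rC_lt => h.
by move: h; rewrite ltr_pXn2r // nnegrE.
Qed.

Lemma exists_root k (z : C) : exists y, y ^+ k.+1 = z.
Proof. by exists (k.+1.-root z); rewrite rootCK. Qed.

Lemma small_factor (A B : R) : 0 <= A -> 0 < B ->
  exists2 t0 : R, 0 < t0 & forall t, 0 <= t <= t0 -> A * t < B.
Proof.
move=> A0 B0; exists (B / (A + 1)); first by rewrite divr_gt0 // ltr_wpDl.
move=> t /andP[t0 tB]; apply: (@le_lt_trans _ _ (A * (B / (A + 1)))).
  by rewrite ler_wpM2l.
by rewrite mulrA ltr_pdivrMr ?ltr_wpDl // mulrC ltr_pM2l // ltrDl.
Qed.

Lemma le_double_of_half (x d k : R) : x <= d + k -> k <= x / 2 -> x <= (1 + 1) * d.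
Proof. lra. Qed.

Lemma lt_of_le_half (t u : R) : 0 < u -> t <= u / 2 -> t < u.
Proof. lra. Qed.

Lemma cancel_division (u v w : C) : u != 0 ->
  u ^+ 2 * (v * - (w / u ^+ 2)) + v * w = 0.
Proof. by move=> u0; field. Qed.

Lemma gt0_of_double (x d : R) : 0 < x -> x <= (1 + 1) * d -> 0 < d.
Proof. lra. Qed.

Lemma sqr_le_double (u c d : R) : 0 < u * c -> u * c <= (1 + 1) * d ->
  u ^+ 2 * c ^+ 2 <= 4 * d ^+ 2.
Proof. by rewrite -exprMn => ? ?; nra. Qed.

Lemma lt_mul_scale (s u m A c d : R) : 0 < u -> 0 <= A ->
  m * 4 * s < A * c -> u * c <= 4 * d -> s * u * m < A * d.
Proof.
move=> u0 A0 h1 h2.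
have h3 : m * 4 * s * u < A * c * u by rewrite ltr_pM2r.
have h4 : A * (u * c) <= A * (4 * d) by rewrite ler_wpM2l.
lra.
Qed.

End Norms.

Section Fibers.
Variables (R : realType) (n : nat).
Local Notation C := (Cplx R).
Variable f : 'rV[C]_n -> C.
Hypothesis fa : analytic_germ f.
Hypothesis f0 : ~ germ_eq f (cst 0).
Let a := multiplicity f.
Let fm := homogeneous_part f a.
Variable e : punctured R (n + 1 + 1).

(** At t (u, y) the equation reads y^k = - twist f (t u) / t^k. The right side is O(t^(2a+1-k)) with
    positive exponent, so a k-th root gives y tending to 0. *)
Lemma fiber_power_mem k (u : 'rV[C]_(n + 1)) : (0 < k)%N -> (k <= a + a)%N -> u != 0 ->
  exceptional_fiber (suspension (twist f) k) (0, pt e (add_last u 0)).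
Proof.
case: k => // k _ ka u0; apply: exceptional_fiber_mem.
  by apply: contraNneq u0 => /(congr1 (@drop_last R (n + 1))); rewrite drop_add_last drop_last0 => ->.
move=> eps eps0.
have [rho [K [rho0 _ K0 HK]]] := order_ge_mono (order_ge_twist fa f0) ltr01.
have [m m0 mE] := ge0_rC (normr_ge0 u).
have [t1 t10 t1P] := small_factor m0 rho0.
have [t2 t20 t2P] := small_factor (mulr_ge0 K0 (exprn_ge0 (a + a).+1 m0)) (exprn_gt0 k.+1 eps0).
pose t := Num.min (Num.min (eps / 2) 1) (Num.min t1 t2).
have t0 : 0 < t by rewrite !lt_min ltr01 t10 t20 divr_gt0.
have [te tl1 tt1 tt2] : [/\ t <= eps / 2, t <= 1, t <= t1 & t <= t2].
  by split; rewrite !ge_min lexx ?orbT.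
have tC0 : rC t != 0 by rewrite gt_eqF // -rC0 rC_lt.
have nt : `|rC t| = rC t by rewrite ger0_norm // -rC0 rC_le ltW.
have [y yE] := exists_root k (- twist f (rC t *: u) / rC t ^+ k.+1).
exists (rC t), (add_last u y); split => //.
- by rewrite nt rC_lt; lra.
- rewrite add_lastB subrr subr0; apply: norm_add_last_lt; first by rewrite normr0 -rC0 rC_lt.
  apply: (@lt_exprn2 _ k); first by rewrite -rC0 rC_le ltW.
  have tu : `|rC t *: u| <= rC rho.
    rewrite normrZ nt mE -rCM rC_le mulrC ltW //; apply: t1P.
    by rewrite (ltW t0).
  rewrite -normrX yE normrM normrN normfV normrX nt.
  rewrite ltr_pdivrMr; last by rewrite exprn_gt0 // -rC0 rC_lt.
  apply: le_lt_trans (HK _ tu) _.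
  rewrite normrZ nt mE -!rCX -!rCM -!rCX -!rCM rC_lt exprMn.
  apply: (@le_lt_trans _ _ ((K * m ^+ (a + a).+1 * t) * t ^+ k.+1)).
    rewrite [t ^+ _ * _]mulrC mulrA -[leRHS]mulrA -exprS.
    rewrite ler_wpM2l ?mulr_ge0 ?exprn_ge0 //.
    by apply: ler_wiXn2l; rewrite ?(ltW t0).
  rewrite ltr_pM2r ?exprn_gt0 //; apply: t2P.
  by rewrite (ltW t0).
rewrite add_lastZ /suspension drop_add_last last_add_last exprMn yE.
by rewrite mulrC divfK ?expf_neq0 // subrr.
Qed.

(** For small t the remainder, of order a + 1, is at most half of the main term |t|^a |fm x|. *)
Lemma initial_lower_bound x : fm x != 0 -> exists2 t0 : R, 0 < t0 &
  forall t : C, `|t| <= rC t0 -> `|t| ^+ a * `|fm x| <= 2 * `|f (t *: x)|.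
Proof.
move=> fx; have nf : 0 < `|fm x| by rewrite normr_gt0.
have [c c0 cE] := gt0_rC nf; have [m m0 mE] := ge0_rC (normr_ge0 x).
have [rho [K [rho0 _ K0 HK]]] := order_ge_mono (order_ge_initial fa f0) ltr01.
have [t1 t10 t1P] := small_factor m0 rho0.
have [t2 t20 t2P] := small_factor (mulr_ge0 K0 (exprn_ge0 a.+1 m0)) (divr_gt0 c0 (ltr0n R 2)).
exists (Num.min t1 t2) => [|t]; first by rewrite lt_min t10.
have [s s0 sE] := ge0_rC (normr_ge0 t); rewrite sE rC_le le_min => /andP[st1 st2].
have tx : `|t *: x| <= rC rho.
  by rewrite normrZ sE mE -rCM rC_le mulrC ltW //; apply: t1P; rewrite s0.
have [d d0 dE] := ge0_rC (normr_ge0 (f (t *: x))).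
have := HK _ tx; rewrite -/a -/fm normrZ sE mE -rCM -rCX -rCM => h.
have : rC (s ^+ a * c) <= rC (d + K * (s * m) ^+ a.+1).
  rewrite rCM rCX -cE -sE -normrX -normrM -homogeneous_part_scale // -/fm rCD -dE.
  by rewrite -[fm _](subrK (f (t *: x))) addrC; apply: le_trans (ler_normD _ _) _; rewrite lerD2l distrC.
rewrite rC_le => h2; have h3 := t2P s; rewrite s0 st2 in h3.
rewrite dE cE -rCX -rCM -[2]/(1 + 1) -rC1 -rCD -rCM rC_le.
have {}h3 : K * m ^+ a.+1 * s <= c / 2 by rewrite ltW // h3.
have sa : 0 <= s ^+ a by rewrite exprn_ge0.
have h4 : K * (s * m) ^+ a.+1 <= s ^+ a * c / 2.
  have -> : K * (s * m) ^+ a.+1 = s ^+ a * (K * m ^+ a.+1 * s).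
    by rewrite exprMn [s ^+ a.+1]exprSr; move: (s ^+ a) (m ^+ a.+1) => u v; ring.
  by rewrite -[leRHS]mulrA ler_wpM2l.
exact: le_double_of_half h2 h4.
Qed.

(** On the line from [x] to a point where [fm] does not vanish, [fm] is a nonzero polynomial. It
    cannot vanish at all of the parameters d, d/2, d/3, ..., of which more are tried than it has
    roots. *)
Lemma dense_initial_neq0 x (eps : R) : 0 < eps ->
  exists2 x', `|x' - x| < rC eps & fm x' != 0.
Proof.
move=> eps0; have [fm0 _] := multiplicityP fa f0.
have [w fw] : exists w, fm w != 0.
  apply: contrapT => no; apply: fm0; apply/funext => y; apply/eqP.
  by apply: contrapT => /negP h; apply: no; exists y.
have /analytic_germP[s fs] := fa.
have fmE : fm = feval (s a) by exact: homogeneous_part_expansion.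
have [P _ PE] := feval_line x (w - x) (fs.1 a).
have P0 : P != 0.
  apply: contraNneq fw => P0; rewrite fmE -[w](subrK x) addrC -[w - x]scale1r -PE P0.
  by rewrite horner0.
have [m m0 mE] := ge0_rC (normr_ge0 (w - x)).
have [d d0 dP] := small_factor m0 eps0.
pose pts := [seq rC (d / i.+1%:R) | i <- iota 0 (size P)].
have [i iP Pi] : exists2 i, (i < size P)%N & P.[rC (d / i.+1%:R)] != 0.
  apply: contrapT => no.
  have := max_poly_roots P0 (rs := pts); rewrite size_map size_iota ltnn => F.
  apply: notF; apply: F.
    rewrite all_map; apply/allP => i; rewrite mem_iota /= => iP; rewrite rootE.
    by apply: contrapT => /negP h; apply: no; exists i.
  rewrite map_inj_uniq ?iota_uniq // => i j [] /(mulfI (lt0r_neq0 d0)) /invr_inj /eqP.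
  by rewrite eqr_nat eqSS => /eqP.
exists (x + rC (d / i.+1%:R) *: (w - x)); last by rewrite fmE -PE.
have di : 0 <= d / i.+1%:R <= d.
  by rewrite divr_ge0 ?(ltW d0) //= ler_pdivrMr ?ltr0n // ler_peMr ?(ltW d0) // ler1n.
rewrite addrC addKr normrZ mE ger0_norm -?rC0 ?rC_le ?(andP di).1 //.
by rewrite -rCM rC_lt mulrC; exact: dP.
Qed.

(** At t (x', z, 1) the equation is linear in z, with solution z = - t^(2a+1) / f(t x')^2. This is
    O(t) once f_a(x') is nonzero, which is why x is first moved to x'. *)
Lemma fiber_plane_mem k x : k = (a + a).+2 ->
  exceptional_fiber (suspension (twist f) k) (0, pt e (add_last (add_last x 0) 1)).
Proof.
move=> kE; apply: exceptional_fiber_mem.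
  apply/eqP => /(congr1 (@last_coord R (n + 1))); rewrite last_add_last last_coord0.
  by move/eqP; rewrite oner_eq0.
move=> eps eps0; have [x' x'x fx'] := dense_initial_neq0 x eps0.
have [t0 t00 t0P] := initial_lower_bound fx'.
have nf : 0 < `|fm x'| by rewrite normr_gt0.
have [c c0 cE] := gt0_rC nf.
have [t1 t10 t1P] := small_factor (ler0n R 4) (mulr_gt0 eps0 (exprn_gt0 2 c0)).
pose t := Num.min (eps / 2) (Num.min t0 t1).
have tpos : 0 < t by rewrite !lt_min t00 t10 divr_gt0.
have [te tt0 tt1] : [/\ t <= eps / 2, t <= t0 & t <= t1].
  by split; rewrite !ge_min lexx ?orbT.
have tC : 0 < rC t by rewrite -rC0 rC_lt.
have nt : `|rC t| = rC t by rewrite gtr0_norm.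
have := t0P (rC t); rewrite nt rC_le => /(_ tt0).
have [d d0 dE] := ge0_rC (normr_ge0 (f (rC t *: x'))).
rewrite dE cE -rCX -rCM -[2]/(1 + 1) -rC1 -rCD -rCM rC_le => lb.
have tac : 0 < t ^+ a * c by rewrite mulr_gt0 ?exprn_gt0.
have dpos : 0 < d := gt0_of_double tac lb.
have fn0 : f (rC t *: x') != 0 by rewrite -normr_gt0 dE -rC0 rC_lt.
pose z := - (rC t ^+ (a + a).+1 / f (rC t *: x') ^+ 2).
exists (rC t), (add_last (add_last x' z) 1); split.
- by rewrite gt_eqF.
- by rewrite nt rC_lt; exact: lt_of_le_half te.
- rewrite !add_lastB subrr subr0; apply: norm_add_last_lt; last by rewrite normr0 -rC0 rC_lt.
  apply: norm_add_last_lt => //.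
  rewrite /z normrN normrM normfV !normrX nt dE ltr_pdivrMr ?exprn_gt0 // -?rC0 ?rC_lt //.
  rewrite -!rCX -rCM rC_lt.
  have h1 : 1 * 4 * t < eps * c ^+ 2 by rewrite mul1r; apply: t1P; rewrite (ltW tpos).
  have ta : 0 < (t ^+ a) ^+ 2 by rewrite !exprn_gt0.
  have -> : t ^+ (a + a).+1 = t * (t ^+ a) ^+ 2 by rewrite exprS -exprM muln2 addnn.
  by rewrite -[_ * _ ^+ 2]mulr1; exact: (lt_mul_scale ta (ltW eps0) h1 (sqr_le_double tac lb)).
rewrite !add_lastZ /suspension drop_add_last last_add_last /twist drop_add_last last_add_last.
by rewrite mulr1 /z kE exprS cancel_division.
Qed.

(** Here z0 stays fixed and t is solved for. At (s w, t z0, t) the equation reads t^(2a+1) = - z0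
    f(s w)^2, so |t| has the size of s^(2a/(2a+1)); hence t tends to 0 (as a > 0), and so does the
    x-part s w / t of the direction. *)
Lemma fiber_axis_mem k (z0 : C) : k = (a + a).+2 -> f 0 = 0 -> z0 != 0 ->
  exceptional_fiber (suspension (twist f) k) (0, pt e (add_last (add_last 0 z0) 1)).
Proof.
move=> kE f00 z00; apply: exceptional_fiber_mem.
  apply/eqP => /(congr1 (@last_coord R (n + 1))); rewrite last_add_last last_coord0.
  by move/eqP; rewrite oner_eq0.
move=> eps eps0; have [w _ fw] := dense_initial_neq0 0 eps0.
have a0 : (0 < a)%N by exact: multiplicity_gt0.
have [s0 s00 s0P] := initial_lower_bound fw.
have nf : 0 < `|fm w| by rewrite normr_gt0.
have [c c0 cE] := gt0_rC nf; have [m m0 mE] := ge0_rC (normr_ge0 w).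
have nz : 0 < `|z0| by rewrite normr_gt0.
have [z z1 zE] := gt0_rC nz.
have of_ : order_ge a f.
  have := order_geD (order_ge_weaken (leqnSn a) (order_ge_initial fa f0))
    (order_ge_homogeneous_part a fa).
  by congr order_ge; apply/funext => x; rewrite subrK.
have [rho [K [rho0 _ K0 HK]]] := order_ge_mono of_ ltr01.
pose N := (a + a).+1.
have eN : 0 < eps ^+ N by rewrite exprn_gt0.
have Km0 : 0 <= K * m ^+ a by rewrite mulr_ge0 ?exprn_ge0.
have [s1 s10 s1P] := small_factor m0 rho0.
have [s2 s20 s2P] := small_factor (mulr_ge0 (ltW z1) (exprn_ge0 2 Km0)) eN.
have [s3 s30 s3P] := small_factor (mulr_ge0 (exprn_ge0 N m0) (ler0n R 4))
  (mulr_gt0 (mulr_gt0 eN z1) (exprn_gt0 2 c0)).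
pose s := Num.min (Num.min 1 s0) (Num.min s1 (Num.min s2 s3)).
have spos : 0 < s by rewrite !lt_min ltr01 s00 s10 s20 s30.
have [ss ss0 ss1 ss2 ss3] : [/\ s <= 1, s <= s0, s <= s1, s <= s2 & s <= s3].
  by split; rewrite !ge_min lexx ?orbT.
have sC : 0 < rC s by rewrite -rC0 rC_lt.
have ns : `|rC s| = rC s by rewrite gtr0_norm.
have := s0P (rC s); rewrite ns rC_le => /(_ ss0).
have [d d0 dE] := ge0_rC (normr_ge0 (f (rC s *: w))).
rewrite dE cE -rCX -rCM -[2]/(1 + 1) -rC1 -rCD -rCM rC_le => lb.
have sac : 0 < s ^+ a * c by rewrite mulr_gt0 ?exprn_gt0.
have dpos : 0 < d := gt0_of_double sac lb.
have fn0 : f (rC s *: w) != 0 by rewrite -normr_gt0 dE -rC0 rC_lt.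
have ub : d <= K * m ^+ a * s.
  have sw : `|rC s *: w| <= rC rho.
    by rewrite normrZ ns mE -rCM rC_le mulrC ltW //; apply: s1P; rewrite (ltW spos).
  have := HK _ sw; rewrite normrZ ns mE dE -rCM -rCX -rCM rC_le => h.
  apply: le_trans h _; rewrite exprMn mulrCA mulrC ler_wpM2l //.
  by rewrite -[leRHS]expr1; apply: ler_wiXn2l; rewrite ?(ltW spos).
(* The upper bound [ub] on f(s w) makes t small; the lower bound [lb] makes s / t small. *)
have [t tE] := exists_root (a + a) (- (z0 * f (rC s *: w) ^+ 2)).
have ntE : `|t| ^+ N = rC (z * d ^+ 2).
  by rewrite -normrX tE normrN normrM normrX zE dE rCM rCX.
have zd : 0 < rC (z * d ^+ 2) by rewrite -rC0 rC_lt mulr_gt0 ?exprn_gt0.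
have tn0 : t != 0.
  by apply: contraTneq zd => t0; rewrite -ntE t0 normr0 /N expr0n ltxx.
exists t, (add_last (add_last ((rC s / t) *: w) z0) 1); split => //.
- apply: (@lt_exprn2 _ (a + a)); first by rewrite -rC0 rC_le ltW.
  rewrite -/N ntE -rCX rC_lt.
  have h := s2P s; rewrite (ltW spos) ss2 in h.
  apply: le_lt_trans (h _) => //; rewrite -mulrA ler_wpM2l ?(ltW z1) //.
  have : d ^+ 2 <= (K * m ^+ a * s) ^+ 2 by rewrite lerXn2r // nnegrE mulr_ge0 // ltW.
  move=> /le_trans; apply; rewrite exprMn ler_wpM2l ?exprn_ge0 //.
  by rewrite expr2 ler_piMr ?(ltW spos).
- rewrite !add_lastB !subrr subr0; apply: norm_add_last_lt; last by rewrite normr0 -rC0 rC_lt.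
  apply: norm_add_last_lt; last by rewrite normr0 -rC0 rC_lt.
  rewrite normrZ normrM normfV ns mE.
  have -> : rC s / `|t| * rC m = `|rC s / t * rC m|.
    by rewrite !normrM normfV ns [`|rC m|]ger0_norm // -rC0 rC_le.
  apply: (@lt_exprn2 _ (a + a)); first by rewrite -rC0 rC_le ltW.
  rewrite -/N !normrM normfV ns [`|rC m|]ger0_norm -?rC0 ?rC_le // mulrAC exprMn exprVn ntE.
  rewrite ltr_pdivrMr // -rCM -!rCX -rCM rC_lt exprMn.
  have h := s3P s; rewrite (ltW spos) ss3 in h; have {}h := h isT.
  have -> : s ^+ N = s * (s ^+ a) ^+ 2 by rewrite /N exprS -exprM muln2 addnn.
  have sa : 0 < (s ^+ a) ^+ 2 by rewrite !exprn_gt0.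
  rewrite mulrA; apply: (lt_mul_scale sa _ h (sqr_le_double sac lb)).
  by rewrite mulr_ge0 ?ltW.
rewrite !add_lastZ /suspension drop_add_last last_add_last /twist drop_add_last last_add_last.
have -> : t *: ((rC s / t) *: w) = rC s *: w by rewrite scalerA mulrCA divff // mulr1.
rewrite mulr1 kE [t ^+ _]exprS -/N tE.
by rewrite mulrN mulrCA -mulrBr [z0 * _]mulrC subrr mulr0.
Qed.

End Fibers.

(** * Affine charts of projective space and the comparison of fibers *)

Section AffineChart.
Variables (R : realType) (N n : nat).
Local Notation C := (Cplx R).
Variables (l : 'rV[C]_N -> C) (L : 'rV[C]_N -> 'rV[C]_n).
Hypothesis l_linear : forall (a : C) u v, l (a *: u + v) = a * l u + l v.
Hypothesis L_linear : forall (a : C) u v, L (a *: u + v) = a *: L u + L v.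

Definition affine_chart v := (l v)^-1 *: L v.

Lemma affine_chart_invariant (c : C) v : c != 0 -> l v != 0 ->
  l (c *: v) != 0 /\ affine_chart (c *: v) = affine_chart v.
Proof.
move=> c0 lv.
have l0 : l 0 = 0 by have := l_linear (-1) 0 0; rewrite scaler0 addr0 mulN1r addNr.
have L0 : L 0 = 0 by have := L_linear (-1) 0 0; rewrite scaler0 addr0 scaleN1r addNr.
have lc : l (c *: v) = c * l v by have := l_linear c v 0; rewrite !addr0 l0 addr0.
have Lc : L (c *: v) = c *: L v by have := L_linear c v 0; rewrite !addr0 L0 addr0.
split; first by rewrite lc mulf_neq0.
by rewrite /affine_chart lc Lc scalerA invfM mulrAC mulVf // mul1r.
Qed.

Lemma near_affine_chart (X : topologicalType) (s : X * projective R N) :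
  l (rep s.2) != 0 -> \forall t \near s,
    {for t, continuous (fun t : X * projective R N => affine_chart (rep t.2))} /\
    l (rep t.2) != 0.
Proof.
move=> ls.
have lc v : {for v, continuous l} by exact: linear_continuous_rV.
have Lc v : {for v, continuous L} by exact: linear_continuous_rV.
pose D := [set v | l v != 0].
have ac v : D v -> {for v, continuous affine_chart}.
  by move=> lv; exact: (cvgZ (cvgV lv (lc v)) (Lc v)).
have Do : open D.
  rewrite openE => v /= lv.
  have nl : nbhs (l v) [set z : C | z != 0].
    have [r r0 E] := gt0_rC (etrans (normr_gt0 (l v)) lv).
    apply/nbhs_rC; exists r => // w; rewrite -E distrC => h.
    by apply: contraTneq h => ->; rewrite subr0 ltxx.
  exact: (lc v _ nl).
have H c : D (rep c) -> {for c, continuous (affine_chart \o @rep R N)} /\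
    \forall c' \near c, D (rep c').
  by apply: continuous_rep => // v b b0 Dv; exact: affine_chart_invariant.
have sc (t : X * projective R N) : {for t, continuous snd} by exact: cvg_snd.
have [_ nD] := H _ ls.
apply: (filterS _ (near_continuous (sc s) nD)) => t Dt.
have [ct _] := H _ Dt.
exact: conj (@continuous_comp _ _ _ snd (affine_chart \o @rep R N) t (sc t) ct) Dt.
Qed.

Lemma affine_chart_pt e v : v != 0 -> l v != 0 ->
  l (rep (pt e v)) != 0 /\ affine_chart (rep (pt e v)) = affine_chart v.
Proof. by move=> v0 lv; have [c c0 ->] := rep_pt e v0; exact: affine_chart_invariant. Qed.

End AffineChart.

Section ProjectiveContradiction.
Variables (R : realType) (n : nat).
Local Notation C := (Cplx R).
Local Notation X := ('rV[C]_(n + 1 + 1) * projective R (n + 1 + 1))%type.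
Variables (q : 'rV[C]_n -> C) (a : nat) (w : 'rV[C]_n).
Hypothesis a0 : (0 < a)%N.
Hypothesis qh : forall c x, q (c *: x) = c ^+ a * q x.
Hypothesis qw : q w != 0.
Variables (A B : set X) (e : punctured R (n + 1 + 1)).
Hypothesis Acone : forall p, A p -> p.1 = 0 /\ twist q (drop_last (rep p.2)) = 0.
Hypothesis Aplane : forall x, A (0, pt e (add_last (add_last x 0) 1)).
Hypothesis Aaxis : forall z, z != 0 -> A (0, pt e (add_last (add_last 0 z) 1)).
Hypothesis Bhyperplane : forall p, B p -> p.1 = 0 /\ last_coord (rep p.2) = 0.
Hypothesis hyperplaneB : forall u, u != 0 -> B (0, pt e (add_last u 0)).

(** The homeomorphism may send the singular point anywhere in the target hyperplane, so the affine
    chart there divides by whichever coordinate is nonzero, moved to the last place. *)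
Lemma exists_swap m (u : 'rV[C]_(m + 1)) : u != 0 ->
  exists sw : 'rV[C]_(m + 1) -> 'rV[C]_(m + 1),
    [/\ forall (c : C) u v, sw (c *: u + v) = c *: sw u + sw v,
        involutive sw & last_coord (sw u) != 0].
Proof.
move=> u0; have [j uj] : exists j, u 0 j != 0.
  apply: contrapT => no; case/eqP: u0; apply/rowP => j; rewrite mxE.
  by apply/eqP; apply: contrapT => /negP h; apply: no; exists j.
exists (col_perm (tperm j (rshift m ord0))); split => [c v v'|v|].
- by apply/rowP => i; rewrite !mxE.
- by apply/rowP => i; rewrite !mxE tpermK.
- by rewrite /last_coord mxE tpermR.
Qed.

Lemma add_last1_neq0 m (u : 'rV[C]_m) : add_last u 1 != 0.
Proof.
by apply/eqP => /(congr1 (@last_coord R m)); rewrite last_add_last last_coord0 => /eqP; rewrite oner_eq0.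
Qed.

Lemma add_last_neq0 m (u : 'rV[C]_m) y : u != 0 -> add_last u y != 0.
Proof.
by apply: contraNneq => /(congr1 (@drop_last R m)); rewrite drop_add_last drop_last0 => ->.
Qed.

Lemma exceptional_fibers_not_homeo : ~ homeomorphic_sets A B.
Proof.
move=> [h [k hk]]; have [hB _ _ _ _] := hk.
pose jota (u : 'rV[C]_(n + 1)) : X := (0, pt e (add_last u 1)).
pose iota (x : 'rV[C]_n) : X := jota (add_last x 0).
have jc u : {for u, continuous jota}.
  have ac : {for u, continuous (fun u => add_last u 1 : 'rV[C]_(n + 1 + 1))}.
    have -> : (fun u => add_last u 1 : 'rV[C]_(n + 1 + 1)) =
        (fun u : 'rV[C]_(n + 1) => add_last u 0 + add_last 0 1).
      by apply/funext => v; rewrite add_lastD addr0 add0r.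
    have lc : {for u, continuous (fun u => add_last u 0 : 'rV[C]_(n + 1 + 1))}.
      by apply: linear_continuous_rV => c v v'; rewrite add_lastZ add_lastD mulr0 addr0.
    exact: (cvgD lc (@cst_continuous 'rV[C]_(n + 1) 'rV[C]_(n + 1 + 1) (add_last 0 1) u)).
  have pc : {for u, continuous (pt e \o (fun u => add_last u 1 : 'rV[C]_(n + 1 + 1)))}.
    apply: (@continuous_comp _ _ _ (fun u => add_last u 1 : 'rV[C]_(n + 1 + 1)) (pt e) u ac).
    exact/continuous_pt/add_last1_neq0.
  exact: (cvg_pair (@cst_continuous 'rV[C]_(n + 1) 'rV[C]_(n + 1 + 1) 0 u) pc).
have ic x : {for x, continuous iota}.
  have ac : {for x, continuous (fun x => add_last x 0 : 'rV[C]_(n + 1))}.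
    by apply: linear_continuous_rV => c v v'; rewrite add_lastZ add_lastD mulr0 addr0.
  exact: (@continuous_comp _ _ _ (fun x => add_last x 0 : 'rV[C]_(n + 1)) jota x ac (jc _)).
(* In the chart y = 1 around [0 : 0 : 1], the map [L] is the same slide as for the cone, and
   [iota x] is [x : 0 : 1]. *)
pose l (v : 'rV[C]_(n + 1 + 1)) := last_coord v.
pose L (v : 'rV[C]_(n + 1 + 1)) := slide w (drop_last v).
have ll (c : C) u v : l (c *: u + v) = c * l u + l v.
  by rewrite /l last_coordD last_coordZ.
have Ll (c : C) u v : L (c *: u + v) = c *: L u + L v.
  by rewrite /L drop_lastD drop_lastZ slideD slideZ.
pose hv := drop_last (rep (h (iota 0)).2).
have Bh : B (h (iota 0)) by apply: hB; exact: Aplane.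
have hv0 : hv != 0.
  apply: contraTneq (rep_neq0 (h (iota 0)).2) => E.
  by rewrite -[rep _]add_lastK (Bhyperplane Bh).2 -/hv E add_last0 eqxx.
have [sw [swl swK swh]] := exists_swap hv0.
(* The chart of the projectivized hyperplane at the image point: y is dropped, and the swapped last
   coordinate is normalized to 1. *)
pose l' (v : 'rV[C]_(n + 1 + 1)) := last_coord (sw (drop_last v)).
pose L' (v : 'rV[C]_(n + 1 + 1)) := drop_last (sw (drop_last v)).
have ll' (c : C) u v : l' (c *: u + v) = c * l' u + l' v.
  by rewrite /l' drop_lastD drop_lastZ swl last_coordD last_coordZ.
have Ll' (c : C) u v : L' (c *: u + v) = c *: L' u + L' v.
  by rewrite /L' drop_lastD drop_lastZ swl drop_lastD drop_lastZ.
have sw0 : sw 0 = 0 by have := swl (-1) 0 0; rewrite scaler0 addr0 scaleN1r addNr.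
have swZ c v : sw (c *: v) = c *: sw v by have := swl c v 0; rewrite !addr0 sw0 addr0.
have lrep : l (rep (iota 0).2) != 0.
  apply: (affine_chart_pt ll Ll e (add_last1_neq0 _) _).1.
  by rewrite /l last_add_last oner_neq0.
have nl := near_affine_chart ll Ll (s := iota 0) lrep.
have nl' := near_affine_chart ll' Ll' (s := h (iota 0)) swh.
pose j' (u : 'rV[C]_n) : 'rV[C]_(n + 1 + 1) := add_last (sw (add_last u 1)) 0.
have j'0 u : sw (add_last u 1) != 0.
  by apply: contraNneq (add_last1_neq0 u) => E; rewrite -[add_last u 1]swK E sw0.
have j'c u : {for u, continuous (fun u => (0, pt e (j' u)) : X)}.
  have ac : {for u, continuous j'}.
    have -> : j' = (fun u : 'rV[C]_n => add_last (sw (add_last u 0)) 0 + j' 0).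
      apply/funext => v; rewrite /j' add_lastD addr0 -[sw (add_last v 0)]scale1r -swl.
      by rewrite scale1r add_lastD addr0 add0r.
    have lc : {for u, continuous (fun u => add_last (sw (add_last u 0)) 0 : 'rV[C]_(n + 1 + 1))}.
      apply: linear_continuous_rV => c v v'.
      by rewrite add_lastZ add_lastD mulr0 addr0 -swl add_lastZ add_lastD mulr0 addr0.
    exact: (cvgD lc (@cst_continuous 'rV[C]_n 'rV[C]_(n + 1 + 1) (j' 0) u)).
  have pc : {for u, continuous (pt e \o j')}.
    by apply: (@continuous_comp _ _ _ j' (pt e) u ac); exact/continuous_pt/add_last_neq0.
  exact: (cvg_pair (@cst_continuous 'rV[C]_n 'rV[C]_(n + 1 + 1) 0 u) pc).
apply: (@no_homeo_to_chart R n X X A B h k hk (iota 0) (Aplane 0) iota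
  (fun s => affine_chart l L (rep s.2)) (fun t => affine_chart l' L' (rep t.2))
  (fun u => (0, pt e (j' u)))).
- by [].
- by apply: filterE => x; exact: ic.
- by apply: filterE => x; exact: Aplane.
- by apply: filterS nl => s [].
- apply: filterE => x; rewrite (affine_chart_pt ll Ll e (add_last1_neq0 _) _).2.
    by rewrite /affine_chart /l /L last_add_last invr1 scale1r drop_add_last slide_plane.
  by rewrite /l last_add_last oner_neq0.
- apply: filterS nl => -[s1 s2] /= [_ ls] As.
  have [/= -> ts] := Acone As; rewrite /affine_chart => /eqP.
  rewrite scaler_eq0 invr_eq0 (negbTE ls) /= => /eqP Ls.
  have d0 := slide_eq0 a0 qh qw ts Ls.
  congr pair; rewrite -(pt_rep e s2) -(@ptZ _ _ e _ _ ls (add_last1_neq0 _)).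
  by congr pt; rewrite -[LHS]add_lastK d0 !add_lastZ !scaler0 !mulr0 !mulr1 add_last0.
- move=> M M0.
  have jM : nbhs (0 : 'rV[C]_(n + 1)) [set u | M (jota u)].
    have M0' : nbhs (jota 0) M by rewrite -(add_last0 R n).
    exact: (jc 0 _ M0').
  have [r r0 rP] := (nbhs_rC _ _).1 jM.
  have r2 : 0 < rC (r / 2) by rewrite -rC0 rC_lt divr_gt0.
  (* The point [0 : r/2 : 1] lies on the axis component near [0 : 0 : 1], while points of [iota]
     have z = 0 in every representative. *)
  exists (jota (add_last 0 (rC (r / 2)))); split.
  + by apply: Aaxis; rewrite gt_eqF.
  + apply: rP; rewrite subr0; apply: norm_add_last_lt; first by rewrite normr0 -rC0 rC_lt.
    by rewrite gtr0_norm // rC_lt; lra.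
  + move=> x [] /(congr1 (@rep R _)).
    have [c c0 ->] := rep_pt e (add_last1_neq0 (add_last x 0 : 'rV[C]_(n + 1))).
    have [d d0 ->] := rep_pt e (add_last1_neq0 (add_last 0 (rC (r / 2)) : 'rV[C]_(n + 1))).
    move=> /(congr1 (fun v => last_coord (drop_last v))).
    rewrite !drop_lastZ !drop_add_last !last_coordZ !last_add_last mulr0 => /esym/eqP.
    by rewrite mulf_eq0 (negbTE d0) gt_eqF.
- by apply: filterS nl' => t [].
- by apply: filterE => u; exact: j'c.
- by apply: filterE => u; apply: hyperplaneB.
- apply: filterE => u.
  have E : sw (drop_last (j' u)) = add_last u 1 by rewrite /j' drop_add_last swK.
  rewrite (affine_chart_pt ll' Ll' e (add_last_neq0 _ (j'0 u)) _).2.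
    by rewrite /affine_chart /l' /L' E last_add_last drop_add_last invr1 scale1r.
  by rewrite /l' E last_add_last oner_neq0.
- apply: filterS nl' => -[t1 t2] /= [_ lt] Bt.
  have [/= -> y0] := Bhyperplane Bt; congr pair.
  set v := rep t2 in lt y0 *; rewrite -(pt_rep e t2) -/v.
  have lV : (l' v)^-1 != 0 by rewrite invr_eq0.
  rewrite -(@ptZ _ _ e _ _ lV (rep_neq0 t2)) -/v; congr pt.
  rewrite -[_ *: v]add_lastK drop_lastZ last_coordZ y0 mulr0 /j'; congr add_last.
  rewrite -[RHS]swK; congr sw; rewrite swZ -[sw (drop_last v)]add_lastK.
  by rewrite add_lastZ -/(l' v) mulVf.
Qed.

End ProjectiveContradiction.

(** * The theorem *)

Definition cone_or_fiber_homeo (R : realType) : Prop :=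
  forall (n : nat) (f g : 'rV[Cplx R]_n -> Cplx R)
         (phi : 'rV[Cplx R]_n -> 'rV[Cplx R]_n),
     (1 <= n)%N ->
     reduced_germ f -> reduced_germ g ->
     germ_homeo setT setT phi -> germ_eq f (g \o phi) ->
     linear_subspace (tangent_cone f) \/ linear_subspace (tangent_cone g) ->
     (exists h, germ_homeo (tangent_cone f) (tangent_cone g) h) \/
     homeomorphic_sets (exceptional_fiber f) (exceptional_fiber g).

(** Only this strict inequality has to be excluded; the opposite one follows by exchanging the germs
    and inverting [phi]. *)
Lemma multiplicity_not_lt (R : realType) n (f g : 'rV[Cplx R]_n -> Cplx R) phi :
  cone_or_fiber_homeo R -> reduced_germ f -> reduced_germ g ->
  germ_homeo setT setT phi -> germ_eq f (g \o phi) ->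
  ~ (multiplicity f < multiplicity g)%N.
Proof.
move=> HB [fa f00 f0 _] [ga g00 g0 _] phiH fg ab.
pose a := multiplicity f; pose k := (a + a).+2.
pose F := suspension (twist f) k; pose G := suspension (twist g) k.
(* From a < b, in integers, 2a + 2 <= 2b: this places y^k strictly below the order 2b + 1 of
   [twist g]. *)
have kb : (k <= multiplicity g + multiplicity g)%N by rewrite /k /a; lia.
have a0 : (0 < a)%N by exact: multiplicity_gt0.
have t0 (q : 'rV[Cplx R]_n -> Cplx R) : q 0 = 0 -> twist q 0 = 0.
  by move=> q0; rewrite /twist drop_last0 q0 expr0n mul0r.
have Fr : reduced_germ F.
  exact: (reduced_suspension (ltn0Sn _) (analytic_twist fa) (t0 _ f00) (twist_neq0 fa f0)).
have Gr : reduced_germ G.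
  exact: (reduced_suspension (ltn0Sn _) (analytic_twist ga) (t0 _ g00) (twist_neq0 ga g0)).
have [Fa _ F0 _] := Fr; have [Ga _ G0 _] := Gr.
pose q := homogeneous_part f a.
have [q_neq0 _] := multiplicityP fa f0.
have [w qw] : exists w, q w != 0.
  apply: contrapT => no; apply: q_neq0; apply/funext => y; apply/eqP.
  by apply: contrapT => /negP h; apply: no; exists y.
have qh c x : q (c *: x) = c ^+ a * q x by exact: homogeneous_part_scale.
have [mF iF] := suspension_twist_initial fa f0 (erefl k).
have [mG iG] := suspension_power_initial ga g0 kb.
have cF : tangent_cone F = cone q by rewrite /tangent_cone -/F mF iF.
have cG : tangent_cone G = @hyperplane R n.
  rewrite /tangent_cone mG iG; apply/seteqP; split => v /=.
    by move/eqP; rewrite expf_eq0 /= => /eqP.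
  by rewrite /hyperplane /zero_set /= => ->; rewrite expr0n.
have n1 : (1 <= n + 1 + 1)%N by rewrite addn1.
have lin : linear_subspace (tangent_cone F) \/ linear_subspace (tangent_cone G).
  by right; rewrite cG; exact: linear_subspace_hyperplane.
have [[h hH]|fib] := HB _ F G (lift_last (lift_last phi)) n1 Fr Gr
  (germ_homeo_lift_last (germ_homeo_lift_last phiH)) (suspension_lift k (twist_lift fg)) lin.
  by rewrite cF cG in hH; exact: (cone_not_germ_homeo a0 qh qw hH).
pose e := punct (add_last1_neq0 (0 : 'rV[Cplx R]_(n + 1))).
apply: (exceptional_fibers_not_homeo a0 qh qw (e := e) _ _ _ _ _ fib).
- move=> p /(exceptional_fiber_subset Fa F0)[p0]; rewrite mF iF => tp.
  by split.
- by move=> x; exact: fiber_plane_mem.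
- by move=> z z0; exact: fiber_axis_mem.
- move=> p /(exceptional_fiber_subset Ga G0)[p0]; rewrite mG iG => /eqP.
  by rewrite expf_eq0 => /andP[_ /eqP].
- by move=> u u0; exact: fiber_power_mem.
Qed.

Theorem theorem1p2 (R : realType) :
  (forall (n : nat) (f g : 'rV[Cplx R]_n -> Cplx R)
          (phi : 'rV[Cplx R]_n -> 'rV[Cplx R]_n),
     (1 <= n)%N ->
     reduced_germ f -> reduced_germ g ->
     germ_homeo setT setT phi -> germ_eq f (g \o phi) ->
     linear_subspace (tangent_cone f) \/ linear_subspace (tangent_cone g) ->
     (exists h, germ_homeo (tangent_cone f) (tangent_cone g) h) \/
     homeomorphic_sets (exceptional_fiber f) (exceptional_fiber g)) ->
  (forall (n : nat) (f g : 'rV[Cplx R]_n -> Cplx R)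
          (phi : 'rV[Cplx R]_n -> 'rV[Cplx R]_n),
     (1 <= n)%N ->
     reduced_germ f -> reduced_germ g ->
     germ_homeo setT setT phi -> germ_eq f (g \o phi) ->
     multiplicity f = multiplicity g).
Proof.
move=> HB n f g phi _ fr gr phiH fg.
have fg' := multiplicity_not_lt HB fr gr phiH fg.
have [ph0 [U [V [k [[Uo U0] [Vo V0] [hU kV hK kK [hc kc]]]]]]] := phiH.
have k0 : k 0 = 0 by rewrite -ph0 hK.
rewrite !setTI in hU kV hK kK hc kc.
have kH : germ_homeo setT setT k.
  by split => //; exists V, U, phi; rewrite !setTI.
(* Near 0 the point [k y] lies where [f = g \o phi], by continuity of [k] at 0, and [phi (k y) = y]
   there. *)
have gf : germ_eq g (f \o k).
  have kn : {for 0, continuous k}.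
    have Vn0 : \forall y \near (0 : 'rV[Cplx R]_n), V y by apply: open_nbhs_nbhs.
    have ci : {for 0, continuous (fun x : 'rV[Cplx R]_n => x)} := cvg_id.
    exact: (@continuous_within_comp _ _ _ V (fun x => x) k 0 kc ci Vn0).
  have fgk : nbhs (k 0) [set x | f x = g (phi x)] by rewrite k0.
  have Vn : nbhs (0 : 'rV[Cplx R]_n) V by apply: open_nbhs_nbhs.
  by apply: (filterS _ (near_and (near_continuous kn fgk) Vn)) => y [/= -> Vy]; rewrite kK.
have gf' := multiplicity_not_lt HB gr fr kH gf.
case: (ltngtP (multiplicity f) (multiplicity g)) => [ab|ab|E].
- case: (fg' ab).
- case: (gf' ab).
- exact: E.
Qed.
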